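(* Let $f\in L_2(\Omega)$ and assume that there are $C_{\mathrm{PF}}>0$ and $c_{\mathrm{is}}>0$ such that \[ \|v\|\le C_{\mathrm{PF}}\|Av\|\quad\forall v\in H_0(A),\qquad \sup_{w\in H(A^* ),\ \|w\|_{A^*}=1}(A^*w,v)\ge c_{\mathrm{is}}\|v\|\quad\forall v\in L_2(\Omega). \] Let $\mathcal U(\mathcal T):=L_2(\Omega)\times L_2(\Omega;U)\times H_0(A,\mathcal S)\times H(A^*,\mathcal S)$, $\mathcal V(\mathcal T):=\widetilde H(A,\mathcal T)\times\widetilde H(A^*,\mathcal T)$ and, for $\boldsymbol u=(u,w,\phi,\psi)\in\mathcal U(\mathcal T)$ and $\boldsymbol{\delta v}=(\delta u,\delta w)\in\mathcal V(\mathcal T)$, \[ b(\boldsymbol u,\boldsymbol{\delta v}):=(\mathcal C^{-1}w,\delta w)-(u,A^*\delta w)_{\mathcal T}-\langle\phi,\delta w\rangle_{\mathcal S}-(w,A\delta u)_{\mathcal T}-\langle\psi,\delta u\rangle_{\mathcal S},\qquad L(\boldsymbol{\delta v}):=-(f,\delta u). \] Let $\boldsymbol u=(u,w,\phi,\psi)\in\mathcal U(\mathcal T)$ be the solution of $b(\boldsymbol u,\boldsymbol{\delta v})=L(\boldsymbol{\delta v})$ for all $\boldsymbol{\delta v}\in\mathcal V(\mathcal T)$. Let $\mathcal V_h(\mathcal T)\subset\mathcal V(\mathcal T)$ and $\mathcal U_h(\mathcal T)\subset\mathcal U(\mathcal T)$ be finite-dimensional subspaces, and assume that there is an operator $\mathcal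 F:\mathcal V(\mathcal T)\to\mathcal V_h(\mathcal T)$ and a constant $C_{\mathrm F}>0$ independent of $\mathcal T$ and the discrete subspaces with \[ b(\boldsymbol{\delta u},\boldsymbol v-\mathcal F\boldsymbol v)=0\quad\forall\boldsymbol{\delta u}\in\mathcal U_h(\mathcal T),\ \forall\boldsymbol v\in\mathcal V(\mathcal T),\qquad \|\mathcal F\boldsymbol v\|_{\mathcal V(\mathcal T)}\le C_{\mathrm F}\|\boldsymbol v\|_{\mathcal V(\mathcal T)}\quad\forall\boldsymbol v\in\mathcal V(\mathcal T). \] Then the scheme: find $\boldsymbol v_h\in\mathcal V_h(\mathcal T)$ and $\boldsymbol u_h\in\mathcal U_h(\mathcal T)$ such that \[ \langle\!\langle\boldsymbol v_h,\boldsymbol{\delta v}\rangle\!\rangle_{\mathcal V(\mathcal T)}+b(\boldsymbol u_h,\boldsymbol{\delta v})=L(\boldsymbol{\delta v})\quad\forall\boldsymbol{\delta v}\in\mathcal V_h(\mathcal T),\qquad b(\boldsymbol{\delta u},\boldsymbol v_h)=0\quad\forall\boldsymbol{\delta u}\in\mathcal U_h(\mathcal T) \] has a unique solution $(\boldsymbol v_h,\boldsymbol u_h)$ with components $\boldsymbol u_h=(u_h,w_h,\phi_h,\psi_h)$. It satisfies \[ \|\boldsymbol u-\boldsymbol u_h\|_{\mathcal U(\mathcal T)}^2=\|u-u_h\|^2+\|w-w_h\|^2+\|\phi-\phi_h\|_{A,\mathcal S}^2+\|\psi-\psi_h\|_{A^*,\mathcal S}^2\le C\|\boldsymbol u-\boldsymbol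 w\|_{\mathcal U(\mathcal T)}^2 \] for any $\boldsymbol w\in\mathcal U_h(\mathcal T)$ with a constant $C>0$ that is independent of $f$, $\mathcal T$, and the discrete subspaces.
   Context: Setting. $\Omega\subset\mathbb R^d$ ($d\in\mathbb N$) is a bounded Lipschitz domain and $U\in\{\mathbb R,\mathbb R^d,\mathbb R^{d\times d}\}$ or $U=\mathbb S:=\{w\in\mathbb R^{d\times d}: w=w^\top\}$. $A$ is a linear differential operator with constant coefficients taking scalar functions to $U$-valued functions, and $A^*$ is its formal adjoint (taking $U$-valued functions to scalar functions); both are applied in the distributional sense. $(\cdot,\cdot)$ and $\|\cdot\|$ are the $L_2(\Omega)$ inner product and norm (for scalar or $U$-valued functions). Set $H(A)=\{v\in L_2(\Omega): Av\in L_2(\Omega;U)\}$ with $\|v\|_A^2=\|v\|^2+\|Av\|^2$, and $H(A^* )=\{w\in L_2(\Omega;U): A^*w\in L_2(\Omega)\}$ with $\|w\|_{A^*}^2=\|w\|^2+\|A^*w\|^2$. The trace operator $\gamma_{A,\Gamma}:H(A)\to H(A^* )^*$ is $\langle\gamma_{A,\Gamma}(v),w\rangle_\Gamma:=(Av,w)-(v,A^*w)$, and $H_0(A):=\{v\in H(A):\gamma_{A,\Gamma}(v)=0\}$. $\mathcal C\in L_\infty(\Omega;U\times U)$ is a symmetric, (uniformly) positive definite tensor field, acting pointwise as a linear map $U\to U$, with pointwise inverse $\mathcal C^{-1}$. $\mathcal T=\{T\}$ is a regular mesh of polyhedral elements covering $\Omega$, with skeleton $\mathcal S=\bigcup\{\partial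 T: T\in\mathcal T\}$. $(\cdot,\cdot)_{\mathcal T}$ is the sum over $T\in\mathcal T$ of the $L_2(T)$ inner products, differential operators inside it being taken elementwise, and $\|\cdot\|_{\mathcal T}^2=(\cdot,\cdot)_{\mathcal T}$. Set $H(A,\mathcal T)=\{v\in L_2(\Omega): A(v|_T)\in L_2(T;U)\ \forall T\in\mathcal T\}$ with $\|v\|_{A,\mathcal T}^2=\|v\|^2+\|Av\|_{\mathcal T}^2$ and $H(A^*,\mathcal T)=\{w\in L_2(\Omega;U): A^*(w|_T)\in L_2(T)\ \forall T\in\mathcal T\}$ with $\|w\|_{A^*,\mathcal T}^2=\|w\|^2+\|A^*w\|_{\mathcal T}^2$. $\widetilde H(A,\mathcal T)$ and $\widetilde H(A^*,\mathcal T)$ are given closed subspaces with $H_0(A)\subset\widetilde H(A,\mathcal T)\subset H(A,\mathcal T)$ and $H(A^* )\subset\widetilde H(A^*,\mathcal T)\subset H(A^*,\mathcal T)$. Trace operators: $\gamma_{A,\mathcal S}:H(A)\to\widetilde H(A^*,\mathcal T)^*$, $\langle\gamma_{A,\mathcal S}(v),w\rangle_{\mathcal S}:=(Av,w)-(v,A^*w)_{\mathcal T}$, and $\gamma_{A^*,\mathcal S}:H(A^* )\to\widetilde H(A,\mathcal T)^*$, $\langle\gamma_{A^*,\mathcal S}(w),v\rangle_{\mathcal S}:=(A^*w,v)-(w,Av)_{\mathcal T}$. Trace spaces: $H(A,\mathcal S):=\gamma_{A,\mathcal S}(H(A))$, $H_0(A,\mathcal S):=\gamma_{A,\mathcal S}(H_0(A))$,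 $H(A^*,\mathcal S):=\gamma_{A^*,\mathcal S}(H(A^* ))$ with norms $\|\phi\|_{A,\mathcal S}:=\inf\{\|v\|_A: v\in H(A),\ \gamma_{A,\mathcal S}(v)=\phi\}$ and $\|\psi\|_{A^*,\mathcal S}:=\inf\{\|w\|_{A^*}: w\in H(A^* ),\ \gamma_{A^*,\mathcal S}(w)=\psi\}$. For trace-space elements, $\langle\phi,w\rangle_{\mathcal S}:=\langle\gamma_{A,\mathcal S}(v),w\rangle_{\mathcal S}$ for any $v\in H(A)$ with $\gamma_{A,\mathcal S}(v)=\phi$ ($w\in\widetilde H(A^*,\mathcal T)$), and $\langle\psi,v\rangle_{\mathcal S}:=\langle\gamma_{A^*,\mathcal S}(w),v\rangle_{\mathcal S}$ for any $w\in H(A^* )$ with $\gamma_{A^*,\mathcal S}(w)=\psi$ ($v\in\widetilde H(A,\mathcal T)$). Norms on products: $\|(u,w,\phi,\psi)\|_{\mathcal U(\mathcal T)}^2=\|u\|^2+\|w\|^2+\|\phi\|_{A,\mathcal S}^2+\|\psi\|_{A^*,\mathcal S}^2$ and $\|(\delta u,\delta w)\|_{\mathcal V(\mathcal T)}^2=\|\delta u\|_{A,\mathcal T}^2+\|\delta w\|_{A^*,\mathcal T}^2$; $\langle\!\langle\cdot,\cdot\rangle\!\rangle_{\mathcal V(\mathcal T)}$ is the inner product inducing $\|\cdot\|_{\mathcal V(\mathcal T)}$. Under the two stated assumptions with $C_{\mathrm{PF}}$ and $c_{\mathrm{is}}$, the continuous problem has a unique solution. *)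

(* Defs.v *)
From HB Require Import structures.
From mathcomp Require Import all_boot all_order all_algebra.
From mathcomp Require Import all_classical all_reals all_analysis.
Set Implicit Arguments.
Unset Strict Implicit.
Unset Printing Implicit Defensive.
Import Order.TTheory GRing.Theory Num.Theory.
Import numFieldNormedType.Exports.
Local Open Scope classical_set_scope.
Local Open Scope ring_scope.

(* Throughout the space dimension is d = n.+1 and points are row vectors. *)

Section Lebesgue.
Context {R : realType} {n : nat}.
Local Notation Rd := 'rV[R]_n.+1.

Definition box (a b : Rd) : set Rd :=
  [set x | forall i, a 0 i <= x 0 i <= b 0 i].

Definition covering_boxes (X : set Rd) : set (Rd * Rd) :=
  [set ab : Rd * Rd | (forall i, ab.1 0 i <= ab.2 0 i) /\ X `<=` box ab.1 ab.2].

(* the least volume of a box containing X; +oo if X is unbounded *)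
Definition box_volume (X : set Rd) : \bar R :=
  ereal_inf [set (\prod_i (ab.2 0 i - ab.1 0 i))%:E | ab in covering_boxes X].

Lemma box_volume_ge0 X : (0 <= box_volume X)%E.
Proof.
apply: le_ereal_inf_tmp => _ [ab [leab _] <-]; rewrite lee_fin.
by apply: prodr_ge0 => i _; rewrite subr_ge0.
Qed.

Lemma box_volume0 : box_volume set0 = 0%E.
Proof.
apply/eqP; rewrite eq_le box_volume_ge0 andbT; apply: ereal_inf_lbound.
exists (0, 0); first by split=> //= i; rewrite mxE.
by rewrite /= (bigD1 ord0)//= subrr mul0r.
Qed.

(* Lebesgue outer measure.  mu_ext restricts the covering sets to the
   measurable ones; declaring every set measurable lifts the restriction, and
   enlarging each covering set to a box gives the infimum over countable
   covers by boxes. *)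
Local Notation Rd_discrete := (g_sigma_algebraType [set: set Rd]).
Definition lebesgue_outer : set Rd -> \bar R :=
  @mu_ext _ Rd_discrete R box_volume.

Lemma lebesgue_outer0 : lebesgue_outer set0 = 0%E.
Proof. exact: (@mu_ext0 _ Rd_discrete R box_volume box_volume0 box_volume_ge0). Qed.

Lemma lebesgue_outer_ge0 X : (0 <= lebesgue_outer X)%E.
Proof. exact: (@mu_ext_ge0 _ Rd_discrete R box_volume box_volume_ge0). Qed.

Lemma le_lebesgue_outer : {homo lebesgue_outer : A B / A `<=` B >-> (A <= B)%E}.
Proof. exact: (@le_mu_ext _ Rd_discrete R box_volume). Qed.

Lemma lebesgue_outer_subadd : sigma_subadditive lebesgue_outer.
Proof.
exact: (@mu_ext_sigma_subadditive _ Rd_discrete R box_volume box_volume_ge0).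
Qed.

HB.instance Definition _ := isOuterMeasure.Build R Rd lebesgue_outer
  lebesgue_outer0 lebesgue_outer_ge0 le_lebesgue_outer lebesgue_outer_subadd.

(* R^d with the sigma-algebra of the Lebesgue measurable sets *)
Definition lebT : Type := caratheodory_type lebesgue_outer.
HB.instance Definition _ := Measurable.on lebT.

Definition leb : set lebT -> \bar R := lebesgue_outer.
HB.instance Definition _ := isMeasure.Build _ lebT R leb
  (@caratheodory_measure0 _ _ lebesgue_outer)
  (@caratheodory_measure_ge0 _ _ lebesgue_outer)
  (@caratheodory_measure_sigma_additive _ _ lebesgue_outer).

Local Notation meas := (@measurable _ lebT).

Lemma box_volume_split (X : set Rd) (i : 'I_n.+1) (c : R) :
  (box_volume (X `&` [set x : Rd | x 0 i < c]%R) +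
   box_volume (X `&` ~` [set x : Rd | x 0 i < c]%R) <= box_volume X)%E.
Proof.
apply: le_ereal_inf_tmp => _ [[a b] /= [leab Xab] <-].
pose m := Num.max (a 0 i) (Num.min (b 0 i) c).
have am : a 0 i <= m by rewrite le_max lexx.
have mb : m <= b 0 i by rewrite ge_max leab ge_min lexx.
pose b' := \row_j (if j == i then m else b 0 j).
pose a' := \row_j (if j == i then m else a 0 j).
have -> : \prod_j (b 0 j - a 0 j) =
    \prod_j (b' 0 j - a 0 j) + \prod_j (b 0 j - a' 0 j).
  have pE (F : 'I_n.+1 -> R) : \prod_j F j = F i * \prod_(j | j != i) F j.
    by rewrite (bigD1 i).
  rewrite !pE.
  have -> : \prod_(j | j != i) (b' 0 j - a 0 j) = \prod_(j | j != i) (b 0 j - a 0 j).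
    by apply: eq_bigr => j /negPf ji; rewrite !mxE ji.
  have -> : \prod_(j | j != i) (b 0 j - a' 0 j) = \prod_(j | j != i) (b 0 j - a 0 j).
    by apply: eq_bigr => j /negPf ji; rewrite !mxE ji.
  by rewrite -mulrDl !mxE eqxx; congr (_ * _); rewrite [RHS]addrC addrA subrK.
rewrite EFinD leeD//; apply: ereal_inf_lbound.
- exists (a, b') => //; split => /= [j|x [Xx xc] j].
    by rewrite mxE; case: eqP => [->|].
  have := Xab _ Xx j; rewrite mxE; case: eqP => [->|//] /andP[-> xb] /=.
  by rewrite le_max le_min xb (ltW xc) orbT.
- exists (a', b) => //; split => /= [j|x [Xx /negP]].
    by rewrite mxE; case: eqP => [->|].
  rewrite -leNgt => cx j.
  have := Xab _ Xx j; rewrite mxE; case: eqP => [->|//] /andP[ax ->].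
  by rewrite ge_max ax ge_min cx orbT.
Qed.

Lemma measurable_halfspace (i : 'I_n.+1) (c : R) : meas [set x : Rd | x 0 i < c].
Proof.
apply: le_caratheodory_measurable => X.
apply: le_ereal_inf_tmp => _ [A [mA XA] <-].
set H := [set x : Rd | _].
apply: (@le_trans _ _ (\sum_(k <oo) (box_volume (A k `&` H) +
                        box_volume (A k `&` ~` H)))%E); last first.
  by apply: lee_nneseries => k _ //;
    [rewrite adde_ge0 ?box_volume_ge0|exact: box_volume_split].
rewrite nneseriesD; try by move=> *; exact: box_volume_ge0.
apply: leeD; apply: ereal_inf_lbound.
- exists (fun k => A k `&` H) => //; split; first by move=> k; exact: sub_sigma_algebra.
  by rewrite -setI_bigcupl; exact: setSI.
- exists (fun k => A k `&` ~` H) => //; split; first by move=> k; exact: sub_sigma_algebra.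
  by rewrite -setI_bigcupl; exact: setSI.
Qed.

Lemma open_measurable_leb (U : set Rd) : open U -> meas U.
Proof.
move=> oU.
pose B (ab : 'rV[rat]_n.+1 * 'rV[rat]_n.+1) : set Rd :=
  [set x | forall i, ratr (ab.1 0 i) < x 0 i < ratr (ab.2 0 i)].
have mB ab : meas (B ab).
  pose G (i : 'I_n.+1) := [set x : Rd | x 0 i < ratr (ab.2 0 i)] `&`
    \bigcup_k ~` [set x : Rd | x 0 i < ratr (ab.1 0 i) + k.+1%:R^-1].
  have -> : B ab = \bigcap_i G i.
    apply/seteqP; split => x /=.
      move=> Bx i _; have /andP[ax xb] := Bx i; split => //.
      have [m hm] := ltr_add_invr ax; exists m => //=.
      by apply/negP; rewrite -leNgt ltW.
    move=> + i => /(_ i I) /= [-> [k _ /negP]]; rewrite -leNgt andbT.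
    by apply: lt_le_trans; rewrite ltrDl invr_gt0 ltr0n.
  apply: fin_bigcap_measurable => // i _.
  apply: measurableI; first exact: measurable_halfspace.
  by apply: bigcup_measurable => k _; apply: measurableC; exact: measurable_halfspace.
have -> : U = \bigcup_(ab in [set ab | B ab `<=` U]) B ab.
  apply/seteqP; split => [x Ux|x [ab]]; last exact.
  have /nbhs_ballP[e e0 xeU] := open_nbhs_nbhs (conj oU Ux).
  have qe i : {q : rat * rat | x 0 i - e < ratr q.1 < x 0 i /\
                               x 0 i < ratr q.2 < x 0 i + e}.
    apply: cid.
    have /rat_in_itvoo[q1 q1P] : x 0 i - e < x 0 i by rewrite ltrBlDr ltrDl.
    have /rat_in_itvoo[q2 q2P] : x 0 i < x 0 i + e by rewrite ltrDl.
    by exists (q1, q2); move: q1P q2P; rewrite !in_itv.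
  exists (\row_i (sval (qe i)).1, \row_i (sval (qe i)).2); last first.
    move=> i /=; rewrite !mxE; case: (qe i) => q /= [/andP[_ ->] /andP[-> _]] //.
  move=> y /= yB; apply: xeU; split=> // i j.
  have := yB j; rewrite !mxE ord1; case: (qe j) => q /=.
  move=> [/andP[a1 a2] /andP[a3 a4]] /andP[b1 b2].
  rewrite /ball/= ltr_distl; apply/andP; split.
    by rewrite ltrBlDr (lt_trans b2)// -?ltrBlDr.
  by rewrite -ltrBlDr (lt_trans a1).
rewrite -[bigcup _ _]/(\bigcup_(ab in _) _) bigcup_mkcond.
apply: countable_bigcupT_measurable => [|ab]; first exact: countableP.
by case: ifP => _ //; exact: measurable0.
Qed.
End Lebesgue.

Structure opens (R : realType) (n : nat) :=
  Opens { oset :> set 'rV[R]_n.+1; oset_open : open oset }.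

Section L2space.
Context {R : realType} {n : nat}.
Implicit Types O : opens R n.

(* Functions are defined on the whole of R^d, but only their values on O count. *)
Definition leb_on O : {measure set (@lebT R n) -> \bar R} :=
  mrestr leb (open_measurable_leb (@oset_open _ _ O)).

Definition L2fun O := LfunType (leb_on O) (lee1n 2).
HB.instance Definition _ O := GRing.Lmodule.on (L2fun O).

Definition ae_null O : {pred L2fun O} :=
  fun f => `[< {ae leb_on O, forall x, f x = 0} >].

Lemma ae_null_zmod_closed O : zmod_closed (@ae_null O).
Proof.
split; first by apply/asboolP/aeW.
move=> f g /asboolP f0 /asboolP g0; apply/asboolP.
apply: filterS2 f0 g0 => x fx gx.
by have -> : (f - g) x = f x - g x by []; rewrite fx gx subr0.
Qed.
HB.instance Definition _ O := GRing.isZmodClosed.Build (L2fun O) (@ae_null O)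
  (@ae_null_zmod_closed O).

Lemma ae_nullZ O (a : R) f : f \in @ae_null O -> a *: f \in @ae_null O.
Proof.
move=> /asboolP f0; apply/asboolP; apply: filterS f0 => x fx.
by have -> : (a *: f) x = a * f x by []; rewrite fx mulr0.
Qed.

(* L_2(O): functions up to equality almost everywhere on O *)
Definition L2 O := Quotient.quot (@ae_null O).
HB.instance Definition _ O := GRing.Zmodule.on (L2 O).
HB.instance Definition _ O := EqQuotient.on (L2 O).

Local Open Scope quotient_scope.

Definition L2scale O (a : R) (u : L2 O) : L2 O := \pi_(L2 O) (a *: repr u).

Lemma L2scale_pi O a (f : L2fun O) : L2scale a (\pi_(L2 O) f) = \pi_(L2 O) (a *: f).
Proof.
apply/eqP; rewrite /L2scale -Quotient.idealrBE -scalerBr ae_nullZ//.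
by rewrite Quotient.idealrBE reprK.
Qed.

Lemma L2scaleA O a b (u : L2 O) : L2scale a (L2scale b u) = L2scale (a * b) u.
Proof. by rewrite [L2scale b u]/L2scale L2scale_pi scalerA. Qed.

Lemma L2scale1 O : left_id 1 (@L2scale O).
Proof. by move=> u; rewrite /L2scale scale1r reprK. Qed.

Lemma L2piD O (f g : L2fun O) :
  \pi_(L2 O) (f + g) = \pi_(L2 O) f + \pi_(L2 O) g.
Proof. exact: Quotient.pi_add. Qed.

Lemma L2scaleDr O : right_distributive (@L2scale O) +%R.
Proof.
move=> a u v; rewrite -[u]reprK -[v]reprK -L2piD !L2scale_pi.
by rewrite scalerDr L2piD.
Qed.

Lemma L2scaleDl O (u : L2 O) : {morph (@L2scale O)^~ u : a b / a + b}.
Proof. by move=> a b; rewrite /L2scale scalerDl L2piD. Qed.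

HB.instance Definition _ O := GRing.Zmodule_isLmodule.Build R (L2 O)
  (@L2scaleA O) (@L2scale1 O) (@L2scaleDr O) (@L2scaleDl O).

Definition L2rep O (u : L2 O) : 'rV[R]_n.+1 -> R := (repr u : L2fun O).

End L2space.
Coercion L2rep : L2 >-> Funclass.

Section Geometry.
Context {R : realType} {n : nat}.
Local Notation Rd := 'rV[R]_n.+1.

Definition dot m (x y : 'rV[R]_m) : R := \sum_i x 0 i * y 0 i.
Definition enorm m (x : 'rV[R]_m) : R := Num.sqrt (dot x x).

(* In the orthonormal coordinates y *m Q, the last one being vertical, Om is
   the strict epigraph of a Lipschitz function near x. *)
Definition lipschitz_epigraph_near (Om : set Rd) (x : Rd) : Prop :=
  exists (Q : 'M[R]_n.+1) (V : set Rd) (g : 'rV[R]_n -> R) (L : R),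
    [/\ Q *m Q^T = 1%:M, open V, V x,
        forall y z, `|g y - g z| <= L * enorm (y - z) &
        forall y, V y ->
          (Om y <-> g (col' ord_max (y *m Q)) < (y *m Q) 0 ord_max)].

Definition bounded_lipschitz_domain (Om : set Rd) : Prop :=
  [/\ open Om, Om !=set0, connected Om, bounded_set Om &
      forall x, (closure Om `\` Om) x -> lipschitz_epigraph_near Om x].

Definition polytope (P : set Rd) : Prop :=
  bounded_set P /\
  exists (m : nat) (c : 'I_m -> Rd) (b : 'I_m -> R),
    P = [set x | forall i, dot (c i) x <= b i].

(* Elements are open and need not be convex; slits are excluded. *)
Definition polyhedral_element (T : set Rd) : Prop :=
  [/\ open T, T !=set0, connected T, interior (closure T) = T &
      exists (m : nat) (P : 'I_m -> set Rd),
        (forall i, polytope (P i)) /\ closure T = \bigcup_i P i].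

Definition same_germ (P : set Rd) (x y : Rd) : Prop :=
  \forall z \near (0 : Rd), P (x + z) <-> P (y + z).

(* The closed faces of a polyhedron, of every dimension (P included): closures
   of the connected pieces along which P looks locally the same.  For a convex
   polytope these are its nonempty faces in the usual sense. *)
Definition is_face (P F : set Rd) : Prop :=
  exists x, P x /\ F = closure (connected_component (same_germ P x) x).

(* The last clause is conformity: two elements meet in a union of common faces
   (for convex elements: the intersection is empty or a single common face). *)
Definition regular_mesh (Om : set Rd) (N : nat) (T : 'I_N -> opens R n) : Prop :=
  [/\ forall i, polyhedral_element (T i) /\ T i `<=` Om,
      trivIset setT (fun i => T i : set Rd),
      closure Om = \bigcup_i closure (T i) &
      forall i j x, i != j -> (closure (T i) `&` closure (T j)) x ->
        exists F, [/\ is_face (closure (T i)) F, is_face (closure (T j)) F & F x]].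

End Geometry.

Definition multi_index (n : nat) : Type := 'I_n.+1 -> nat.

Section Operators.
Context {R : realType} {n : nat}.
Local Notation Rd := 'rV[R]_n.+1.

Definition pderiv (i : 'I_n.+1) (f : Rd -> R) : Rd -> R :=
  fun x => derive (f : Rd -> R^o) x (delta_mx 0 i).

Definition mi_order (al : multi_index n) : nat := (\sum_i al i)%N.
Definition mi_deriv (al : multi_index n) (f : Rd -> R) : Rd -> R :=
  foldr (fun i g => iter (al i) (pderiv i) g) f (enum 'I_n.+1).

Definition smooth (f : Rd -> R) : Prop :=
  forall s : seq 'I_n.+1, let g := foldr pderiv f s in
    continuous (g : Rd -> R^o) /\
    forall i x, derivable (g : Rd -> R^o) x (delta_mx 0 i).

Definition test_function (O : set Rd) (f : Rd -> R) : Prop :=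
  [/\ smooth f, compact (closure [set x | f x != 0]) &
      closure [set x | f x != 0] `<=` O].
End Operators.

(* The four choices of U.  Scalars are 1 x 1 matrices, vectors are columns. *)
Variant Ukind := Uscalar | Uvector | Utensor | Usym.

Definition urow (n : nat) (k : Ukind) : nat :=
  if k is Uscalar then 1 else n.+1.
Definition ucol (n : nat) (k : Ukind) : nat :=
  if k is (Uscalar | Uvector) then 1 else n.+1.

(* The entries are real numbers or elements of L_2. *)
Definition in_U (n : nat) (k : Ukind) (E : Type) :
    ('I_(urow n k) -> 'I_(ucol n k) -> E) -> Prop :=
  match k with
  | Usym => fun w => forall i j, w i j = w j i
  | _ => fun=> True
  end.
Arguments in_U {n} k {E}.

Notation Umat R n k := 'M[R]_(urow n k, ucol n k).

Section Fields.
Context {R : realType} {n : nat} {k : Ukind}.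
Local Notation Rd := 'rV[R]_n.+1.
Local Notation Umat := (Umat R n k).

Definition frob (M N : Umat) : R := \sum_i \sum_j M i j * N i j.

Definition ip (O : set Rd) (f g : Rd -> R) : R :=
  \int[leb]_(x in (O : set lebT)) (f x * g x).
Definition ipU (O : set Rd) (F G : Rd -> Umat) : R :=
  \int[leb]_(x in (O : set lebT)) frob (F x) (G x).

Definition L2mx (O : opens R n) : Type :=
  'I_(urow n k) -> 'I_(ucol n k) -> L2 O.
HB.instance Definition _ O := GRing.Lmodule.on (L2mx O).

Definition L2mxrep (O : opens R n) (w : L2mx O) : Rd -> Umat :=
  fun x => \matrix_(i, j) L2rep (w i j) x.

Definition norm2 (O : opens R n) (v : L2 O) : R := Num.sqrt (ip O v v).
Definition norm2U (O : opens R n) (w : L2mx O) : R :=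
  Num.sqrt (ipU O (L2mxrep w) (L2mxrep w)).

Definition test_functionU (O : set Rd) (F : Rd -> Umat) : Prop :=
  (forall x, in_U k (F x)) /\
  (forall i j, test_function O (fun x => F x i j)).

(* The tensor field is only relevant up to a null set and as a map U -> U. *)
Definition spd_tensor_field (Om : set Rd) (C : Rd -> Umat -> Umat) : Prop :=
  [/\ forall M N : Umat, in_U k M -> in_U k N ->
        measurable_fun (Om : set lebT) (fun x : lebT => frob (C x M) N),
      {ae leb, forall x : lebT, Om x ->
        (forall M : Umat, in_U k M -> in_U k (C x M)) /\
        (forall (a : R) (M N : Umat), in_U k M -> in_U k N ->
           C x (a *: M + N) = a *: C x M + C x N)},
      {ae leb, forall x : lebT, Om x -> forall M N : Umat, in_U k M -> in_U k N ->
        frob (C x M) N = frob M (C x N)},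
      exists c : R, {ae leb, forall x : lebT, Om x -> forall M : Umat, in_U k M ->
        frob (C x M) (C x M) <= c * frob M M} &
      exists2 c : R, 0 < c & {ae leb, forall x : lebT, Om x ->
        forall M : Umat, in_U k M -> c * frob M M <= frob (C x M) M}].

Definition tensor_inv (C : Rd -> Umat -> Umat) (x : Rd) (M : Umat) : Umat :=
  xget 0 [set N : Umat | in_U k N /\ C x N = M].

End Fields.
Arguments L2mx {R n} k O.

Definition L2U {R : realType} {n : nat} (k : Ukind) (O : opens R n) :
  set (L2mx k O) := [set w | in_U k w].

(* sum over s of coef s times the partial derivative of multi-index mi s *)
Record diffop (R : realType) (n : nat) (k : Ukind) := DiffOp {
  do_size : nat;
  do_mi : 'I_do_size -> multi_index n;
  do_coef : 'I_do_size -> Umat R n k;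
  do_coef_in : forall s, in_U k (do_coef s) }.

Section WeakOperators.
Context {R : realType} {n : nat} {k : Ukind} (A : diffop R n k).
Local Notation Rd := 'rV[R]_n.+1.
Local Notation Umat := (Umat R n k).
Implicit Types (O : opens R n).

(* A and A^* applied to smooth functions *)
Definition opA (f : Rd -> R) : Rd -> Umat :=
  fun x => \sum_(s < do_size A) mi_deriv (do_mi s) f x *: do_coef s.
Definition opAs (F : Rd -> Umat) : Rd -> R :=
  fun x => \sum_(s < do_size A) (-1) ^+ mi_order (do_mi s) *
    mi_deriv (do_mi s) (fun y => frob (do_coef s) (F y)) x.

(* g = A v, resp. g = A^* w, in the sense of distributions on O *)
Definition distrA O (v : Rd -> R) (g : L2mx k O) : Prop :=
  L2U g /\
  forall F, test_functionU O F -> ipU O (L2mxrep g) F = ip O v (opAs F).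
Definition distrAs O (w : Rd -> Umat) (g : L2 O) : Prop :=
  forall f, test_function O f -> ip O g f = ipU O w (opA f).

(* total: 0 where the distribution is not in L_2(O) *)
Definition weakA O (v : Rd -> R) : L2mx k O := xget 0 [set g | distrA v g].
Definition weakAs O (w : Rd -> Umat) : L2 O := xget 0 [set g | distrAs w g].

End WeakOperators.

Section Subspaces.
Context {R : realType}.

Definition is_subspace (E : lmodType R) (S : set E) : Prop :=
  S 0 /\ forall (a : R) x y, S x -> S y -> S (a *: x + y).
Definition closed_subspace (E : lmodType R) (norm : E -> R) (X S : set E) :=
  [/\ is_subspace S, S `<=` X &
      forall x, X x -> (forall e, 0 < e -> exists2 y, S y & norm (x - y) < e) ->
        S x].
Definition finite_dim_subspace (E : lmodType R) (X S : set E) : Prop :=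
  S `<=` X /\ exists (m : nat) (e : 'I_m -> E),
    S = [set x | exists c : 'I_m -> R, x = \sum_i c i *: e i].

(* Functionals on a subspace S are represented by their extension by zero
   outside S, so that equality of functionals on S is equality of functions. *)
Definition functional_on (E : Type) (S : set E) (l : E -> R) : E -> R^o :=
  patch (fun=> 0) S l.

End Subspaces.

Section Spaces.
Context {R : realType} {n : nat} {k : Ukind} (A : diffop R n k).
Variable Om : opens R n.
Local Notation L2mx := (L2mx k).

Definition HA : set (L2 Om) :=
  [set v | exists g : L2mx Om, distrA A v g].
Definition HAs : set (L2mx Om) :=
  [set w | L2U w /\ exists g : L2 Om, distrAs A (L2mxrep w) g].

Definition normA (v : L2 Om) : R :=
  Num.sqrt (norm2 v ^+ 2 + norm2U (weakA A Om v) ^+ 2).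
Definition normAs (w : L2mx Om) : R :=
  Num.sqrt (norm2U w ^+ 2 + norm2 (weakAs A Om (L2mxrep w)) ^+ 2).

Definition gammaA_Gamma (v : L2 Om) : L2mx Om -> R^o :=
  functional_on HAs (fun w => ipU Om (L2mxrep (weakA A Om v)) (L2mxrep w) -
                              ip Om v (weakAs A Om (L2mxrep w))).

Definition H0A : set (L2 Om) := [set v | HA v /\ gammaA_Gamma v = 0].

Variables (N : nat) (T : 'I_N -> opens R n).

Definition HAT : set (L2 Om) :=
  [set v | forall i, exists g : L2mx (T i), distrA A v g].
Definition HAsT : set (L2mx Om) :=
  [set w | L2U w /\ forall i, exists g : L2 (T i), distrAs A (L2mxrep w) g].

(* (w, A v)_T and (v, A^* w)_T, with A and A^* applied element by element *)
Definition ipT_A (w : L2mx Om) (v : L2 Om) : R :=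
  \sum_i ipU (T i) (L2mxrep w) (L2mxrep (weakA A (T i) v)).
Definition ipT_As (v : L2 Om) (w : L2mx Om) : R :=
  \sum_i ip (T i) v (weakAs A (T i) (L2mxrep w)).

Definition normAT (v : L2 Om) : R :=
  Num.sqrt (norm2 v ^+ 2 + \sum_i norm2U (weakA A (T i) v) ^+ 2).
Definition normAsT (w : L2mx Om) : R :=
  Num.sqrt (norm2U w ^+ 2 + \sum_i norm2 (weakAs A (T i) (L2mxrep w)) ^+ 2).

(* HtA and HtAs stand for the spaces with a tilde. *)
Variables (HtA : set (L2 Om)) (HtAs : set (L2mx Om)).

Definition gammaA_S (v : L2 Om) : L2mx Om -> R^o :=
  functional_on HtAs (fun w =>
    ipU Om (L2mxrep (weakA A Om v)) (L2mxrep w) - ipT_As v w).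
Definition gammaAs_S (w : L2mx Om) : L2 Om -> R^o :=
  functional_on HtA (fun v =>
    ip Om (weakAs A Om (L2mxrep w)) v - ipT_A w v).

Definition H0A_S : set (L2mx Om -> R^o) := gammaA_S @` H0A.
Definition HAs_S : set (L2 Om -> R^o) := gammaAs_S @` HAs.

Definition normA_S (phi : L2mx Om -> R^o) : R :=
  inf [set normA v | v in [set v | HA v /\ gammaA_S v = phi]].
Definition normAs_S (psi : L2 Om -> R^o) : R :=
  inf [set normAs w | w in [set w | HAs w /\ gammaAs_S w = psi]].

Definition trial : Type :=
  (L2 Om * L2mx Om * (L2mx Om -> R^o) * (L2 Om -> R^o))%type.
HB.instance Definition _ := GRing.Lmodule.on trial.
Definition test : Type := (L2 Om * L2mx Om)%type.
HB.instance Definition _ := GRing.Lmodule.on test.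

Definition UT : set trial :=
  [set x | let: (_, w, phi, psi) := x in [/\ L2U w, H0A_S phi & HAs_S psi]].
Definition VT : set test := HtA `*` HtAs.

Definition normUT (x : trial) : R :=
  let: (u, w, phi, psi) := x in
  Num.sqrt (norm2 u ^+ 2 + norm2U w ^+ 2 + normA_S phi ^+ 2 + normAs_S psi ^+ 2).
Definition normVT (y : test) : R :=
  Num.sqrt (normAT y.1 ^+ 2 + normAsT y.2 ^+ 2).
Definition ipVT (y z : test) : R :=
  ip Om y.1 z.1 +
  \sum_i ipU (T i) (L2mxrep (weakA A (T i) y.1)) (L2mxrep (weakA A (T i) z.1)) +
  (ipU Om (L2mxrep y.2) (L2mxrep z.2) +
   \sum_i ip (T i) (weakAs A (T i) (L2mxrep y.2)) (weakAs A (T i) (L2mxrep z.2))).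

Variable C : 'rV[R]_n.+1 -> Umat R n k -> Umat R n k.

Definition bform (x : trial) (y : test) : R :=
  let: (u, w, phi, psi) := x in let: (du, dw) := y in
  ipU Om (fun z => tensor_inv C z (L2mxrep w z)) (L2mxrep dw) - ipT_As u dw
  - phi dw - ipT_A w du - psi du.

Definition Lf (f : L2 Om) (y : test) : R := - ip Om f y.1.

Definition mixed_scheme (f : L2 Om) (Vh : set test) (Uh : set trial)
    (vh : test) (uh : trial) : Prop :=
  [/\ Vh vh, Uh uh,
      forall dv, Vh dv -> ipVT vh dv + bform uh dv = Lf f dv &
      forall du, Uh du -> bform du vh = 0].

End Spaces.

Arguments HA {R n k} A Om _.
Arguments HAs {R n k} A Om _.
Arguments H0A {R n k} A Om _.
Arguments HAT {R n k} A Om {N} T _.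
Arguments HAsT {R n k} A Om {N} T _.
Arguments UT {R n k} A Om {N} T HtA HtAs _.
Arguments trial {R n} k Om.
Arguments test {R n} k Om.

(* Main.v *)
Require Import Defs.
From HB Require Import structures.
From mathcomp Require Import all_boot all_order all_algebra.
From mathcomp Require Import all_classical all_reals all_analysis.
From mathcomp Require Import measurable_realfun.
From mathcomp Require Import ring lra.
Set Implicit Arguments.
Unset Strict Implicit.
Unset Printing Implicit Defensive.
Import Order.TTheory GRing.Theory Num.Theory.
Import numFieldNormedType.Exports.
Local Open Scope classical_set_scope.
Local Open Scope ring_scope.

(* The form [b] is inf-sup stable on [UT x VT] with a constant depending only on
   the Poincare constant and on [C].  For the field components [(u, w)], Riesz's
   theorem for the inner product [(C A v, A v')] on [H_0(A)] yields [du] such that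
   [dw = C (A du + w)] lies in [H(A^* )] with [A^* dw = - u]; on [(du, dw)] the trace
   terms vanish and [b] equals [|u|^2 + |w|^2].  For the trace [phi], its Riesz
   representative [dw] in the broken graph space satisfies [A (- A^*_T dw) = dw] in
   the sense of distributions, and [- A^*_T dw] has trace [phi] and norm [|dw|]; the
   trace [psi] is dealt with symmetrically.  A combination of these test functions
   bounds all components.  The Fortin operator transfers the stability to the
   discrete spaces, where solvability is linear algebra and quasi-optimality follows
   from the boundedness of [b].

   A weak derivative is unique because an L2 function orthogonal to all test
   functions vanishes: the indicator of an open set is a bounded pointwise limit of
   test functions.  Integration by parts against test functions rests on the
   translation invariance of the Lebesgue measure. *)

(** * Lebesgue measure *)

(** The delicate point is the cross terms: the test functions built for the traces also meet u and w
    in b. They enter with the factor -2, the traces having a minus sign in b. Young's inequality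
    spends half of the gain 2 |phi|^2 + 2 |psi|^2 and leaves a defect of at most |u|^2 + (1 +
    c_0^{-2}) |w|^2, where c_0 is the coercivity constant of C and |C^{-1} w| <= c_0^{-1} |w|. The
    field pair, weighted by 2 + c_0^{-2}, covers this defect. No mesh quantity appears: the field
    pair lives in unbroken spaces, and a trace extension has exactly the norm of its test function.

    Elementwise operators are treated as one closed relation on L_2(Omega), obtained by testing with
    functions supported in a single element. The skeleton being null makes this relation
    single-valued, and the one-element family yields the operators on Omega by the same arguments.
    The abstract spaces carry forms but no topology: limits are taken along sequences with
    increments bounded by 2^{-n}, with explicit error bounds. *)

Section LebesgueMeasure.
Context {R : realType} {n : nat}.
Local Notation Rd := 'rV[R]_n.+1.
Local Notation lebT := (@lebT R n).
Local Notation leb := (@leb R n).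
Implicit Types (X : set Rd) (t : Rd).

Definition translate t (x : Rd) : Rd := x + t.

Lemma translateK t : translate t \o translate (- t) = id.
Proof. by apply/funext => x /=; rewrite /translate subrK. Qed.

Lemma box_volume_translate_le t X :
  (box_volume (translate t @^-1` X) <= box_volume X)%E.
Proof.
apply: le_ereal_inf_tmp => _ [[a b] /= [leab Xab] <-].
apply: ereal_inf_lbound; exists (a - t, b - t); last first.
  by rewrite /=; congr _%:E; apply: eq_bigr => i _; rewrite !mxE; lra.
split=> /= [i|x /= /Xab xab i]; first by rewrite !mxE lerD2r.
by have := xab i; rewrite /translate !mxE; lra.
Qed.

Lemma lebesgue_outer_translate_le t X :
  (lebesgue_outer (translate t @^-1` X) <= lebesgue_outer X)%E.
Proof.
apply: le_ereal_inf_tmp => _ [A [mA XA] <-].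
apply: (@le_trans _ _ (\sum_(k <oo) box_volume (translate t @^-1` A k))%E).
  apply: ereal_inf_lbound; exists (fun k => translate t @^-1` A k) => //.
  split; first by move=> k; exact: sub_sigma_algebra.
  by move=> x /= /XA [k _ Akx]; exists k.
apply: lee_nneseries => k _; first by move=> _; exact: box_volume_ge0.
exact: box_volume_translate_le.
Qed.

(** Translating a cover gives one inequality; the other is the same inequality for [- t], applied to
    the preimage. *)
Lemma lebesgue_outer_translate t X :
  lebesgue_outer (translate t @^-1` X) = lebesgue_outer X.
Proof.
apply/eqP; rewrite eq_le lebesgue_outer_translate_le/=.
have := lebesgue_outer_translate_le (- t) (translate t @^-1` X).
by rewrite -comp_preimage translateK.
Qed.

(** Splitting [X] by the preimage of [E] is, up to a translation, splitting a translate of [X] by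
    [E]; the Caratheodory condition is thus inherited through the invariance of the outer
    measure. *)
Lemma measurable_translate t :
  measurable_fun setT (translate t : lebT -> lebT).
Proof.
move=> _ /= E mE; have -> : [set: lebT] `&` translate t @^-1` E =
  translate t @^-1` E by rewrite setTI.
move=> X /=.
have h : lebesgue_outer (translate (- t) @^-1` X) =
  (lebesgue_outer (translate (- t) @^-1` X `&` E) +
   lebesgue_outer (translate (- t) @^-1` X `&` ~` E))%E := mE _.
have tE Y : lebesgue_outer (X `&` translate t @^-1` Y) =
    lebesgue_outer (translate (- t) @^-1` X `&` Y).
  rewrite -(lebesgue_outer_translate (- t)); congr lebesgue_outer.
  by apply/seteqP; split=> x /=; rewrite /translate /= subrK.
rewrite -[LHS](lebesgue_outer_translate (- t)) h -tE; congr (_ + _)%E.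
by rewrite -tE.
Qed.

Lemma leb_translate t (E : set lebT) : leb (translate t @^-1` E) = leb E.
Proof. exact: lebesgue_outer_translate. Qed.

Lemma lebesgue_outer_le_box_volume X : (lebesgue_outer X <= box_volume X)%E.
Proof.
apply: ereal_inf_lbound; exists (fun k => if k == 0%N then X else set0).
  split; first by move=> k; exact: sub_sigma_algebra.
  by move=> x Xx; exists 0%N.
rewrite (@nneseriesD1 _ _ 0%N)//; last by move=> k _; exact: box_volume_ge0.
rewrite eqxx eseries0 ?adde0// => k _ /andP[_ /negPf ->].
exact: box_volume0.
Qed.

Lemma leb_box (a b : Rd) : (forall i, a 0 i <= b 0 i) ->
  (leb (box a b) <= (\prod_i (b 0 i - a 0 i))%:E)%E.
Proof.
move=> ab; apply: le_trans (lebesgue_outer_le_box_volume _) _.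
by apply: ereal_inf_lbound; exists (a, b) => //; split.
Qed.

Lemma measurable_closed_leb (E : set Rd) : closed E -> measurable (E : set lebT).
Proof.
move=> cE; rewrite -[E]setCK; apply: measurableC.
by apply: open_measurable_leb; exact: closed_openC.
Qed.

Lemma closed_box (a b : Rd) : closed (box a b).
Proof.
have -> : box a b = \bigcap_i ((fun x : Rd => x 0 i) @^-1` `[a 0 i, b 0 i]).
  apply/seteqP; split => x /=.
    by move=> xab i _ /=; rewrite in_itv /=.
  by move=> xab i; have := xab i I; rewrite /= in_itv.
apply: closed_bigI => i _; apply: preimage_closed => [x _|].
  exact: coord_continuous.
exact: itv_closed.
Qed.

Definition cube (r : R) : set Rd := box (const_mx (- r)) (const_mx r).

Lemma cubeP r (x : Rd) : cube r x <-> forall i, `|x 0 i| <= r.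
Proof. by split => xr i; have := xr i; rewrite !mxE ler_norml. Qed.

Lemma rV_le_norm (x : Rd) i : `|x 0 i| <= `|x|.
Proof.
rewrite {2}/Num.norm /= mx_normrE.
by apply: (@le_bigmax_cond _ _ _ _ (0, i)).
Qed.

Lemma bounded_sub_cube X : bounded_set X -> exists2 r, 0 < r & X `<=` cube r.
Proof.
move=> /pinfty_ex_gt0[M M0 XM]; exists M => // x Xx; apply/cubeP => i.
exact: le_trans (rV_le_norm x i) (XM _ Xx).
Qed.

Lemma leb_cube (r : R) : 0 <= r -> (leb (cube r) < +oo)%E.
Proof.
move=> r0; apply: le_lt_trans (leb_box _) _; last exact: ltry.
by move=> i; rewrite !mxE; lra.
Qed.

Lemma leb_bounded X : bounded_set X -> (leb X < +oo)%E.
Proof.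
move=> /bounded_sub_cube[r r0 Xr].
by apply: le_lt_trans (leb_cube (ltW r0)); exact: le_lebesgue_outer.
Qed.

Definition hyperplane (c : Rd) (b : R) : set Rd := [set x | dot c x = b].

Lemma dotD (c x y : Rd) : dot c (x + y) = dot c x + dot c y.
Proof. by rewrite /dot -big_split; apply: eq_bigr => i _ /=; rewrite !mxE mulrDr. Qed.

Lemma dotZ (c x : Rd) (a : R) : dot c (a *: x) = a * dot c x.
Proof. by rewrite /dot mulr_sumr; apply: eq_bigr => i _ /=; rewrite !mxE mulrCA. Qed.

Lemma dot_delta (c : Rd) i : dot c (delta_mx 0 i) = c 0 i.
Proof.
rewrite /dot (bigD1 i)//= big1 ?addr0 => [|j /negPf ji]; rewrite !mxE eqxx.
  by rewrite eqxx mulr1.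
by rewrite ji mulr0.
Qed.

Lemma continuous_dot (c : Rd) : continuous (dot c : Rd -> R^o).
Proof.
apply: continuous_big; first exact: add_continuous.
move=> i _ x; apply: (@continuousM R Rd); first exact: cst_continuous.
exact: coord_continuous.
Qed.

Lemma closed_hyperplane c b : closed (hyperplane c b).
Proof.
apply: (@preimage_closed _ _ (dot c : Rd -> R^o) [set b]).
  by move=> x _; exact: continuous_dot.
exact: closed_eq.
Qed.

(** [leb] is the outer measure, defined and monotone on all sets, so null sets are handled without
    measurability; [measurable_null] recovers it afterwards. *)
Lemma leb_null_sub X Y : X `<=` Y -> leb Y = 0%E -> leb X = 0%E.
Proof.
move=> XY Y0; apply/eqP; rewrite eq_le lebesgue_outer_ge0 andbT -Y0.
exact: le_lebesgue_outer.
Qed.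

Lemma leb_null_bigcup (F : nat -> set Rd) :
  (forall k, leb (F k) = 0%E) -> leb (\bigcup_k F k) = 0%E.
Proof.
move=> F0; apply/eqP; rewrite eq_le lebesgue_outer_ge0 andbT.
apply: le_trans (lebesgue_outer_subadd _) _.
by rewrite eseries0// => k _ _; exact: F0.
Qed.

Lemma leb_null_setU X Y : leb X = 0%E -> leb Y = 0%E -> leb (X `|` Y) = 0%E.
Proof.
move=> X0 Y0; apply: (@leb_null_sub _ (\bigcup_k (if k == 0%N then X else Y))).
  by move=> x [Xx|Yx]; [exists 0%N|exists 1%N].
by apply: leb_null_bigcup => k; case: ifP.
Qed.

Lemma leb_null_bigcup_fin m (F : 'I_m -> set Rd) :
  (forall k, leb (F k) = 0%E) -> leb (\bigcup_k F k) = 0%E.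
Proof.
move=> F0; pose G k := if insub k is Some i then F i else set0.
apply: (@leb_null_sub _ (\bigcup_k G k)).
  by move=> x [i _ Fx]; exists i => //; rewrite /G valK.
by apply: leb_null_bigcup => k; rewrite /G; case: insubP => // _; exact: lebesgue_outer0.
Qed.

Lemma measurable_null X : leb X = 0%E -> measurable (X : set lebT).
Proof.
move=> X0; apply: le_caratheodory_measurable => Y.
have YX : lebesgue_outer (Y `&` X) = 0%E by apply: leb_null_sub X0; exact: subIsetr.
rewrite [X in (X + _)%E]YX add0e.
by apply: le_lebesgue_outer; exact: subIsetl.
Qed.

Lemma negligible_null X : leb X = 0%E -> leb.-negligible (X : set lebT).
Proof. by move=> X0; apply/negligibleP => //; exact: measurable_null. Qed.

Lemma leb_hyperplane (c : Rd) (b : R) i : c 0 i != 0 ->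
  leb (hyperplane c b) = 0%E.
Proof.
move=> ci0.
pose H k := hyperplane c b `&` cube k%:R.
have cH k : measurable (H k : set lebT).
  by apply: measurable_closed_leb; apply: closedI;
    [exact: closed_hyperplane|exact: closed_box].
suff H0 k : leb (H k) = 0%E.
  apply: (@leb_null_sub _ (\bigcup_k H k)).
    move=> x cx; exists (Num.truncn `|x|).+1 => //; split=> //; apply/cubeP => j.
    by rewrite (le_trans (rV_le_norm _ _))// ltW// truncnS_gt.
  exact: leb_null_bigcup.
(* the translates of H k along the i-th axis are disjoint, of equal measure,
   and all contained in a cube *)
pose s j : R := j.+1%:R^-1.
pose F j := translate (s j *: delta_mx 0 i) @^-1` (H k).
have mF j : measurable (F j : set lebT).
  by rewrite -[X in measurable X]setTI; apply: measurable_translate.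
have tF : trivIset setT F.
  move=> j j' _ _ [x [[+ _] [+ _]]]; rewrite /hyperplane /translate /=.
  rewrite !dotD !dotZ dot_delta => <- /addrI /(mulIf ci0) /invr_inj.
  by move=> /eqP; rewrite eqr_nat eqSS => /eqP.
have Fsub : \bigcup_j F j `<=` cube (k%:R + 1).
  move=> x [j _ [_ /cubeP xk]]; apply/cubeP => l; have := xk l.
  rewrite /translate !mxE eqxx /=; set e := _ * _ => h.
  have e1 : `|e| <= 1.
    rewrite /e normrM [`|s j|]ger0_norm ?invr_ge0//.
    apply: (@le_trans _ _ (1 * 1)); last by rewrite mulr1.
    apply: ler_pM; rewrite ?invr_ge0//; first by rewrite invf_le1// ler1n.
    by case: (_ == _); rewrite ?normr1// normr0.
  have -> : x 0 l = x 0 l + e - e by rewrite addrK.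
  by rewrite (le_trans (ler_normB _ _))// lerD.
have := leb_cube (addr_ge0 (ler0n R k) ler01).
set V := leb (cube _) => Vfin.
have FV N : (N%:R%:E * leb (H k) <= V)%E.
  apply: (@le_trans _ _ (\sum_(0 <= j < N) leb (F j))%E).
    rewrite (eq_bigr (fun=> leb (H k))) => [|j _]; last exact: leb_translate.
    by rewrite sumr_const_nat subn0 mule_natl.
  apply: (@le_trans _ _ (leb (\bigcup_j F j))); last exact: le_lebesgue_outer.
  rewrite measure_bigcup//; apply: le_trans (nneseries_lim_ge _ _) _ => //.
  rewrite le_eqVlt; apply/orP; left; apply/eqP.
  by apply: eq_eseriesl => j; rewrite in_setT.
have V0 : (0 <= V)%E by exact: lebesgue_outer_ge0.
have Hfin : leb (H k) \is a fin_num.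
  rewrite ge0_fin_numE//; apply: le_lt_trans Vfin.
  by have := FV 1%N; rewrite mul1e.
have Vf : V \is a fin_num by rewrite ge0_fin_numE.
move: FV; rewrite -(fineK Hfin) -(fineK Vf) => FV.
congr _%:E; apply/eqP; rewrite eq_le fine_ge0// andbT leNgt; apply/negP => m0.
(* Archimedean choice: this many disjoint translates of a set of positive measure exceed the volume
   [V] of the cube. *)
have := FV (Num.truncn (fine V / fine (leb (H k)))).+1.
by rewrite -EFinM lee_fin leNgt -ltr_pdivrMr// truncnS_gt.
Qed.

Definition open_box (a b : Rd) : set Rd :=
  [set x | forall i, a 0 i < x 0 i < b 0 i].

Lemma open_open_box (a b : Rd) : open (open_box a b).
Proof.
have -> : open_box a b = ~` \bigcup_i (((fun x : Rd => x 0 i) @^-1` `]-oo, a 0 i]) `|`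
    ((fun x : Rd => x 0 i) @^-1` `[b 0 i, +oo[)).
  apply/seteqP; split => x /=.
    move=> xab [i _ /= [|]]; rewrite in_itv /=; have := xab i; lra.
  move=> nx i; apply/andP; split; rewrite ltNge; apply/negP => h; apply: nx.
    by exists i => //=; left; rewrite in_itv.
  by exists i => //=; right; rewrite in_itv/= h.
apply: closed_openC; apply: closed_bigcup => //.
    exact: finite_finset.
move=> i _; apply: closedU; apply: preimage_closed; try exact: interval_closed;
  by move=> x _; exact: coord_continuous.
Qed.

Lemma sub_open_box (a b : Rd) : open_box a b `<=` box a b.
Proof. by move=> x xab i; have := xab i; lra. Qed.

Lemma leb_box_boundary (a b : Rd) : leb (box a b `\` open_box a b) = 0%E.
Proof.
pose G (i : 'I_n.+1) := hyperplane (delta_mx 0 i) (a 0 i) `|`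
  hyperplane (delta_mx 0 i) (b 0 i).
have dC (i : 'I_n.+1) (x : Rd) : dot (delta_mx 0 i) x = x 0 i.
  by rewrite -dot_delta; apply: eq_bigr => j _; rewrite mulrC.
apply: (@leb_null_sub _ (\bigcup_i G i)).
  move=> x [xab /existsNP[i nxi]]; exists i => //.
  rewrite /G/hyperplane/= !dC; have := xab i; move: nxi.
  have [->|xa] := eqVneq (x 0 i) (a 0 i); first by left.
  have [->|xb] := eqVneq (x 0 i) (b 0 i); first by right.
  by rewrite !le_eqVlt eq_sym (negPf xa) (negPf xb).
apply: leb_null_bigcup_fin => i; apply: leb_null_setU;
  by apply: (@leb_hyperplane _ _ i); rewrite mxE !eqxx oner_eq0.
Qed.

(** The closed boxes of a nearly optimal cover are replaced by their interiors. This loses their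
    boundaries, which are null, and no box has to be enlarged; hence [X] is covered by [V] up to a
    null set. *)
Lemma outer_regular X e : (leb X < +oo)%E -> 0 < e ->
  exists V, [/\ open V, leb (X `\` V) = 0%E & (leb V <= leb X + e%:E)%E].
Proof.
move=> Xfin e0.
have Xf : leb X \is a fin_num by rewrite ge0_fin_numE//; exact: lebesgue_outer_ge0.
have [_ [A [_ XA] <-] sumA] := lb_ereal_inf_adherent (divr_gt0 e0 (ltr0n R 2)) Xf.
(* Half of [e] pays for the nearly optimal cover. The [d k] sum up to the other half and pay for
   replacing its members by boxes. *)
pose d k : R := e / 2 / (2 ^ k.+1)%:R.
have d0 k : 0 < d k by rewrite !divr_gt0// ltr0n expn_gt0.
have sum_fin : (\sum_(k <oo) box_volume (A k) < +oo)%E.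
  by apply: lt_trans sumA _; rewrite lte_add_pinfty// ltry.
have AE k : exists ab : Rd * Rd, covering_boxes (A k) ab /\
    ((\prod_i (ab.2 0 i - ab.1 0 i))%:E <= box_volume (A k) + (d k)%:E)%E.
  have Af : box_volume (A k) \is a fin_num.
    rewrite ge0_fin_numE ?box_volume_ge0//; apply: le_lt_trans sum_fin.
    apply: (@le_trans _ _ (\sum_(0 <= i < k.+1) box_volume (A i))%E).
      by rewrite big_nat_recr//= leeDr// sume_ge0// => i _; exact: box_volume_ge0.
    by apply: nneseries_lim_ge => i _ _; exact: box_volume_ge0.
  have [_ [ab cab <-] h] := lb_ereal_inf_adherent (d0 k) Af.
  by exists ab; split => //; exact: ltW.
have [ab abP] := choice AE.
exists (\bigcup_k open_box (ab k).1 (ab k).2); split.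
- by apply: bigcup_open => k _; exact: open_open_box.
- apply: (@leb_null_sub _ (\bigcup_k (box (ab k).1 (ab k).2 `\`
      open_box (ab k).1 (ab k).2))).
    move=> x [/XA[k _ Akx] nx]; exists k => //; split.
      by have [[_ +] _] := abP k; apply.
    by move=> h; apply: nx; exists k.
  by apply: leb_null_bigcup => k; exact: leb_box_boundary.
- apply: le_trans (lebesgue_outer_subadd _) _.
  apply: (@le_trans _ _ (\sum_(k <oo) (box_volume (A k) + (d k)%:E))%E).
    apply: lee_nneseries => [k _ _|k _]; first exact: lebesgue_outer_ge0.
    have [[lab _] h] := abP k; apply: le_trans h.
    apply: le_trans (leb_box lab); apply: le_lebesgue_outer; exact: sub_open_box.
  apply: le_trans (epsilon_trick xpredT _ _) _.
  + by move=> k; exact: box_volume_ge0.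
  + by rewrite divr_ge0// ltW.
  + by rewrite {2}(splitr e) EFinD addeA leeD2r// ltW.
Qed.

(** At a point where no constraint with nonzero normal is active, the strict inequalities persist
    nearby; boundary points thus lie on finitely many hyperplanes. A constraint with zero normal
    does not depend on the point, so its [G j] is empty. *)
Lemma leb_polytope_boundary (P : set Rd) : polytope P -> leb (P `\` interior P) = 0%E.
Proof.
move=> [_ [m [c [b ->]]]].
pose G j : set Rd := if c j == 0 then set0 else hyperplane (c j) (b j).
apply: (@leb_null_sub _ (\bigcup_j G j)); last first.
  apply: leb_null_bigcup_fin => j; rewrite /G; case: eqVneq => [_|cj0].
    exact: lebesgue_outer0.
  have /existsNP[i /eqP ci0] : ~ forall i, c j 0 i = 0.
    by move=> c0; move/eqP: cj0; apply; apply/rowP => i; rewrite mxE.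
  exact: leb_hyperplane ci0.
move=> x [Px nPx]; apply: contrapT => nG; apply: nPx.
pose W := ~` \bigcup_(j in [set j | c j != 0]) (dot (c j) @^-1` `[b j, +oo[ : set Rd).
have oW : open W.
  apply: closed_openC; apply: closed_bigcup.
    exact: finite_finset.
  move=> j _; apply: (@preimage_closed _ _ (dot (c j) : Rd -> R^o)).
    by move=> y _; exact: continuous_dot.
  exact: interval_closed.
have Wx : W x.
  move=> [j /= cj0]; rewrite in_itv/= andbT => bj; apply: nG; exists j => //.
  by rewrite /G (negPf cj0); apply/eqP; rewrite eq_le bj Px.
apply: filterS (open_nbhs_nbhs (conj oW Wx)) => y Wy j.
have [cj0|cj0] := eqVneq (c j) 0.
  have -> : dot (c j) y = dot (c j) x by rewrite cj0 /dot !big1// => i _; rewrite mxE mul0r.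
  exact: Px.
rewrite leNgt; apply/negP => bj; apply: Wy; exists j => //=.
by rewrite in_itv/= ltW.
Qed.

(** An interior point of one of the polytopes is interior to the closure of [T], hence belongs to
    [T], since an element is the interior of its closure. The boundary is therefore covered by the
    boundaries of the polytopes. *)
Lemma leb_polyhedral_boundary (T : set Rd) :
  polyhedral_element T -> leb (closure T `\` T) = 0%E.
Proof.
move=> [_ _ _ intT [m [P [polyP PE]]]].
apply: (@leb_null_sub _ (\bigcup_i (P i `\` interior (P i)))); last first.
  by apply: leb_null_bigcup_fin => i; exact: leb_polytope_boundary.
move=> x [+ nTx]; rewrite {1}PE => -[i _ Pix]; exists i => //; split => // iPx.
apply: nTx; rewrite -intT; move: iPx; apply: interiorS => y Py.
by rewrite PE; exists i.
Qed.

(** The closures of the elements cover [Om], so what the elements miss lies on their boundaries.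
    This is what lets elementwise integrals add up to integrals over [Om]. *)
Lemma leb_skeleton (Om : set Rd) N (T : 'I_N -> opens R n) :
  regular_mesh Om T -> leb (Om `\` \bigcup_i T i) = 0%E.
Proof.
move=> [polyT _ clOm _].
apply: (@leb_null_sub _ (\bigcup_i (closure (T i) `\` T i))); last first.
  by apply: leb_null_bigcup_fin => i; apply: leb_polyhedral_boundary; have [] := polyT i.
move=> x [/subset_closure + nTx]; rewrite clOm => -[i _ Tx]; exists i => //.
by split=> // Tix; apply: nTx; exists i.
Qed.

End LebesgueMeasure.

(** * Smooth functions *)

Section Flat.
Context {R : realType}.
Implicit Types (p : {poly R}) (t : R).

Lemma exprn_le_expR (n : nat) (y : R) : 0 <= y -> y ^+ n <= n`!%:R * expR y.
Proof.
move=> y0; case: n => [|n]; first by rewrite expr0 fact0 mul1r (le_trans _ (expR_ge1Dx y))// lerDl.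
rewrite mulrC -ler_pdivrMr ?ltr0n ?fact_gt0//.
by apply: le_trans (expR_ge1Dxn n y0); rewrite lerDr.
Qed.

Lemma poly_le_expR p : exists2 M, 0 <= M & forall y, 0 <= y -> `|p.[y]| <= M * expR y.
Proof.
exists (\sum_(i < size p) `|p`_i| * i`!%:R); first exact: sumr_ge0.
move=> y y0; rewrite horner_coef mulr_suml.
apply: le_trans (ler_norm_sum _ _ _) _; apply: ler_sum => i _.
rewrite normrM -mulrA ler_wpM2l// ger0_norm ?exprn_ge0//.
exact: exprn_le_expR.
Qed.

(* The family is closed under derivation, so smoothness follows by coinduction. *)
Definition flat p t : R := if 0 < t then p.[t^-1] * expR (- t^-1) else 0.

(** With y = 1/t, the polynomial y^2 p(y) is dominated by a multiple of exp(y). The quadratic decay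
    forces the derivative at 0 to vanish. *)
Lemma flat_bound p : exists2 M, 0 <= M & forall t, `|flat p t| <= M * t ^+ 2.
Proof.
have [M M0 pM] := poly_le_expR (p * 'X^2); exists M => // t; rewrite /flat.
case: ltP => t0; last by rewrite normr0 mulr_ge0// sqr_ge0.
have ti0 : 0 <= t^-1 by rewrite invr_ge0 ltW.
have := pM _ ti0; rewrite hornerM hornerXn normrM normrX (ger0_norm ti0) exprVn.
rewrite ler_pdivrMr ?exprn_gt0// normrM expRN => h.
rewrite [`|(expR _)^-1|]ger0_norm ?invr_ge0 ?expR_ge0// ler_pdivrMr ?expR_gt0//.
by apply: le_trans h _; rewrite mulrAC.
Qed.

(** With y = 1/t, so that y' = - y^2, the derivative of p(y) exp(-y) is y^2 (p - p')(y) exp(-y). At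
    the origin the difference quotient is bounded by M |t|. *)
Lemma is_derive_flat p t : is_derive t 1 (flat p) (flat ('X^2 * (p - p^`())) t).
Proof.
have [t0|t0|->] := ltgtP t 0.
- apply: (@near_eq_is_derive _ _ _ (cst 0)).
    near=> s; rewrite /flat ltNge ifF//; apply/negbF/ltW.
    by near: s; exact: lt_nbhsl.
  by rewrite /flat ltNge ltW//; exact: is_derive_cst.
- pose F := ((horner p \o (fun s : R => s^-1)) * (expR \o (fun s : R => - s^-1)) : R -> R).
  have dV : is_derive t 1 (fun s : R => s^-1) (- t ^- 2).
    have := @is_deriveV _ id t 1 1 (lt0r_neq0 t0) (is_derive_id _ _).
    by rewrite /= scaler1.
  apply: (@near_eq_is_derive _ _ _ F).
    near=> s; rewrite /flat /F ifT//.
    by near: s; exact: lt_nbhsr.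
  have dN : is_derive t 1 (fun s : R => - s^-1) (- - t ^- 2) := is_deriveN dV.
  have dF : is_derive t 1 F _ :=
    is_deriveM (is_derive1_comp (is_derive_poly p t^-1) dV)
      (@is_derive1_comp _ expR _ t _ _ (is_derive_expR (- t^-1)) dN).
  apply: is_derive_eq dF _.
  transitivity (p.[t^-1] * (expR (- t^-1) * t ^- 2) +
      expR (- t^-1) * (p^`().[t^-1] * - t ^- 2)); first by rewrite opprK.
  by rewrite /flat t0 hornerM hornerXn hornerD hornerN exprVn; ring.
- have [M M0 fM] := flat_bound p.
  have f0 q : flat q 0 = 0 by rewrite /flat ltxx.
  have lim0 : h^-1 *: (flat p (h *: 1 + 0) - flat p 0) @[h --> 0^'] --> (0 : R).
    apply/cvgr0Pnorm_le => e e0; near=> h.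
    rewrite f0 subr0 addr0 [h *: 1]mulr1.
    have h0 : h != 0 by near: h; exact: nbhs_dnbhs_neq.
    rewrite normrM normfV ler_pdivrMl ?normr_gt0//.
    apply: le_trans (fM h) _.
    rewrite -real_normK ?num_real// expr2 mulrA mulrC ler_wpM2l//.
    have : `|h| <= e / (M + 1).
      near: h; apply: dnbhs0_le; rewrite divr_gt0// ltr_wpDl//.
    rewrite ler_pdivlMr ?ltr_wpDl// mulrC; apply: le_trans.
    by rewrite ler_wpM2r// lerDl.
  rewrite f0; apply: DeriveDef; first by apply/cvg_ex; exists 0.
  exact: cvg_lim lim0.
Unshelve. all: by end_near.
Qed.

Lemma continuous_flat p : continuous (flat p).
Proof.
move=> t; apply: differentiable_continuous; apply/derivable1_diffP.
by have [] := is_derive_flat p t.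
Qed.

End Flat.

Section Smooth.
Context {R : realType} {n : nat}.
Local Notation Rd := 'rV[R]_n.+1.
Local Notation e_ i := (delta_mx 0 i : Rd).
Implicit Types (f g : Rd -> R) (x : Rd) (i j : 'I_n.+1).

Definition pderivable f := forall i x, derivable (f : Rd -> R^o) x (e_ i).

Lemma derive_line f x v :
  'D_v (f : Rd -> R^o) x = 'D_1 ((fun h => f (h *: v + x)) : R -> R^o) 0.
Proof.
rewrite /derive; set F := fun h => h^-1 *: _; set G := fun h => h^-1 *: _.
suff -> : F = G by [].
apply/funext => h; rewrite /F /G /=.
by rewrite addr0 scale0r add0r [_%:A]mulr1.
Qed.

Lemma smooth_continuous f : smooth f -> continuous (f : Rd -> R^o).
Proof. by move=> /(_ [::])[]. Qed.

Lemma smooth_pderivable f : smooth f -> pderivable f.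
Proof. by move=> /(_ [::])[]. Qed.

Lemma smooth_pderiv f i : smooth f -> smooth (pderiv i f).
Proof. by move=> sf s; have := sf (rcons s i); rewrite foldr_rcons. Qed.

(** Induction on the word of derivatives from its innermost letter: applying that letter to a member
    of [P] gives another member of [P]. *)
Lemma smooth_coind (P : (Rd -> R) -> Prop) :
  (forall f, P f -> [/\ continuous (f : Rd -> R^o), pderivable f &
                       forall i, P (pderiv i f)]) ->
  forall f, P f -> smooth f.
Proof.
move=> HP f Pf s; elim/last_ind: s f Pf => [|s i IH] f Pf.
  by have [? ? _] := HP f Pf.
by rewrite foldr_rcons; apply: IH; have [_ _ +] := HP f Pf; apply.
Qed.

(** Closing under sums and products makes the class stable under [pderiv] by the Leibniz rule, so
    that coinduction applies without tracking the terms of iterated derivatives. *)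
Inductive smooth_alg : (Rd -> R) -> Prop :=
| smooth_alg_smooth f : smooth f -> smooth_alg f
| smooth_alg_cst c : smooth_alg (cst c)
| smooth_algD f g : smooth_alg f -> smooth_alg g -> smooth_alg (fun x => f x + g x)
| smooth_algM f g : smooth_alg f -> smooth_alg g -> smooth_alg (fun x => f x * g x).

Lemma pderiv_cst (c : R) i : pderiv i (cst c : Rd -> R) = cst 0.
Proof. by apply/funext => x; exact: (@derive_cst R Rd R^o). Qed.

Lemma pderivD f g i : pderivable f -> pderivable g ->
  pderiv i (fun x => f x + g x) = fun x => pderiv i f x + pderiv i g x.
Proof. by move=> df dg; apply/funext => x; rewrite /pderiv -deriveD. Qed.

Lemma pderivM f g i : pderivable f -> pderivable g ->
  pderiv i (fun x => f x * g x) = fun x => f x * pderiv i g x + pderiv i f x * g x.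
Proof.
move=> df dg; apply/funext => x; rewrite /pderiv [X in _ + X]mulrC.
exact: (deriveM (df i x) (dg i x)).
Qed.

Lemma pderivableD f g : pderivable f -> pderivable g ->
  pderivable (fun x => f x + g x).
Proof. by move=> df dg i x; apply: (@derivableD _ _ R^o f g). Qed.

Lemma pderivableM f g : pderivable f -> pderivable g ->
  pderivable (fun x => f x * g x).
Proof. by move=> df dg i x; apply: (@derivableM _ _ f g). Qed.

Lemma smooth_algP f : smooth_alg f -> smooth f.
Proof.
apply: smooth_coind => {}f; elim=> {f} [f sf|c|f g sf [cf df If] sg [cg dg Ig]
    |f g sf [cf df If] sg [cg dg Ig]].
- split; [exact: smooth_continuous|exact: smooth_pderivable|].
  by move=> i; apply: smooth_alg_smooth; exact: smooth_pderiv.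
- split; first exact: cst_continuous; first by move=> i x; exact: derivable_cst.
  by move=> i; rewrite pderiv_cst; exact: smooth_alg_cst.
- split; first by move=> x; exact: (@continuousD R R^o Rd f g x (cf x) (cg x)).
    exact: pderivableD.
  by move=> i; rewrite pderivD//; exact: smooth_algD.
- split; first by move=> x; exact: (@continuousM R Rd f g x (cf x) (cg x)).
    exact: pderivableM.
  by move=> i; rewrite pderivM//; apply: smooth_algD; exact: smooth_algM.
Qed.

Lemma smooth_cst (c : R) : smooth (cst c : Rd -> R).
Proof. by apply: smooth_algP; exact: smooth_alg_cst. Qed.

Lemma smoothD f g : smooth f -> smooth g -> smooth (fun x => f x + g x).
Proof. by move=> sf sg; apply: smooth_algP; apply: smooth_algD; exact: smooth_alg_smooth. Qed.

Lemma smoothM f g : smooth f -> smooth g -> smooth (fun x => f x * g x).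
Proof. by move=> sf sg; apply: smooth_algP; apply: smooth_algM; exact: smooth_alg_smooth. Qed.

Lemma smooth_prod (I : Type) (r : seq I) (P : pred I) (F : I -> Rd -> R) :
  (forall k, P k -> smooth (F k)) -> smooth (fun x => \prod_(k <- r | P k) F k x).
Proof.
move=> sF; elim: r => [|k r IH].
  by rewrite (_ : (fun x => _) = cst 1); [exact: smooth_cst|
    apply/funext => x; rewrite big_nil].
rewrite (_ : (fun x => _) = fun x => (if P k then F k x else 1) *
  \prod_(k <- r | P k) F k x); last first.
  by apply/funext => x; rewrite big_cons; case: ifP; rewrite ?mul1r.
apply: smoothM IH; case Pk: (P k); [exact: sF|exact: smooth_cst].
Qed.

Lemma smooth_flat (p : {poly R}) (s c : R) j :
  smooth (fun x : Rd => flat p (s * x 0 j + c)).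
Proof.
pose P f := exists a (q : {poly R}), f = fun x : Rd => a * flat q (s * x 0 j + c).
apply: (@smooth_coind P); last first.
  by exists 1, p; apply/funext => x; rewrite mul1r.
move=> _ [a [q ->]].
have dflat i x : is_derive (0 : R) (1 : R)
    ((fun h => a * flat q (s * (h *: e_ i + x) 0 j + c)) : R -> R^o)
    (a * (s * (j == i)%:R) * flat ('X^2 * (q - q^`())) (s * x 0 j + c)).
  pose L h := h * (s * (j == i)%:R) + (s * x 0 j + c).
  rewrite (_ : (fun h => _) = (fun h : R => a *: (flat q \o L) h : R^o)); last first.
    apply/funext => h; rewrite /L /= !mxE eqxx /=; congr (_ * flat _ _).
    by ring.
  have dL : is_derive (0 : R) 1 L (s * (j == i)%:R).
    rewrite /L; apply: is_derive_eq; rewrite /GRing.scale /=; ring.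
  have dF := is_derive_flat q (L 0).
  have := is_deriveZ a (is_derive1_comp dF dL) => dd.
  by apply: is_derive_eq dd _; rewrite /L mul0r add0r /GRing.scale/=; ring.
split.
- move=> x; apply: (@continuousM _ Rd (cst a)); first exact: cst_continuous.
  apply: (@continuous_comp _ _ _ (fun x : Rd => s * x 0 j + c) (flat q)).
    apply: (@continuousD R R^o Rd (fun x : Rd => s * x 0 j) (cst c)).
      apply: (@continuousM _ Rd (cst s)); first exact: cst_continuous.
      exact: coord_continuous.
    exact: cst_continuous.
  exact: continuous_flat.
- by move=> i x; apply/derivable1P; have [] := dflat i x.
- move=> i; exists (a * (s * (j == i)%:R)), ('X^2 * (q - q^`())).
  by apply/funext => x; rewrite /pderiv derive_line; have [_ ->] := dflat i x.
Qed.

Lemma is_derive_line f x i (h : R) : pderivable f ->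
  is_derive h (1 : R) ((fun h => f (h *: e_ i + x)) : R -> R^o) (pderiv i f (h *: e_ i + x)).
Proof.
move=> df; have := df i (h *: e_ i + x).
have E : (fun k : R => k^-1 *: ((f : Rd -> R^o) (k *: e_ i + (h *: e_ i + x)) - f (h *: e_ i + x))) =
    (fun k => k^-1 *: (((fun h => f (h *: e_ i + x)) : R -> R^o) (k *: 1 + h) - f (h *: e_ i + x))).
  by apply/funext => k; rewrite scalerDl addrA [k *: 1]mulr1.
by move=> dfx; apply: DeriveDef; rewrite /derivable /derive /pderiv /derive -E.
Qed.

Lemma pderiv_MVT f x i s : pderivable f -> 0 < s ->
  exists c, [/\ 0 < c, c < s & f (s *: e_ i + x) - f x = s * pderiv i f (c *: e_ i + x)].
Proof.
move=> df s0.
pose phi := (fun h => f (h *: e_ i + x)) : R -> R.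
have dphi (h : R) : is_derive h (1 : R) phi (pderiv i f (h *: e_ i + x)) by exact: is_derive_line.
have cphi : {within `[0, s], continuous phi}.
  apply: derivable_within_continuous => h _; by have [] := dphi h.
have [c] := MVT s0 (fun h _ => dphi h) cphi.
rewrite in_itv /= => /andP[c0 cs] E; exists c; split => //.
by move: E; rewrite /phi scale0r add0r subr0 => ->; rewrite mulrC.
Qed.

Lemma pderivable_shift f v : pderivable f -> pderivable (fun x => f (v + x)).
Proof.
move=> df i x; have := df i (v + x); rewrite /derivable.
set F := fun h => _ *: _; set G := fun h => _ *: _.
by suff -> : F = G by []; apply/funext => h; rewrite /F /G /= addrCA.
Qed.

Lemma pderiv_shift f v i x : pderiv i (fun x => f (v + x)) x = pderiv i f (v + x).
Proof.
rewrite /pderiv /derive; set F := fun h => _ *: _; set G := fun h => _ *: _.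
by suff -> : F = G by []; apply/funext => h; rewrite /F /G /= addrCA.
Qed.

Lemma pderivB f g i : pderivable f -> pderivable g ->
  pderiv i (fun x => f x - g x) = fun x => pderiv i f x - pderiv i g x.
Proof. by move=> df dg; apply/funext => x; rewrite /pderiv -deriveB. Qed.

Lemma pderivableB f g : pderivable f -> pderivable g ->
  pderivable (fun x => f x - g x).
Proof. by move=> df dg i x; apply: (@derivableB _ _ R^o f g). Qed.

(** The mean value theorem is applied in direction [i] to the difference of [f] in direction [j],
    then in direction [j] to the derivative obtained. The second difference is symmetric in [i] and
    [j], which makes the two mixed derivatives comparable. *)
Lemma second_difference f x i j r : smooth f -> 0 < r ->
  exists c d, [/\ 0 < c < r, 0 < d < r &
    f (r *: e_ j + (r *: e_ i + x)) - f (r *: e_ i + x) - (f (r *: e_ j + x) - f x) =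
    r * (r * pderiv j (pderiv i f) (d *: e_ j + (c *: e_ i + x)))].
Proof.
move=> sf r0; have df := smooth_pderivable sf.
have dfi := smooth_pderivable (smooth_pderiv i sf).
pose g y := f (r *: e_ j + y) - f y.
have dfj := @pderivable_shift _ (r *: e_ j) df.
have [c [c0 cr Ec]] := pderiv_MVT x i (pderivableB dfj df) r0.
move: Ec; rewrite pderivB// pderiv_shift => ->.
have [d [d0 dr ->]] := pderiv_MVT (c *: e_ i + x) j dfi r0.
by exists c, d; rewrite c0 d0.
Qed.

Lemma mixed_pderiv_meet f x i j r : smooth f -> 0 < r ->
  exists c d c' d', [/\ 0 < c < r, 0 < d < r, 0 < c' < r, 0 < d' < r &
    pderiv i (pderiv j f) (d' *: e_ i + (c' *: e_ j + x)) =
    pderiv j (pderiv i f) (d *: e_ j + (c *: e_ i + x))].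
Proof.
move=> sf r0.
have [c [d [cr dr Ecd]]] := second_difference x i j sf r0.
have [c' [d' [cr' dr' Ecd']]] := second_difference x j i sf r0.
exists c, d, c', d'; split; [exact: cr|exact: dr|exact: cr'|exact: dr'|].
move: Ecd Ecd'; rewrite (addrCA (r *: e_ i)).
move: (pderiv i _ _) (pderiv j _ _) => u v.
move: (f (r *: e_ j + (r *: e_ i + x))) (f (r *: e_ i + x)) (f (r *: e_ j + x)) (f x).
move=> a b c0 d0 h1 h2.
by apply: (mulfI (lt0r_neq0 r0)); apply: (mulfI (lt0r_neq0 r0)); lra.
Qed.

Lemma dist_le_half (e u v w : R) :
  `|u - v| < e / 2 -> `|u - w| < e / 2 -> `|v - w| <= e.
Proof. by rewrite !ltr_norml ler_norml; lra. Qed.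

(** The two mixed derivatives agree at some pair of points arbitrarily close to [x], and both are
    continuous. The symmetry is needed to reorder iterated derivatives in the integration by
    parts. *)
Lemma pderivC f i j : smooth f -> pderiv i (pderiv j f) = pderiv j (pderiv i f).
Proof.
move=> sf; apply/funext => x; apply/eqP; rewrite -subr_eq0 -normr_eq0.
rewrite eq_le normr_ge0 andbT; apply/ler_addgt0Pr => e e0; rewrite add0r.
pose close g (r : R) := forall c d k l, 0 < c < r -> 0 < d < r ->
  `|g (d *: e_ k + (c *: e_ l + x)) - g x| < e / 2.
have near_close g : smooth g ->
    exists2 s, 0 < s & forall r, r <= s -> close g r.
  move=> /smooth_continuous/(_ x)/cvgrPdist_lt/(_ (e / 2) (divr_gt0 e0 (ltr0n R 2))).
  (* The argument is displaced twice, each time by less than the radius, so half the radius of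
     continuity is taken. *)
  move=> /nbhs_normP[r /= r0 gr]; exists (r / 2) => [|s sr c d k l]; first by rewrite divr_gt0.
  move=> /andP[c0 cs] /andP[d0 ds].
  rewrite distrC; apply: gr => /=.
  rewrite addrA distrC addrK (le_lt_trans (ler_normD _ _))// !normrZ.
  have nd (m : 'I_n.+1) : `|e_ m| <= 1.
    rewrite /Num.norm/= mx_normrE; apply/bigmax_leP; split => // -[u v] _ /=.
    by rewrite !mxE; case: (_ && _); rewrite ?normr1 ?normr0.
  apply: (@le_lt_trans _ _ (c + d)); last by lra.
    rewrite addrC (gtr0_norm c0) (gtr0_norm d0).
  by apply: lerD; rewrite -[leRHS]mulr1; apply: ler_pM => //; exact: ltW.
have [s1 s10 h1] := near_close _ (smooth_pderiv i (smooth_pderiv j sf)).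
have [s2 s20 h2] := near_close _ (smooth_pderiv j (smooth_pderiv i sf)).
set r := Num.min s1 s2.
have r0 : 0 < r by rewrite lt_min s10.
have hi : close (pderiv i (pderiv j f)) r by apply: h1; rewrite ge_min lexx.
have hj : close (pderiv j (pderiv i f)) r by apply: h2; rewrite ge_min lexx orbT.
have [c [d [c' [d' [cr dr cr' dr' E]]]]] := mixed_pderiv_meet x i j sf r0.
have {}h1 := hi c' d' i j cr' dr'; have {}h2 := hj c d j i cr dr.
move: h1 h2; rewrite E; move: (pderiv j _ (_ + _)) (pderiv i _ x) (pderiv j _ x).
move=> u v w; exact: dist_le_half.
Qed.

End Smooth.

(** * Test functions and integration by parts *)

Section TestFunctions.
Context {R : realType} {n : nat}.
Local Notation Rd := 'rV[R]_n.+1.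
Local Notation lebT := (@lebT R n).
Local Notation leb := (@leb R n).
Local Notation e_ i := (delta_mx 0 i : Rd).
Implicit Types (O : set Rd) (f g h : Rd -> R) (x : Rd) (i j : 'I_n.+1).

Definition supp f : set Rd := closure [set x | f x != 0].

Lemma supp0 f x : ~ supp f x -> f x = 0.
Proof. by move=> nfx; apply: contra_notP nfx => /eqP fx; exact: subset_closure. Qed.

Lemma test_function_sub O f g : test_function O f -> smooth g ->
  (forall x, ~ supp f x -> g x = 0) -> test_function O g.
Proof.
move=> [_ cf fO] sg g0.
have gf : supp g `<=` supp f.
  rewrite /supp [X in _ `<=` X](closure_id _).1; last exact: closed_closure.
  by apply: closureS => x /= gx; apply: contrapT => /g0 /eqP; rewrite (negPf gx).
split=> //; last exact: subset_trans fO.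
by apply: subclosed_compact cf gf; exact: closed_closure.
Qed.

Lemma test_smooth O f : test_function O f -> smooth f.
Proof. by case. Qed.

Lemma pderiv_supp i f x : ~ supp f x -> pderiv i f x = 0.
Proof.
move=> nfx; rewrite /pderiv (@near_eq_derive _ _ R^o _ (cst 0)) ?derive_cst//.
have : open_nbhs x (~` supp f).
  by split => //; apply: closed_openC; exact: closed_closure.
by move/open_nbhs_nbhs; apply: filterS => y /supp0.
Qed.

Lemma test_pderiv O f i : test_function O f -> test_function O (pderiv i f).
Proof.
move=> tf; apply: (test_function_sub tf); last exact: pderiv_supp.
by apply: smooth_pderiv; exact: test_smooth tf.
Qed.

Lemma test_mulr O f g : test_function O f -> smooth g ->
  test_function O (fun x => f x * g x).
Proof.
move=> tf sg; apply: (test_function_sub tf).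
  by apply: smoothM => //; exact: test_smooth tf.
by move=> x /supp0 ->; rewrite mul0r.
Qed.

Lemma test_scale O f c : test_function O f -> test_function O (fun x => c * f x).
Proof.
move=> tf; rewrite (_ : (fun x => _) = fun x => f x * c).
  by apply: test_mulr => //; exact: smooth_cst.
by apply/funext => x; rewrite mulrC.
Qed.

Lemma test0 O : test_function O (fun=> 0).
Proof.
have E : [set x : Rd | (0 : R) != 0] = set0 by apply/seteqP; split=> x //=; rewrite eqxx.
rewrite /test_function E closure0; split; [exact: smooth_cst|exact: compact0|].
exact: sub0set.
Qed.

Lemma testD O f g : test_function O f -> test_function O g ->
  test_function O (fun x => f x + g x).
Proof.
move=> [sf cf fO] [sg cg gO].
have sub : supp (fun x => f x + g x) `<=` supp f `|` supp g.
  rewrite /supp -closureU; apply: closureS => x /=.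
  by apply: contraNP => /not_orP[/negP/negPn/eqP-> /negP/negPn/eqP->]; rewrite addr0.
split; first exact: smoothD.
  by apply: subclosed_compact (compactU cf cg) sub; exact: closed_closure.
by apply: subset_trans sub _ => x [/fO|/gO].
Qed.

Lemma test_sum O (I : Type) (r : seq I) (F : I -> Rd -> R) :
  (forall k, test_function O (F k)) -> test_function O (fun x => \sum_(k <- r) F k x).
Proof.
move=> tF; elim: r => [|k r IH].
  by rewrite (_ : (fun x => _) = fun=> 0); [exact: test0|
    apply/funext => x; rewrite big_nil].
rewrite (_ : (fun x => _) = fun x => F k x + \sum_(k <- r) F k x); first exact: testD.
by apply/funext => x; rewrite big_cons.
Qed.

Lemma test_subset O O' f : O `<=` O' -> test_function O f -> test_function O' f.
Proof. by move=> OO' [? ? fO]; split=> //; exact: subset_trans OO'. Qed.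

Lemma test_out O f x : test_function O f -> ~ O x -> f x = 0.
Proof. by move=> [_ _ fO] nOx; apply: supp0 => /fO. Qed.

Lemma test_bounded O f : test_function O f -> exists2 M, 0 <= M & forall x, `|f x| <= M.
Proof.
move=> [sf cf _].
have cff : {within supp f, continuous (f : Rd -> R^o)}.
  by apply: continuous_subspaceT; exact: smooth_continuous.
have /compact_bounded/pinfty_ex_gt0[M M0 fM] := continuous_compact cff cf.
exists M => [|x]; first exact: ltW.
have [fx|nfx] := pselect (supp f x); last by rewrite supp0// normr0 ltW.
by apply: fM; exists x.
Qed.

Lemma test_cube O f : test_function O f ->
  exists2 r, 0 < r & forall x, ~ cube r x -> f x = 0.
Proof.
move=> [_ /compact_bounded/bounded_sub_cube[r r0 fr] _]; exists r => // x nx.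
by apply: supp0 => /fr.
Qed.

Lemma measurable_continuous f : continuous (f : Rd -> R^o) ->
  measurable_fun setT (f : lebT -> R).
Proof.
move=> /continuousP cf; apply: (measurability _ (RGenOpens.measurableE R)).
move=> _ [_ [a [b ->] <-]]; rewrite setTI; apply: open_measurable_leb.
exact/cf/interval_open.
Qed.

Lemma bounded_cube_integrable f M r : 0 <= r ->
  measurable_fun setT (f : lebT -> R) -> (forall x, `|f x| <= M) ->
  (forall x, ~ cube r x -> f x = 0) -> leb.-integrable setT (EFin \o f).
Proof.
move=> r0 mf fM f0.
have mr : measurable (cube r : set lebT).
  by apply: measurable_closed_leb; exact: closed_box.
have <- : f \_ (cube r) = f.
  apply/funext => x; rewrite /patch; case: ifPn => //.
  by rewrite notin_setE => /f0.
rewrite -restrict_EFin; apply/integrable_restrict => //; rewrite setTI.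
apply: measurable_bounded_integrable => //.
- exact: leb_cube.
- exact: measurable_funS mf.
- exists M; split; first exact: num_real.
  by move=> N MN x _ /=; rewrite (le_trans (fM x))// ltW.
Qed.

Lemma test_integrable O f : test_function O f -> leb.-integrable setT (EFin \o f).
Proof.
move=> tf; have [M _ fM] := test_bounded tf; have [r r0 fr] := test_cube tf.
apply: (bounded_cube_integrable (ltW r0) _ fM fr).
by apply: measurable_continuous; apply: smooth_continuous; exact: test_smooth tf.
Qed.

Lemma Rintegral_translate (f : lebT -> R) (t : Rd) :
  leb.-integrable setT (EFin \o f) ->
  leb.-integrable setT (EFin \o (f \o translate t)) ->
  \int[leb]_x f (translate t x) = \int[leb]_x f x.
Proof.
move=> fi fti; have mt := @measurable_translate R n t.
have pE : pushforward leb (translate t : lebT -> lebT) = leb.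
  by apply/funext => E; exact: leb_translate.
have mf : measurable_fun setT (EFin \o f) by case/integrableP : fi.
have := @integral_pushforward _ _ lebT lebT R (translate t) mt leb setT (EFin \o f) mf fti measurableT.
move=> H; rewrite /Rintegral; congr fine; symmetry; etransitivity; last exact: H.
by apply: eq_measure_integral => E mE _; rewrite /= pE.
Qed.

(** The integral of x |-> h(t e_i + x) does not depend on t; differentiating under the integral at t
    = 0 gives the claim. The dominating function [G] lives on an enlarged cube containing the
    supports of all derivatives with |t| < 1. *)
Lemma Rintegral_pderiv O h i : test_function O h -> \int[leb]_x pderiv i h x = 0.
Proof.
move=> th; have sh := test_smooth th.
have [M M0 hM] := test_bounded th; have [r r0 hr] := test_cube th.
have tdh := test_pderiv i th.
have [M' M'0 dhM'] := test_bounded tdh; have [r' r'0 dhr'] := test_cube tdh.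
have cubeS s t a x : `|t| <= a -> ~ cube (s + a) x -> ~ cube s (t *: e_ i + x).
  move=> ta nx /cubeP sx; apply: nx; apply/cubeP => j.
  have := sx j; rewrite !mxE eqxx /=.
  have : `|t * (j == i)%:R| <= a.
    rewrite normrM -[leRHS]mulr1; apply: ler_pM => //.
    by case: (_ == _); rewrite ?normr1 ?normr0.
  by rewrite !ler_norml; lra.
pose f t x := h (t *: e_ i + x).
have mf t : measurable_fun setT (f t : lebT -> R).
  apply: measurable_continuous => x.
  apply: (@continuous_comp _ _ _ (fun x : Rd => t *: e_ i + x) (h : Rd -> R^o)).
    by apply: (@continuousD R Rd Rd (cst (t *: e_ i)) id); [exact: cst_continuous|].
  exact: smooth_continuous.
pose G : lebT -> R := fun x => M' * \1_(cube (r' + 1)) x.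
have mC : measurable (cube (r' + 1) : set lebT).
  by apply: measurable_closed_leb; exact: closed_box.
have dE t x : (f ^~ x)^`()%classic t = pderiv i h (t *: e_ i + x).
  rewrite derive1E; have [_ <-] := is_derive_line x i t (smooth_pderivable sh).
  by [].
have zeroI : `]-1, 1[%classic (0 : R) by rewrite /= in_itv /=; lra.
have intf t : leb.-integrable setT (EFin \o f t).
  apply: (@bounded_cube_integrable _ M (r + `|t|)); rewrite ?addr_ge0 ?(ltW r0)//.
    by move=> x; exact: hM.
  by move=> x nx; apply/hr/(cubeS r t `|t|).
have dF := @differentiation_under_integral R _ lebT leb f setT measurableT 0 (-1) 1
  zeroI (fun t _ => intf t) _ G _ _ _.
transitivity (\int[leb]_(x in setT) partial1of2 f ^~ x 0).
  by apply: eq_Rintegral => x _; rewrite /partial1of2 dE scale0r add0r.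
rewrite -dF; first last.
- move=> t x; rewrite /= in_itv /= => tI _; rewrite /partial1of2 dE /G indicE.
  have [xr|xr] := boolP (x \in cube (r' + 1)); first by rewrite mulr1 dhM'.
  rewrite dhr' ?normr0 ?mulr0//; apply: (cubeS r' t 1).
    by rewrite ler_norml; lra.
  by move=> xc; move/negP: xr; apply; rewrite inE.
- apply: (@bounded_cube_integrable _ M' (r' + 1)).
  + by rewrite addr_ge0// ltW.
  + by apply: measurable_funM => //; exact: measurable_indic.
  + move=> x; rewrite /G indicE; case: (_ \in _); rewrite ?mulr1 ?mulr0 ?normr0//.
    by rewrite ger0_norm.
  + by move=> x nx; rewrite /G indicE memNset// mulr0.
- by move=> x; rewrite /G mulr_ge0.
- move=> t x _ _; have [+ _] := is_derive_line x i t (smooth_pderivable sh).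
  by [].
rewrite (_ : (fun t => _) = cst (\int[leb]_x h x)) ?derive1_cst//.
apply/funext => t; have := @Rintegral_translate h (t *: e_ i).
rewrite /translate /f; under eq_Rintegral do rewrite addrC.
apply; first exact: test_integrable th.
by have := intf t; congr (leb.-integrable _ _); apply/funext => x /=; rewrite /f addrC.
Qed.

Lemma test_measurable O f : test_function O f -> measurable_fun setT (f : lebT -> R).
Proof.
by move=> tf; apply: measurable_continuous; apply: smooth_continuous; exact: test_smooth tf.
Qed.

Lemma foldr_pderiv f s : smooth f -> smooth (foldr pderiv f s).
Proof.
move=> sf; elim: s => [|i s IH] /=; first exact: sf.
exact: smooth_pderiv.
Qed.

Lemma foldr_pderivC f s i : smooth f ->
  foldr pderiv (pderiv i f) s = pderiv i (foldr pderiv f s).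
Proof.
by move=> sf; elim: s => //= j s ->; rewrite pderivC//; exact: foldr_pderiv.
Qed.

Lemma integration_by_parts1 O f g i : test_function O f -> smooth g ->
  \int[leb]_x (pderiv i f x * g x) = - \int[leb]_x (f x * pderiv i g x).
Proof.
move=> tf sg; apply/eqP; rewrite -addr_eq0; apply/eqP.
have t1 := test_mulr (test_pderiv i tf) sg.
have t2 := test_mulr tf (smooth_pderiv i sg).
have := Rintegral_pderiv i (test_mulr tf sg).
rewrite pderivM; [|exact/smooth_pderivable/(test_smooth tf)|exact: smooth_pderivable].
by rewrite RintegralD//; [rewrite addrC|exact: test_integrable t2|exact: test_integrable t1].
Qed.

Lemma test_foldr_pderiv O f s : test_function O f -> test_function O (foldr pderiv f s).
Proof. by move=> tf; elim: s => //= i s; exact: test_pderiv. Qed.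

(** The outermost derivative of [f] becomes the innermost one of [g]; [foldr_pderivC] moves it back
    to the outside. *)
Lemma integration_by_parts O f g s : test_function O f -> smooth g ->
  \int[leb]_x (foldr pderiv f s x * g x) =
  (-1) ^+ size s * \int[leb]_x (f x * foldr pderiv g s x).
Proof.
move=> tf; elim: s g => [|i s IH] g sg /=; first by rewrite mul1r.
rewrite (integration_by_parts1 i (test_foldr_pderiv s tf) sg) IH; last exact: smooth_pderiv.
by rewrite foldr_pderivC// exprS !mulNr mul1r.
Qed.

Definition mi_seq (al : multi_index n) : seq 'I_n.+1 :=
  flatten [seq nseq (al i) i | i <- enum 'I_n.+1].

Lemma mi_derivE al f : mi_deriv al f = foldr pderiv f (mi_seq al).
Proof.
rewrite /mi_deriv /mi_seq; elim: (enum _) => //= i s ->.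
by rewrite foldr_cat; elim: (al i) => //= m ->.
Qed.

Lemma size_mi_seq al : size (mi_seq al) = mi_order al.
Proof.
rewrite /mi_seq size_flatten /shape -map_comp /mi_order sumnE big_map big_enum /=.
by apply: eq_bigr => i _; rewrite size_nseq.
Qed.

Lemma smooth_mi_deriv al f : smooth f -> smooth (mi_deriv al f).
Proof. by rewrite mi_derivE; exact: foldr_pderiv. Qed.

Lemma test_mi_deriv O al f : test_function O f -> test_function O (mi_deriv al f).
Proof. by rewrite mi_derivE; exact: test_foldr_pderiv. Qed.

Lemma mi_deriv_by_parts O al f g : test_function O f -> smooth g ->
  \int[leb]_x (mi_deriv al f x * g x) =
  (-1) ^+ mi_order al * \int[leb]_x (f x * mi_deriv al g x).
Proof. by rewrite !mi_derivE -size_mi_seq; exact: integration_by_parts. Qed.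

End TestFunctions.

(** * Riesz representation without definiteness *)

Section InnerProduct.
Context {R : realType}.

Lemma discriminant_le (a b c : R) : 0 <= a ->
  (forall t, 0 <= a * t ^+ 2 + 2 * b * t + c) -> b ^+ 2 <= a * c.
Proof.
rewrite le_eqVlt => /predU1P[<- h|a0 h].
  have [->|b0] := eqVneq b 0; first by rewrite expr0n mul0r.
  (* For a = 0 the quadratic is affine, and this argument gives it the value -1. *)
  have := h (- (c + 1) / (2 * b)); rewrite (_ : _ + c = -1); last by field.
  by rewrite ler0N1.
have := h (- b / a); rewrite (_ : _ + c = (a * c - b ^+ 2) / a); last first.
  by field; rewrite gt_eqF.
by rewrite pmulr_lge0 ?invr_gt0// subr_ge0.
Qed.

(** Passages to the limit below end here: an error bound C 2^{-n} replaces a topology on the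
    abstract spaces. *)
Lemma le0_of_geometric (x C : R) : (forall n, x <= C * 2^-1 ^+ n) -> x <= 0.
Proof.
move=> h.
have cvg0 : C * 2^-1 ^+ n @[n --> \oo] --> C * 0.
  by apply: cvgMl_tmp; apply: cvg_expr; rewrite ger0_norm ?invr_ge0// invf_lt1// ltr1n.
rewrite mulr0 in cvg0; rewrite -(cvg_lim _ cvg0)//.
by apply: limr_ge; [apply/cvg_ex; exists 0|exact: nearW].
Qed.

Context {E : lmodType R}.
Implicit Types (S : set E) (B : E -> E -> R).

Section Subspace.
Context {S : set E} (sS : is_subspace S).

Lemma sub0 : S 0. Proof. by case: sS. Qed.

Lemma subZ a x : S x -> S (a *: x).
Proof. by case: sS => S0 SD Sx; rewrite -[_ *: x]addr0; exact: SD. Qed.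

Lemma subD x y : S x -> S y -> S (x + y).
Proof. by case: sS => S0 SD Sx Sy; rewrite -[x]scale1r; exact: SD. Qed.

Lemma subN x : S x -> S (- x).
Proof. by move=> Sx; rewrite -scaleN1r; exact: subZ. Qed.

Lemma subB x y : S x -> S y -> S (x - y).
Proof. by move=> Sx Sy; apply: subD => //; exact: subN. Qed.

Lemma sub_sum (I : Type) (r : seq I) (F : I -> E) :
  (forall i, S (F i)) -> S (\sum_(i <- r) F i).
Proof. by move=> SF; elim/big_ind : _ => //; [exact: sub0|exact: subD]. Qed.
End Subspace.

(** Semidefinite and restricted to a subspace, so that it covers functions before the quotient by
    null sets as well as forms that make sense on part of a space only. *)
Record semi_ip S B : Prop := SemiIp {
  ip_sub : is_subspace S;
  ip_lin : forall a x y z, S x -> S y -> S z -> B (a *: x + y) z = a * B x z + B y z;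
  ip_sym : forall x y, S x -> S y -> B x y = B y x;
  ip_ge0 : forall x, S x -> 0 <= B x x }.

Definition nrm B x : R := Num.sqrt (B x x).

(** Completeness along sequences with geometric increments, together with a geometric rate. The
    limit is not unique, since the form may degenerate. *)
Definition fast_complete S B : Prop :=
  forall x : nat -> E, (forall n, S (x n)) ->
    (forall n, nrm B (x n.+1 - x n) <= 2^-1 ^+ n) ->
  exists y K, S y /\ forall n, nrm B (x n - y) <= K * 2^-1 ^+ n.

Section Theory.
Context {S : set E} {B : E -> E -> R} (hB : semi_ip S B).
Let sS := ip_sub hB.
Implicit Types (x y z : E).

Lemma ipDl x y z : S x -> S y -> S z -> B (x + y) z = B x z + B y z.
Proof. by move=> Sx Sy Sz; rewrite -{1}[x]scale1r (ip_lin hB)// mul1r. Qed.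

Lemma ip0l z : S z -> B 0 z = 0.
Proof.
move=> Sz; have := ipDl (sub0 sS) (sub0 sS) Sz.
by rewrite addr0 => /eqP; rewrite -{1}[B 0 z]addr0 (inj_eq (addrI _)) => /eqP <-.
Qed.

Lemma ipZl a x z : S x -> S z -> B (a *: x) z = a * B x z.
Proof.
by move=> Sx Sz; rewrite -[_ *: x]addr0 (ip_lin hB)// ?ip0l ?addr0//; exact: sub0.
Qed.

Lemma ipNl x z : S x -> S z -> B (- x) z = - B x z.
Proof. by move=> Sx Sz; rewrite -scaleN1r ipZl// mulN1r. Qed.

Lemma ipBl x y z : S x -> S y -> S z -> B (x - y) z = B x z - B y z.
Proof. by move=> Sx Sy Sz; rewrite ipDl ?ipNl//; exact: subN. Qed.

Lemma ip0r z : S z -> B z 0 = 0.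
Proof. by move=> Sz; rewrite (ip_sym hB) ?ip0l//; exact: sub0. Qed.

Lemma ipDr x y z : S x -> S y -> S z -> B z (x + y) = B z x + B z y.
Proof.
move=> Sx Sy Sz; rewrite (ip_sym hB) ?ipDl ?(ip_sym hB Sz)//; exact: subD.
Qed.

Lemma ipZr a x z : S x -> S z -> B z (a *: x) = a * B z x.
Proof. by move=> Sx Sz; rewrite (ip_sym hB) ?ipZl ?(ip_sym hB Sz)//; exact: subZ. Qed.

Lemma ipNr x z : S x -> S z -> B z (- x) = - B z x.
Proof. by move=> Sx Sz; rewrite -scaleN1r ipZr// mulN1r. Qed.

Lemma ipBr x y z : S x -> S y -> S z -> B z (x - y) = B z x - B z y.
Proof. by move=> Sx Sy Sz; rewrite ipDr ?ipNr//; exact: subN. Qed.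

Lemma ip_sqD x y : S x -> S y -> B (x + y) (x + y) = B x x + 2 * B x y + B y y.
Proof.
move=> Sx Sy; have Sxy := subD sS Sx Sy.
rewrite ipDl// !ipDr// (ip_sym hB Sy Sx); ring.
Qed.

Lemma nrm_sqr x : S x -> nrm B x ^+ 2 = B x x.
Proof. by move=> Sx; rewrite sqr_sqrtr// (ip_ge0 hB). Qed.

Lemma nrm_ge0 x : 0 <= nrm B x.
Proof. exact: sqrtr_ge0. Qed.

Lemma cauchy_schwarz x y : S x -> S y -> `|B x y| <= nrm B x * nrm B y.
Proof.
move=> Sx Sy; rewrite -sqrtr_sqr -sqrtrM ?(ip_ge0 hB)// ler_wsqrtr//.
apply: discriminant_le; first exact: ip_ge0 hB _ Sx.
move=> t; have Stx := subZ sS t Sx.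
have := ip_ge0 hB (subD sS Stx Sy); rewrite ip_sqD// !ipZl// ipZr//.
by congr (_ <= _); ring.
Qed.

Lemma nrmD x y : S x -> S y -> nrm B (x + y) <= nrm B x + nrm B y.
Proof.
move=> Sx Sy; rewrite -[leRHS]ger0_norm ?addr_ge0 ?nrm_ge0// -sqrtr_sqr ler_wsqrtr//.
rewrite ip_sqD// sqrrD !nrm_sqr//.
have := le_trans (ler_norm _) (cauchy_schwarz Sx Sy).
move: (B _ _) (B _ _) (B _ _) (nrm _ _ * _) => *; lra.
Qed.

Lemma nrmZ a x : S x -> nrm B (a *: x) = `|a| * nrm B x.
Proof.
move=> Sx; rewrite /nrm ipZl ?ipZr//; last exact: subZ.
by rewrite mulrA -expr2 sqrtrM ?sqr_ge0// sqrtr_sqr.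
Qed.

Lemma nrmN x : S x -> nrm B (- x) = nrm B x.
Proof. by move=> Sx; rewrite -scaleN1r nrmZ// normrN1 mul1r. Qed.

Lemma nrmB x y : S x -> S y -> nrm B (x - y) = nrm B (y - x).
Proof. by move=> Sx Sy; rewrite -opprB nrmN//; exact: subB. Qed.

Lemma nrm0 : nrm B 0 = 0.
Proof. by rewrite /nrm ip0l ?sqrtr0//; exact: sub0. Qed.

Lemma ip_suml (I : Type) (r : seq I) (F : I -> E) z : (forall i, S (F i)) -> S z ->
  B (\sum_(i <- r) F i) z = \sum_(i <- r) B (F i) z.
Proof.
move=> SF Sz; elim: r => [|i r IH]; first by rewrite !big_nil ip0l.
by rewrite !big_cons ipDl ?IH//; exact: sub_sum.
Qed.

(* Minimising sequences of [B x x - 2 l x] are Cauchy by the parallelogram law;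
   completeness is only needed along such sequences. *)
Lemma riesz (l : E -> R) (M : R) : fast_complete S B ->
  (forall a x y, S x -> S y -> l (a *: x + y) = a * l x + l y) ->
  (forall x, S x -> `|l x| <= M * nrm B x) ->
  exists2 x, S x & forall y, S y -> B x y = l y.
Proof.
move=> cS ll lM.
have lD x y : S x -> S y -> l (x + y) = l x + l y.
  by move=> Sx Sy; rewrite -{1}[x]scale1r ll// mul1r.
have l0 : l 0 = 0.
  have := lD 0 0 (sub0 sS) (sub0 sS).
  by rewrite addr0 => /eqP; rewrite -{1}[l 0]addr0 (inj_eq (addrI _)) => /eqP <-.
have lZ a x : S x -> l (a *: x) = a * l x.
  by move=> Sx; rewrite -[_ *: x]addr0 ll// ?l0 ?addr0//; exact: sub0.
pose J x := B x x - 2 * l x.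
have J_ge x : S x -> - M ^+ 2 <= J x.
  move=> Sx; rewrite /J -nrm_sqr//; have := lM x Sx.
  have := ler_norm (l x); have := nrm_ge0 x; move: (nrm B x) (l x) => a b a0 b1 b2.
  by have := sqr_ge0 (a - M); rewrite sqrrB; nra.
pose m := inf (J @` S).
have JS : has_inf (J @` S).
  split; first by exists (J 0), 0; first exact: sub0.
  by exists (- M ^+ 2) => _ [x Sx <-]; exact: J_ge.
have m_le x : S x -> m <= J x.
  by move=> Sx; apply: ge_inf; [case: JS|exists x].
(* The parallelogram law bounds the square of the increment by 2 d_n + 2 d_{n+1} <= 4 d_n, which the
   factor 1/4 turns into (2^{-n})^2. *)
pose d n : R := 4^-1 * (2^-1 ^+ n) ^+ 2.
have d0 n : 0 < d n by rewrite mulr_gt0 ?invr_gt0// !exprn_gt0// invr_gt0.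
have near_m n : exists x, S x /\ J x <= m + d n.
  have [_ [x Sx <-] xm] := inf_adherent (d0 n) JS.
  by exists x; split=> //; exact: ltW.
have [x xP] := choice near_m.
have Sx n : S (x n) by have [] := xP n.
have Jx n : J (x n) <= m + d n by have [] := xP n.
have dS n : d n.+1 <= d n.
  rewrite /d ler_wpM2l ?invr_ge0// [2^-1 ^+ n.+1]exprS exprMn ler_piMl ?sqr_ge0//.
  by rewrite expr2; lra.
have fast n : nrm B (x n.+1 - x n) <= 2^-1 ^+ n.
  have -> : (2^-1 ^+ n : R) = Num.sqrt ((2^-1 ^+ n) ^+ 2).
    by rewrite sqrtr_sqr ger0_norm// exprn_ge0// invr_ge0.
  rewrite ler_wsqrtr//.
  have Sm := subZ sS 2^-1 (subD sS (Sx n.+1) (Sx n)).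
  have Jm := m_le _ Sm.
  have J1 := Jx n.+1; have J2 := Jx n; have dn := dS n.
  have SN := subN sS (Sx n); have SDD := subD sS (Sx n.+1) (Sx n).
  move: Jm J1 J2; rewrite /J !ip_sqD// ?ipNr// ?ipNl// ?ipZl// ?ipZr// ?lZ// ?lD// ip_sqD//.
  have -> : (2^-1 ^+ n) ^+ 2 = 4 * d n by rewrite /d mulrA mulfV ?mul1r.
  move: (B _ _) (B _ _) (B _ _) (l _) (l _) (d n) (d n.+1) dn.
  by move=> *; lra.
have [y [K [Sy yK]]] := cS x Sx fast.
exists y => // z Sz; apply/eqP; rewrite -subr_eq0 -normr_eq0 eq_le normr_ge0 andbT.
apply: (@le0_of_geometric _ ((`|K| + 1) * nrm B z)) => n.
(* First variation at a near-minimiser: J(x_n + t z) >= m >= J(x_n) - d_n for all t is a nonnegative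
   quadratic in t, and its discriminant bounds the residual. *)
have h1 : `|B (x n) z - l z| <= 2^-1 ^+ n * nrm B z.
  have r0 : 0 <= 2^-1 ^+ n * nrm B z by rewrite mulr_ge0 ?nrm_ge0// exprn_ge0// invr_ge0.
  rewrite -[leLHS]sqrtr_sqr -[leRHS](ger0_norm r0) -[leRHS]sqrtr_sqr ler_wsqrtr//.
  apply: (@le_trans _ _ (B z z * d n)); last first.
    rewrite exprMn nrm_sqr// mulrC ler_wpM2r ?(ip_ge0 hB)// /d ler_piMl ?sqr_ge0//.
    by rewrite invf_le1// ler1n.
  apply: discriminant_le; first exact: ip_ge0 hB _ Sz.
  move=> t; have Stz := subZ sS t Sz.
  have := m_le _ (subD sS (Sx n) Stz); have := Jx n; rewrite /J ip_sqD//.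
  rewrite !ipZr// ipZl// lD// lZ//.
  move: (B _ _) (B _ _) (B _ _) (l _) (l _) (d n) => *; lra.
have h2 : `|B (y - x n) z| <= `|K| * 2^-1 ^+ n * nrm B z.
  apply: le_trans (cauchy_schwarz (subB sS Sy (Sx n)) Sz) _.
  rewrite ler_wpM2r ?nrm_ge0// nrmB//; apply: le_trans (yK n) _.
  by rewrite ler_wpM2r ?ler_norm// exprn_ge0// invr_ge0.
have -> : B y z - l z = B (y - x n) z + (B (x n) z - l z).
  by rewrite ipBl// addrA subrK.
apply: le_trans (ler_normD _ _) _; apply: le_trans (lerD h2 h1) _.
by rewrite -mulrDl -[X in _ + X]mul1r -mulrDl mulrAC.
Qed.

Lemma fast_dist (x : nat -> E) : (forall n, S (x n)) ->
  (forall n, nrm B (x n.+1 - x n) <= 2^-1 ^+ n) ->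
  forall n m, (n <= m)%N -> nrm B (x m - x n) <= 2 * 2^-1 ^+ n.
Proof.
move=> Sx fx n m /subnKC <-; move: (m - n)%N => k.
apply: (@le_trans _ _ (2 * 2^-1 ^+ n - 2 * 2^-1 ^+ (n + k))); last first.
  by rewrite gerBl mulr_ge0// exprn_ge0// invr_ge0.
elim: k => [|k IH]; first by rewrite addn0 !subrr nrm0.
rewrite addnS -(subrK (x (n + k)%N) (x _)) -addrA.
apply: le_trans (nrmD _ _) _; try exact: subB.
apply: le_trans (lerD (fx _) IH) _; rewrite exprS; lra.
Qed.

End Theory.
End InnerProduct.

(** Completeness of a finite product of complete spaces, seen through the component maps [f i]. The
    last hypothesis says that the range of the family [f] is closed: componentwise limits come from
    one element of [S]. *)
Lemma fast_complete_graph (R : realType) (E : lmodType R) (I : finType) (F : I -> lmodType R)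
    (BF : forall i, F i -> F i -> R) (f : forall i, E -> F i)
    (S : set E) (B : E -> E -> R) :
  (forall i, semi_ip [set: F i] (BF i)) ->
  (forall i, fast_complete [set: F i] (BF i)) ->
  (forall i x y, S x -> S y -> f i (x - y) = f i x - f i y) ->
  (forall x y, S x -> S y -> B x y = \sum_i BF i (f i x) (f i y)) ->
  is_subspace S ->
  (forall (x : nat -> E) (y : forall i, F i) (K : I -> R), (forall n, S (x n)) ->
     (forall i n, nrm (BF i) (f i (x n) - y i) <= K i * 2^-1 ^+ n) ->
     exists z, S z /\ forall i, f i z = y i) ->
  fast_complete S B.
Proof.
move=> hBF cBF fB BE sS clS x Sx fx.
have r0 n : 0 <= 2^-1 ^+ n :> R by rewrite exprn_ge0// invr_ge0.
have nrmE z n : S z -> nrm B (x n - z) ^+ 2 = \sum_i nrm (BF i) (f i (x n) - f i z) ^+ 2.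
  move=> Sz; rewrite sqr_sqrtr; last first.
    rewrite BE; try exact: subB.
    by apply: sumr_ge0 => i _; exact: (ip_ge0 (hBF i)).
  rewrite BE; try exact: subB.
  by apply: eq_bigr => i _; rewrite fB// (nrm_sqr (hBF i)).
have lim i : {yK : F i * R | forall n, nrm (BF i) (f i (x n) - yK.1) <= yK.2 * 2^-1 ^+ n}.
  apply: cid; suff [y [K [_ yK]]] : exists y K, [set: F i] y /\
      forall n, nrm (BF i) (f i (x n) - y) <= K * 2^-1 ^+ n.
    by exists (y, K).
  apply: cBF => // n; rewrite -fB//; apply: le_trans (fx n).
  rewrite -ler_sqr ?nnegrE ?sqrtr_ge0//.
  have := nrmE (x n) n.+1 (Sx n); rewrite (bigD1 i)//= fB// => ->.
  by rewrite lerDl; apply: sumr_ge0 => j _; exact: sqr_ge0.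
pose y i := (sval (lim i)).1; pose K i : R := (sval (lim i)).2.
have yK i n : nrm (BF i) (f i (x n) - y i) <= K i * 2^-1 ^+ n := svalP (lim i) n.
have [z [Sz fz]] := clS x y K Sx yK.
exists z, (Num.sqrt (\sum_i K i ^+ 2)); split=> // n.
rewrite -ler_sqr ?nnegrE ?sqrtr_ge0 ?mulr_ge0 ?sqrtr_ge0// nrmE// exprMn sqr_sqrtr; last first.
  by apply: sumr_ge0 => i _; exact: sqr_ge0.
rewrite mulr_suml; apply: ler_sum => i _; rewrite -exprMn fz.
by rewrite ler_sqr ?nnegrE ?sqrtr_ge0 ?yK// (le_trans _ (yK i n))// sqrtr_ge0.
Qed.

(** * Square-integrable functions *)

Lemma normrM_le_sqrD (R : realDomainType) (a b : R) : `|a * b| <= a ^+ 2 + b ^+ 2.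
Proof. by rewrite ler_norml !expr2; apply/andP; split; nra. Qed.

Lemma sqrrD_le (R : realDomainType) (a b : R) :
  (a + b) ^+ 2 <= 2 * a ^+ 2 + 2 * b ^+ 2.
Proof. by have := sqr_ge0 (a - b); nra. Qed.

Section SquareIntegrable.
Context d (T : measurableType d) (R : realType).
Variable mu : {measure set T -> \bar R}.
Implicit Types (D : set T) (f g h : T -> R).

Definition aeq D f g : Prop := {ae mu, forall x, D x -> f x = g x}.

Lemma aeq_refl D f : aeq D f f.
Proof. exact: aeW. Qed.

Lemma aeq_sym D f g : aeq D f g -> aeq D g f.
Proof. by apply: filterS => x fg /fg. Qed.

Lemma aeq_trans D g f h : aeq D f g -> aeq D g h -> aeq D f h.
Proof. by apply: filterS2 => x fg gh Dx; rewrite fg// gh. Qed.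

Lemma aeqD D f f' g g' : aeq D f f' -> aeq D g g' ->
  aeq D (fun x => f x + g x) (fun x => f' x + g' x).
Proof. by apply: filterS2 => x fg gh Dx; rewrite fg// gh. Qed.

Lemma aeqM D f f' g g' : aeq D f f' -> aeq D g g' ->
  aeq D (fun x => f x * g x) (fun x => f' x * g' x).
Proof. by apply: filterS2 => x fg gh Dx; rewrite fg// gh. Qed.

Lemma aeqS D D' f g : D' `<=` D -> aeq D f g -> aeq D' f g.
Proof. by move=> DD'; apply: filterS => x fg /DD'. Qed.

Lemma aeq_measurable D f g : measure_is_complete mu -> aeq D f g ->
  measurable_fun D f -> measurable_fun D g.
Proof.
move=> cmu fg /measurable_EFinP mf; apply/measurable_EFinP.
apply: (ae_measurable_fun cmu (f := EFin \o f)) mf.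
by apply: filterS fg => x fg Dx /=; rewrite fg.
Qed.

Lemma ae_forall_fin (I : finType) (P : I -> T -> Prop) :
  (forall i, {ae mu, forall x, P i x}) -> {ae mu, forall x, forall i, P i x}.
Proof.
move=> aeP; apply: filterS (_ : {ae mu, forall x, forall i, i \in enum I -> P i x}).
  by move=> x h i; apply: h; rewrite mem_enum.
elim: (enum I) => [|i s IH]; first exact: aeW.
apply: filterS2 (aeP i) IH => x Pi h j; rewrite inE => /predU1P[->//|]; exact: h.
Qed.

Lemma integrable_Rsum D (I : Type) (r : seq I) (F : I -> T -> R) : measurable D ->
  (forall i, mu.-integrable D (EFin \o F i)) ->
  mu.-integrable D (fun x => (\sum_(i <- r) F i x)%:E).
Proof.
move=> mD iF; under eq_fun do rewrite -sumEFin.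
by apply: integrable_sum => // i _; exact: iF.
Qed.

Lemma Rintegral_sum D (I : Type) (r : seq I) (F : I -> T -> R) : measurable D ->
  (forall i, mu.-integrable D (EFin \o F i)) ->
  \int[mu]_(x in D) (\sum_(i <- r) F i x) = \sum_(i <- r) \int[mu]_(x in D) F i x.
Proof.
move=> mD iF; elim: r => [|i r IH].
  under eq_Rintegral do rewrite big_nil.
  by rewrite big_nil Rintegral_cst// mul0r.
under eq_Rintegral do rewrite big_cons.
by rewrite big_cons RintegralD ?IH//; exact: integrable_Rsum.
Qed.

Definition sqint D f : Prop :=
  measurable_fun D f /\ (\int[mu]_(x in D) (f x ^+ 2)%:E < +oo)%E.

Definition ipf D f g : R := \int[mu]_(x in D) (f x * g x).

Let measurable_sq D f : measurable_fun D f ->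
  measurable_fun D (fun x => (f x ^+ 2)%:E).
Proof. by move=> mf; apply/measurable_EFinP; exact: measurable_funX. Qed.

Let sq_ge0 D f x : D x -> (0 <= (f x ^+ 2)%:E)%E.
Proof. by rewrite lee_fin sqr_ge0. Qed.

Lemma sqint_measurable D f : sqint D f -> measurable_fun D f.
Proof. by case. Qed.

Lemma sqint_mul D f g : measurable D -> sqint D f -> sqint D g ->
  mu.-integrable D (fun x => (f x * g x)%:E).
Proof.
move=> mD [mf if2] [mg ig2].
apply/integrableP; split; first by apply/measurable_EFinP; exact: measurable_funM.
apply: (@le_lt_trans _ _ (\int[mu]_(x in D) ((f x ^+ 2)%:E + (g x ^+ 2)%:E))%E).
  apply: ge0_le_integral => //.
  - by apply/measurable_EFinP; apply: measurableT_comp => //; exact: measurable_funM.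
  - by apply: emeasurable_funD; exact: measurable_sq.
  - by move=> x _ /=; rewrite -EFinD lee_fin normrM_le_sqrD.
rewrite ge0_integralD//; [exact: lte_add_pinfty|exact: sq_ge0|exact: measurable_sq|
  exact: sq_ge0|exact: measurable_sq].
Qed.

Lemma sqint_aeq D f g : measurable D -> measure_is_complete mu -> aeq D f g ->
  sqint D f -> sqint D g.
Proof.
move=> mD cmu fg [mf if2]; have mg := aeq_measurable cmu fg mf; split=> //.
apply: le_lt_trans if2.
rewrite (ge0_ae_eq_integral (g := fun x => (f x ^+ 2)%:E) mD) //.
- exact: measurable_sq.
- exact: measurable_sq.
- exact: sq_ge0.
- exact: sq_ge0.
- by apply: filterS fg => x fg Dx; rewrite fg.
Qed.

Lemma sqintD D f g : measurable D -> sqint D f -> sqint D g ->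
  sqint D (fun x => f x + g x).
Proof.
move=> mD [mf if2] [mg ig2]; split; first exact: measurable_funD.
apply: (@le_lt_trans _ _ (\int[mu]_(x in D) (2%:E * (f x ^+ 2)%:E + 2%:E * (g x ^+ 2)%:E))%E).
  apply: ge0_le_integral => //.
  - by apply: sq_ge0.
  - by apply: measurable_sq; exact: measurable_funD.
  - by apply: emeasurable_funD; apply: measurable_funeM; exact: measurable_sq.
  - move=> x _ /=; rewrite -!EFinM -EFinD lee_fin; exact: sqrrD_le.
rewrite ge0_integralD//; last 4 first.
- by move=> x Dx; rewrite mule_ge0//; exact: sq_ge0 Dx.
- by apply: measurable_funeM; exact: measurable_sq.
- by move=> x Dx; rewrite mule_ge0//; exact: sq_ge0 Dx.
- by apply: measurable_funeM; exact: measurable_sq.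
rewrite !ge0_integralZl//; try exact: sq_ge0; try exact: measurable_sq.
by apply: lte_add_pinfty; apply: lte_mul_pinfty.
Qed.

Lemma sqintZ D a f : measurable D -> sqint D f -> sqint D (fun x => a * f x).
Proof.
move=> mD [mf if2]; split; first exact: measurable_funM.
under eq_integral do rewrite exprMn EFinM.
rewrite ge0_integralZl//; try exact: sq_ge0; try exact: measurable_sq.
- by apply: lte_mul_pinfty; rewrite ?lee_fin ?sqr_ge0.
- by rewrite lee_fin sqr_ge0.
Qed.

Lemma sqint0 D : sqint D (fun=> 0).
Proof.
split; first exact: measurable_cst.
by rewrite integral0_eq// => x _; rewrite expr0n.
Qed.

Lemma sqintS D D' f : measurable D -> measurable D' -> D' `<=` D ->
  sqint D f -> sqint D' f.
Proof.
move=> mD mD' DD' [mf if2]; split; first exact: measurable_funS mf.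
apply: le_lt_trans if2; apply: ge0_subset_integral => //.
- exact: measurable_sq.
- exact: sq_ge0.
Qed.

Lemma sqint_bounded D f M : measurable D -> (mu D < +oo)%E ->
  measurable_fun D f -> (forall x, D x -> `|f x| <= M) -> sqint D f.
Proof.
move=> mD Dfin mf fM; split=> //.
apply: (@le_lt_trans _ _ (\int[mu]_(x in D) (cst (M ^+ 2)%:E x))%E).
  apply: ge0_le_integral => //.
  - exact: sq_ge0.
  - exact: measurable_sq.
  - move=> x Dx /=; rewrite lee_fin -real_normK ?num_real// ler_sqr ?nnegrE ?fM//.
    by rewrite (le_trans _ (fM x Dx)).
by rewrite integral_cst// lte_mul_pinfty// lee_fin sqr_ge0.
Qed.

Lemma ipf_aeq D f f' g g' : measurable D -> measure_is_complete mu ->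
  aeq D f f' -> aeq D g g' -> measurable_fun D f -> measurable_fun D g ->
  ipf D f g = ipf D f' g'.
Proof.
move=> mD cmu ff gg mf mg; rewrite /ipf /Rintegral; congr fine.
have mf' := aeq_measurable cmu ff mf; have mg' := aeq_measurable cmu gg mg.
apply: ae_eq_integral => //; try (apply/measurable_EFinP; exact: measurable_funM).
by apply: filterS (aeqM ff gg) => x h Dx; rewrite h.
Qed.

Lemma ipfE D f g : measurable D -> sqint D f -> sqint D g ->
  (\int[mu]_(x in D) (f x * g x)%:E)%E = (ipf D f g)%:E.
Proof.
by move=> mD qf qg; rewrite /ipf /Rintegral fineK// integrable_fin_num//; exact: sqint_mul.
Qed.

Lemma sqint_semi_ip D : measurable D -> semi_ip (sqint D : set (T -> R^o)) (ipf D).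
Proof.
move=> mD; split.
- split; first exact: sqint0.
  by move=> a f g qf qg; apply: (@sqintD D (fun x => a * f x) g) => //; exact: sqintZ.
- move=> a f g h qf qg qh; rewrite /ipf.
  under eq_Rintegral do rewrite -[(_ *: f + g) _]/(a * f _ + g _) mulrDl -mulrA.
  rewrite RintegralD ?RintegralZl//; try exact: sqint_mul.
  under [X in integrable _ _ X]funext => x do rewrite /= EFinM.
  by apply: integrableZl => //; exact: sqint_mul.
- by move=> f g _ _; apply: eq_Rintegral => x _; rewrite mulrC.
- by move=> f _; apply: Rintegral_ge0 => x _; rewrite -expr2 sqr_ge0.
Qed.

Lemma ipf_eq0 D f : measurable D -> sqint D f -> ipf D f f = 0 -> aeq D f (fun=> 0).
Proof.
move=> mD qf f0.
have /ae_eq_integral_abs : (\int[mu]_(x in D) `|(f x ^+ 2)%:E| = 0)%E.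
  rewrite -[RHS](congr1 EFin f0) -ipfE//; apply: eq_integral => x _.
  by rewrite gee0_abs ?lee_fin ?sqr_ge0// expr2.
move=> /(_ mD (measurable_sq (sqint_measurable qf))); apply: filterS => x h Dx.
by apply/eqP; rewrite -sqrf_eq0; have := h Dx => /= -[->].
Qed.

(* Along a fast Cauchy sequence the successive differences are summable almost
   everywhere; Fatou's lemma identifies the pointwise limit as the L2 limit. *)
Lemma riesz_fischer D : measurable D -> (mu D < +oo)%E ->
  fast_complete (sqint D : set (T -> R^o)) (ipf D).
Proof.
move=> mD Dfin f qf ff; have hB := sqint_semi_ip mD.
have q1 : sqint D (cst 1) by apply: (@sqint_bounded _ _ 1) => // x _; rewrite normr1.
have SB k : sqint D (f k.+1 - f k) := subB (ip_sub hB) (qf k.+1) (qf k).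
pose h k x := `|f k.+1 x - f k x|%:E.
have mh k : measurable_fun D (h k).
  by apply/measurable_EFinP; apply: measurableT_comp => //; apply: measurable_funB;
    exact: sqint_measurable.
have h0 k x : (0 <= h k x)%E by rewrite lee_fin.
(* Cauchy-Schwarz against the constant 1, which is square integrable because [D] has finite measure,
   turns the L2 bound on the increments into an L1 bound. *)
have ih k : (\int[mu]_(x in D) h k x <= (2^-1 ^+ k * nrm (ipf D) (cst 1))%:E)%E.
  pose g : T -> R^o := fun x => `|f k.+1 x - f k x|.
  have qg : sqint D g.
    have [m1 i1] := SB k; split; first by apply: measurableT_comp => //.
    by under eq_integral do rewrite real_normK ?num_real//.
  have -> : (\int[mu]_(x in D) h k x)%E = (ipf D g (cst 1))%:E.
    by rewrite -ipfE//; apply: eq_integral => x _; rewrite mulr1.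
  rewrite lee_fin; apply: le_trans (ler_norm _) _.
  apply: le_trans (cauchy_schwarz hB qg q1) _; rewrite ler_wpM2r ?nrm_ge0//.
  apply: le_trans (ff k); rewrite /nrm le_eqVlt; apply/orP; left; apply/eqP.
  by congr Num.sqrt; apply: eq_Rintegral => x _; rewrite -!expr2 real_normK ?num_real.
set c := nrm _ (cst 1) in ih.
have geo N : (\sum_(0 <= k < N) (2^-1 ^+ k * c)%:E <= (2 * c)%:E)%E.
  have -> : (\sum_(0 <= k < N) (2^-1 ^+ k * c)%:E = (2 * c - 2 * c * 2^-1 ^+ N)%:E)%E.
    elim: N => [|N IH]; first by rewrite big_nil expr0 mulr1 subrr.
    by rewrite big_nat_recr//= IH -EFinD exprS; congr _%:E; field.
  by rewrite lee_fin gerBl !mulr_ge0 ?exprn_ge0 ?invr_ge0 ?sqrtr_ge0.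
pose s x := (\sum_(k <oo) h k x)%E.
have is_ : mu.-integrable D s.
  apply/integrableP; split; first by apply: ge0_emeasurable_sum.
  under eq_integral => x do rewrite gee0_abs ?nneseries_ge0//.
  rewrite integral_nneseries//; apply: (@le_lt_trans _ _ (2 * c)%:E); last exact: ltry.
  apply: lime_le.
    by apply: is_cvg_nneseries => k _ _; exact: integral_ge0.
  by apply: nearW => N; apply: le_trans (geo N); apply: lee_sum => k _; exact: ih.
have [N [mN N0 sN]] := integrable_ae mD is_.
(* The value 0 on the exceptional null set makes [g] a pointwise limit of measurable functions on
   all of [D]. *)
pose g x := if x \in N then 0 else limn (fun m => f m x : R^o).
have cvg_f x : D x -> ~ N x -> (fun m => f m x : R^o) @ \oo --> (g x : R^o).
  move=> Dx nNx; rewrite /g memNset//.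
  have sx : s x \is a fin_num by apply: contrapT => /= ns; apply/nNx/sN => /(_ Dx).
  have cvgs : cvgn (series (fun k => f k.+1 x - f k x : R^o)).
    apply: normed_cvg; apply: nondecreasing_is_cvgn.
      by apply: nondecreasing_series => k _ _; exact: normr_ge0.
    exists (fine (s x)) => _ [m _ <-]; rewrite -lee_fin fineK// /series/= -sumEFin.
    by apply: nneseries_lim_ge => k _ _; exact: h0.
  have -> : (fun m => f m x) = (fun m => f 0%N x + series (fun k => f k.+1 x - f k x : R^o) m).
    apply/funext => m; have := eq_sum_telescope (fun m => f m x : R^o) m.
    by rewrite /telescope.
  by apply: is_cvgD => //; exact: is_cvg_cst.
have mg : measurable_fun D g.
  apply: (@measurable_fun_cvg _ _ _ D (fun m x => f m x * \1_(~` N) x)).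
    move=> m; apply: measurable_funM; first exact: sqint_measurable.
    by apply: measurable_indic; exact: measurableC.
  move=> x Dx; rewrite indicE; have [Nx|Nx] := boolP (x \in N).
    rewrite /g Nx memNset; last by apply; exact: set_mem.
    by under eq_fun do rewrite mulr0; exact: cvg_cst.
  have nNx : ~ N x by move=> h'; move: Nx; rewrite mem_set.
  by rewrite mem_set//; under eq_fun do rewrite mulr1; exact: cvg_f.
have sq_bound n : (\int[mu]_(x in D) ((f n x - g x) ^+ 2)%:E <= ((2 * 2^-1 ^+ n) ^+ 2)%:E)%E.
  pose F m x := ((f n x - f m x) ^+ 2)%:E.
  have mF m : measurable_fun D (F m).
    by apply: measurable_sq; apply: measurable_funB; exact: sqint_measurable.
  have F0 m x : D x -> (0 <= F m x)%E by move=> _; rewrite lee_fin sqr_ge0.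
  have limF x : D x -> ~ N x -> limn_einf (F ^~ x) = ((f n x - g x) ^+ 2)%:E.
    move=> Dx nNx.
    have cF : F ^~ x @ \oo --> ((f n x - g x) ^+ 2)%:E.
      apply: cvg_EFin; first exact: nearW.
      rewrite /comp /=; under eq_fun do rewrite expr2; rewrite expr2.
      have cB : (f n x - f m x) @[m --> \oo] --> f n x - g x.
        by apply: cvgB; [exact: cvg_cst|exact: cvg_f].
      exact: cvgM.
    rewrite is_cvg_limn_einfE; last by apply/cvg_ex; exists ((f n x - g x) ^+ 2)%:E.
    exact: cvg_lim cF.
  have mDN : measurable (D `\` N) by exact: measurableD.
  rewrite (ge0_negligible_integral mN mD)//; last 2 first.
  - by apply: measurable_sq; apply: measurable_funB => //; exact: sqint_measurable.
  - exact: sq_ge0.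
  rewrite [leLHS](eq_integral (fun x => limn_einf (F ^~ x))); last first.
    by move=> x; rewrite inE => -[Dx Nx]; rewrite limF.
  have mFN m : measurable_fun (D `\` N) (F m) by apply: measurable_funS (mF m); first exact: mD.
  apply: le_trans (fatou mu mDN mFN _) _; first by move=> m x [Dx _]; exact: F0.
  rewrite limn_einf_lim; apply: lime_le; first exact: is_cvg_einfs.
  (* An index beyond both [k] and [n]: beyond [k] to bound the tail infimum, beyond [n] for
     [fast_dist] to apply. *)
  apply: nearW => k; apply: (@le_trans _ _ (\int[mu]_(x in D `\` N) F (maxn k n) x)%E).
    by apply: ereal_inf_lbound; exists (maxn k n) => //=; exact: leq_maxl.
  apply: (@le_trans _ _ (\int[mu]_(x in D) F (maxn k n) x)%E).
    by apply: ge0_subset_integral => //; exact: F0.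
  have SBn : sqint D (f n - f (maxn k n)) := subB (ip_sub hB) (qf n) (qf (maxn k n)).
  rewrite (_ : integral _ _ _ = (ipf D (f n - f (maxn k n)) (f n - f (maxn k n)))%:E); last first.
    by rewrite -ipfE//; apply: eq_integral => x _; rewrite /F expr2.
  rewrite lee_fin -(nrm_sqr hB)// ler_sqr ?nnegrE ?nrm_ge0//.
  by rewrite (nrmB hB)//; apply: (fast_dist hB) => //; exact: leq_maxr.
have qB n : sqint D (f n - g).
  split; first by apply: measurable_funB => //; exact: sqint_measurable.
  by apply: le_lt_trans (sq_bound n) _; exact: ltry.
exists g, 2; split.
  by have := subB (ip_sub hB) (qf 0%N) (qB 0%N); rewrite opprB addrCA subrr addr0.
move=> n; have r0 : 0 <= 2 * 2^-1 ^+ n :> R by rewrite mulr_ge0// exprn_ge0// invr_ge0.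
rewrite -[leRHS](ger0_norm r0) -sqrtr_sqr ler_wsqrtr// -lee_fin -ipfE//.
by apply: le_trans (sq_bound n); under eq_integral do rewrite -expr2.
Qed.

Lemma sqint_indic D E : measurable D -> (mu D < +oo)%E -> measurable E ->
  sqint D (\1_E : T -> R).
Proof.
move=> mD Dfin mE; apply: (@sqint_bounded _ _ 1) => // x _.
by rewrite indicE; case: (_ \in _); rewrite ?normr1 ?normr0.
Qed.

Lemma ipf_lim0 D f (F : nat -> T -> R) g : measurable D -> (mu D < +oo)%E ->
  sqint D f -> (forall m, measurable_fun D (F m)) ->
  (forall m x, `|F m x| <= 1) -> measurable_fun D g ->
  (forall x, D x -> F m x @[m --> \oo] --> g x) ->
  (forall m, ipf D f (F m) = 0) -> ipf D f g = 0.
Proof.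
move=> mD Dfin qf mF F1 mg Fg F0; have mf := sqint_measurable qf.
have q1 : sqint D (cst 1) by apply: (@sqint_bounded _ _ 1) => // x _; rewrite normr1.
have qF m : sqint D (F m) by apply: (@sqint_bounded _ _ 1).
have if1 : mu.-integrable D (fun x => `|f x|%:E).
  have := integrable_abse (sqint_mul mD qf q1).
  by apply: eq_integrable => // x _; rewrite /= mulr1.
have mfg : measurable_fun D (fun x => (f x * g x)%:E).
  by apply/measurable_EFinP; exact: measurable_funM.
have cfg : {ae mu, forall x, D x -> (f x * F m x)%:E @[m --> \oo] --> (f x * g x)%:E}.
  apply: aeW => x Dx; apply: cvg_EFin; first exact: nearW.
  by apply: cvgMl_tmp; exact: Fg.
have dom : {ae mu, forall x m, D x -> (`|(f x * F m x)%:E| <= `|f x|%:E)%E}.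
  by apply: aeW => x m Dx; rewrite lee_fin normrM -[leRHS]mulr1; apply: ler_pM.
have [_ _ cI] := @dominated_convergence _ _ _ mu D mD (fun m x => (f x * F m x)%:E)
  (fun x => (f x * g x)%:E) (fun x => `|f x|%:E)
  (fun m => measurable_int mu (sqint_mul mD qf (qF m))) mfg cfg if1 dom.
have zE : [sequence (\int[mu]_(x in D) (f x * F m x)%:E)%E]_m = cst 0%E.
  by apply/funext => m /=; rewrite ipfE// F0.
rewrite /ipf /Rintegral -[RHS]/(fine 0%E); congr fine.
by rewrite zE in cI; rewrite -(cvg_lim _ cI)//; exact: lim_cst.
Qed.

(** Off the null part of [E] outside [V], the difference of the indicators is minus the indicator of
    the rest of [V]; Cauchy-Schwarz then leaves the square root of its measure. *)
Lemma ipf_indic_dist D f E V : measurable D -> (mu D < +oo)%E -> sqint D f ->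
  measurable E -> measurable V -> E `<=` D -> V `<=` D ->
  mu (E `\` V) = 0 ->
  `|ipf D f \1_E - ipf D f \1_V| <= nrm (ipf D) f * Num.sqrt (fine (mu (V `\` E))).
Proof.
move=> mD Dfin qf mE mV ED VD EV0; have hB := sqint_semi_ip mD.
have qE := sqint_indic mD Dfin mE; have qV := sqint_indic mD Dfin mV.
have <- : ipf D f ((\1_E : T -> R^o) - (\1_V : T -> R^o)) = ipf D f \1_E - ipf D f \1_V.
  exact: (ipBr hB qE qV qf).
apply: le_trans (cauchy_schwarz hB qf (subB (ip_sub hB) qE qV)) _.
rewrite ler_wpM2l ?nrm_ge0// ler_wsqrtr// /ipf /Rintegral.
suff -> : (\int[mu]_(x in D) (((\1_E : T -> R^o) - (\1_V : T -> R^o)) x *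
   ((\1_E : T -> R^o) - (\1_V : T -> R^o)) x)%:E = mu (V `\` E))%E by [].
rewrite (ge0_negligible_integral (measurableD mE mV) mD)//; last first.
- by move=> x _; rewrite lee_fin -expr2 sqr_ge0.
- have := sqint_mul mD (subB (ip_sub hB) qE qV) (subB (ip_sub hB) qE qV).
  exact: measurable_int.
have mDEV : measurable (D `\` (E `\` V)) by apply: measurableD => //; exact: measurableD.
rewrite (eq_integral (fun x => (\1_(V `\` E) x)%:E)).
  rewrite integral_indic//; last exact: measurableD.
  congr (mu _); apply/seteqP; split=> x /=; first by case.
  move=> [Vx nEx]; split=> //; split; first exact: VD.
  by case.
move=> x; rewrite inE => -[Dx nx]; rewrite -[((_ - _) : T -> R) x]/(\1_E x - \1_V x).
rewrite !indicE; congr _%:E.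
have [Ex|nEx] := pselect (E x); have [Vx|nVx] := pselect (V x).
- by rewrite (mem_set Ex) (mem_set Vx) subrr mul0r memNset//= => -[].
- by exfalso; apply: nx.
- rewrite (memNset nEx) (mem_set Vx) mem_set//= sub0r mulrNN mulr1//.
- by rewrite (memNset nEx) (memNset nVx) subrr mul0r memNset//= => -[].
Qed.

Lemma sqint_eq0 D f : measurable D -> (mu D < +oo)%E -> sqint D f ->
  (forall E, E `<=` D -> measurable E -> ipf D f \1_E = 0) -> aeq D f (fun=> 0).
Proof.
move=> mD Dfin qf f0.
have if1 : mu.-integrable D (EFin \o f).
  have q1 : sqint D (cst 1) by apply: (@sqint_bounded _ _ 1) => // x _; rewrite normr1.
  by have := sqint_mul mD qf q1; apply: eq_integrable => // x _; rewrite /= mulr1.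
have /(_ _)[] // := @integral_ae_eq _ _ _ mu D mD (cst 0%E) (EFin \o f) if1 (measurable_cst _).
  move=> E ED mE; rewrite integral0 -{1}(setIidr ED) integral_mkcondr.
  have := f0 E ED mE; have qE := sqint_indic mD Dfin mE.
  rewrite -[0%E]/(0%:E) => <-; rewrite -ipfE//; apply: eq_integral => x _.
  by rewrite patchE /= indicE; case: ifP => _; rewrite ?mulr1 ?mulr0.
move=> N [mN N0 sN]; exists N; split=> // x nx; apply: sN => /= h; apply: nx => Dx.
by have [] := h Dx.
Qed.

Section Restriction.
Variables (D : set T) (mD : measurable D).

Lemma ae_mrestr (P : T -> Prop) :
  {ae mrestr mu mD, forall x, P x} <-> {ae mu, forall x, D x -> P x}.
Proof.
split=> [[N [mN N0 PN]]|[N [mN N0 PN]]].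
  exists (N `&` D); split; [exact: measurableI|exact: N0|].
  by move=> x /= /not_implyP[Dx nPx]; split=> //; exact: PN.
exists (N `|` ~` D); split.
- by apply: measurableU => //; exact: measurableC.
- rewrite /= /mrestr setIUl setICl setU0; apply/eqP; rewrite -measure_le0 -N0.
  by apply: le_measure; rewrite ?inE//; exact: measurableI.
- move=> x nPx; have [Dx|nDx] := pselect (D x); last by right.
  by left; apply: PN => /= /(_ Dx).
Qed.

Lemma ge0_integral_mrestr (h : T -> \bar R) : measurable_fun setT h ->
  (forall x, 0 <= h x)%E ->
  (\int[mrestr mu mD]_x h x = \int[mu]_(x in D) h x)%E.
Proof.
move=> mh h0; have mC := measurableC mD.
rewrite -(setvU D) ge0_integral_setU//; last 2 first.
- by rewrite setvU.
- by rewrite disj_set2E setICl.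
rewrite (_ : integral _ (~` _) _ = 0%E) ?add0e.
  by apply: eq_measure_integral => X mX XD; rewrite /= /mrestr setIidl.
apply: null_set_integral => //; first exact: measurable_funS mh.
by rewrite /= /mrestr setICl measure0.
Qed.

Lemma finite_norm2P (f : T -> R) : measurable_fun setT f ->
  finite_norm (mrestr mu mD) 2 f <-> (\int[mu]_(x in D) (f x ^+ 2)%:E < +oo)%E.
Proof.
move=> mf; rewrite /finite_norm unlock.
have -> : (\int[mrestr mu mD]_x (`|(EFin \o f) x| `^ 2) =
    \int[mu]_(x in D) (f x ^+ 2)%:E)%E.
  rewrite -ge0_integral_mrestr.
  - by apply: eq_integral => x _ /=; rewrite powR_mulrn// real_normK ?num_real.
  - by apply/measurable_EFinP; exact: measurable_funX.
  - by move=> x; rewrite lee_fin sqr_ge0.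
split; last exact: poweR_lty.
by apply: lty_poweRy; rewrite invr_eq0.
Qed.

End Restriction.
End SquareIntegrable.

(** * L2 classes, their representatives and inner products *)

Section L2Space.
Context {R : realType} {n : nat}.
Local Notation Rd := 'rV[R]_n.+1.
Local Notation lebT := (@lebT R n).
Local Notation leb := (@leb R n).
Implicit Types (O : opens R n) (f g : lebT -> R).
Local Open Scope quotient_scope.

Lemma leb_complete : measure_is_complete leb.
Proof. exact: measure_is_complete_caratheodory. Qed.

Lemma measurable_opens O : measurable (O : set lebT).
Proof. by apply: open_measurable_leb; exact: oset_open. Qed.

Lemma L2fun_sqint O (u : L2fun O) : sqint leb O u.
Proof.
have mu : measurable_fun setT (u : lebT -> R) by [].
split; first exact: measurable_funS mu.
by apply/(finite_norm2P leb (open_measurable_leb (@oset_open _ _ O))).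
Qed.

Lemma L2_sqint O (u : L2 O) : sqint leb O u.
Proof. exact: L2fun_sqint. Qed.

Lemma L2_measurable O (u : L2 O) : measurable_fun (O : set lebT) (u : lebT -> R).
Proof. exact: sqint_measurable (L2_sqint u). Qed.

Lemma L2pi_eq O (a b : L2fun O) : \pi_(L2 O) a = \pi_(L2 O) b <-> aeq leb O a b.
Proof.
have -> : \pi_(L2 O) a = \pi_(L2 O) b <-> a - b \in @ae_null R n O.
  by rewrite Quotient.idealrBE; split => [->//|/eqP].
split=> [/asboolP/ae_mrestr|ab]; last (apply/asboolP/ae_mrestr; move: ab).
- by apply: filterS => x h Ox; apply/eqP; rewrite -subr_eq0; apply/eqP; exact: h.
- by apply: filterS => x h Ox; apply/eqP; rewrite subr_eq0; apply/eqP; exact: h.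
Qed.

Lemma L2_eqP O (u v : L2 O) : u = v <-> aeq leb O u v.
Proof. by rewrite -L2pi_eq !reprK. Qed.

Lemma L2rep_pi O (a : L2fun O) : aeq leb O (\pi_(L2 O) a : L2 O) a.
Proof. by apply/L2pi_eq; rewrite reprK. Qed.

Lemma L2repD O (u v : L2 O) : aeq leb O (u + v : L2 O) (fun x => u x + v x).
Proof.
have -> : u + v = \pi_(L2 O) (repr u + repr v) by rewrite L2piD !reprK.
exact: L2rep_pi.
Qed.

Lemma L2repZ O a (u : L2 O) : aeq leb O (a *: u : L2 O) (fun x => a * u x).
Proof.
have -> : a *: u = \pi_(L2 O) (a *: repr u) by [].
exact: L2rep_pi.
Qed.

Lemma L2_exists O f : sqint leb O f -> exists u : L2 O, aeq leb O u f.
Proof.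
move=> [mf f2]; have mO := measurable_opens O.
(* A member of [L2fun] is measurable on the whole space, hence the extension by zero. *)
pose g : lebT -> R := f \_ O.
have gf : aeq leb O g f by apply: aeW => x Ox; rewrite /g patchE mem_set.
have mg : measurable_fun setT g by apply/measurable_restrict => //; rewrite setIidr.
have Pg : g \in Lfun (leb_on O) 2%:E.
  rewrite inE; apply/andP; rewrite !inE; split=> //=.
  apply/finite_norm2P => //; apply: le_lt_trans f2.
  by rewrite le_eqVlt; apply/orP; left; apply/eqP; apply: eq_integral => x xO; rewrite /g patchE xO.
exists (\pi_(L2 O) (Lfun_Sub (lee1n 2) Pg : L2fun O)).
by apply: aeq_trans gf; apply: aeq_trans (L2rep_pi _) _; rewrite Lfun_valP; exact: aeq_refl.
Qed.

Lemma ip_aeq (D : set lebT) f f' g g' : measurable D ->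
  aeq leb D f f' -> aeq leb D g g' -> measurable_fun D f -> measurable_fun D g ->
  ip D f g = ip D f' g'.
Proof. by move=> mD; apply: ipf_aeq => //; exact: leb_complete. Qed.

Definition ipL2 O (u v : L2 O) : R := ip O u v.

Lemma L2_semi_ip O : semi_ip [set: L2 O] (@ipL2 O).
Proof.
have mO := measurable_opens O; have hB := sqint_semi_ip leb mO.
split=> //.
- move=> a u v w _ _ _; have qu := L2_sqint u; have qv := L2_sqint v.
  rewrite -[RHS](ip_lin hB)//; last exact: L2_sqint.
  apply: ip_aeq => //; [|exact: aeq_refl|exact: L2_measurable|exact: L2_measurable].
  by apply: aeq_trans (L2repD _ _) _; apply: aeqD (L2repZ _ _) _; exact: aeq_refl.
- by move=> u v _ _; exact: (ip_sym hB (L2_sqint u) (L2_sqint v)).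
- by move=> u _; exact: (ip_ge0 hB (L2_sqint u)).
Qed.

Lemma ipL2_eq0 O (u : L2 O) : ipL2 u u = 0 -> u = 0.
Proof.
move=> u0; apply/L2_eqP.
have {}u0 := ipf_eq0 (measurable_opens O) (L2_sqint u) u0.
apply: aeq_trans u0 _; apply: aeq_sym.
have := L2repZ 0 (0 : L2 O); rewrite scale0r => h; apply: aeq_trans h _.
by apply: aeW => x _; rewrite mul0r.
Qed.

Lemma norm2E O (u : L2 O) : norm2 u = nrm (@ipL2 O) u. Proof. by []. Qed.

Lemma L2repB O (u v : L2 O) : aeq leb O (u - v : L2 O) (fun x => u x - v x).
Proof.
apply: aeq_trans (L2repD _ _) _; apply: aeqD; first exact: aeq_refl.
rewrite -scaleN1r; apply: aeq_trans (L2repZ _ _) _.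
by apply: aeW => x _; rewrite mulN1r.
Qed.

Lemma L2_complete O : (leb O < +oo)%E -> fast_complete [set: L2 O] (@ipL2 O).
Proof.
move=> Ofin u _ fu; pose U k : lebT -> R^o := L2rep (u k); have mO := measurable_opens O.
have distE (v : L2 O) k (g : lebT -> R) : sqint leb O g -> aeq leb O v g ->
    nrm (@ipL2 O) (u k - v) = nrm (ipf leb O) (U k - g).
  move=> qg vg; rewrite /nrm; congr Num.sqrt.
  have uvE : aeq leb O (u k - v : L2 O) (U k - g).
    apply: aeq_trans (L2repB _ _) _.
    by apply: filterS vg => x h Ox; rewrite h.
  by apply: ip_aeq => //; exact: L2_measurable.
have [|g [K [qg gK]]] := riesz_fischer mO Ofin (x := U) (fun k => L2_sqint (u k)).
  by move=> k; rewrite -(distE (u k) k.+1 _ (L2_sqint _) (aeq_refl _ _ _)); exact: fu.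
have [v vg] := L2_exists qg.
by exists v, K; split=> // k; rewrite (distE v k g).
Qed.

Variable k : Ukind.

Definition sqintU (D : set lebT) (F : lebT -> Umat R n k) : Prop :=
  forall i j, sqint leb D (fun x => F x i j).

Definition aeqU (D : set lebT) (F G : lebT -> Umat R n k) : Prop :=
  {ae leb, forall x : lebT, D x -> F x = G x}.

Lemma aeqU_entry (D : set lebT) (F G : lebT -> Umat R n k) i j : aeqU D F G ->
  aeq leb D (fun x => F x i j) (fun x => G x i j).
Proof. by apply: filterS => x FG Dx; rewrite FG. Qed.

Lemma aeqU_entries (D : set lebT) (F G : lebT -> Umat R n k) :
  (forall i j, aeq leb D (fun x => F x i j) (fun x => G x i j)) -> aeqU D F G.
Proof.
move=> FG; have : {ae leb, forall x : lebT, forall ij, D x -> F x ij.1 ij.2 = G x ij.1 ij.2}.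
  by apply: ae_forall_fin => -[i j]; exact: FG.
by apply: filterS => x h Dx; apply/matrixP => i j; exact: (h (i, j) Dx).
Qed.

Lemma ipU_sum (D : set lebT) F G : measurable D -> sqintU D F -> sqintU D G ->
  ipU D F G = \sum_i \sum_j ip D (fun x => F x i j) (fun x => G x i j).
Proof.
move=> mD qF qG; rewrite /ipU /frob.
rewrite Rintegral_sum//; last first.
  move=> i; apply: integrable_Rsum => // j; exact: sqint_mul.
by apply: eq_bigr => i _; rewrite Rintegral_sum// => j; exact: sqint_mul.
Qed.

Lemma ipU_aeq (D : set lebT) F F' G G' : measurable D ->
  aeqU D F F' -> aeqU D G G' -> sqintU D F -> sqintU D G ->
  ipU D F G = ipU D F' G'.
Proof.
move=> mD FF GG qF qG; have qF' : sqintU D F'.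
  by move=> i j; apply: sqint_aeq (aeqU_entry i j FF) _ => //; exact: leb_complete.
have qG' : sqintU D G'.
  by move=> i j; apply: sqint_aeq (aeqU_entry i j GG) _ => //; exact: leb_complete.
rewrite !ipU_sum//; apply: eq_bigr => i _; apply: eq_bigr => j _.
apply: ip_aeq mD (aeqU_entry i j FF) (aeqU_entry i j GG) _ _;
  [exact: sqint_measurable (qF i j)|exact: sqint_measurable (qG i j)].
Qed.

Lemma L2mx_sqintU O (w : L2mx k O) : sqintU O (L2mxrep w).
Proof.
move=> i j; have := L2_sqint (w i j); congr sqint.
by apply/funext => x; rewrite /L2mxrep mxE.
Qed.

Definition ipL2mx O (w z : L2mx k O) : R := ipU O (L2mxrep w) (L2mxrep z).

Lemma ipL2mxE O (w z : L2mx k O) : ipL2mx w z = \sum_i \sum_j ipL2 (w i j) (z i j).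
Proof.
rewrite /ipL2mx ipU_sum; [|exact: measurable_opens|exact: L2mx_sqintU|exact: L2mx_sqintU].
apply: eq_bigr => i _; apply: eq_bigr => j _; apply: eq_Rintegral => x _.
by rewrite /L2mxrep !mxE.
Qed.

Lemma L2mx_semi_ip O : semi_ip [set: L2mx k O] (@ipL2mx O).
Proof.
have hB := L2_semi_ip O; split=> //.
- move=> a u v w _ _ _; rewrite !ipL2mxE mulr_sumr -big_split; apply: eq_bigr => i _ /=.
  by rewrite mulr_sumr -big_split; apply: eq_bigr => j _ /=; exact: (ip_lin hB).
- move=> u v _ _; rewrite !ipL2mxE; apply: eq_bigr => i _; apply: eq_bigr => j _.
  exact: (ip_sym hB).
- move=> u _; rewrite ipL2mxE; apply: sumr_ge0 => i _; apply: sumr_ge0 => j _.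
  exact: (ip_ge0 hB).
Qed.

Lemma ipL2mx_eq0 O (w : L2mx k O) : ipL2mx w w = 0 -> w = 0.
Proof.
have hB := L2_semi_ip O.
rewrite ipL2mxE => /eqP; rewrite psumr_eq0 => [/allP w0|i _]; last first.
  by apply: sumr_ge0 => j _; exact: (ip_ge0 hB).
apply/funext => i; apply/funext => j; apply: ipL2_eq0.
have /eqP/eqP := w0 i (mem_index_enum _); rewrite psumr_eq0 => [/allP wi|j' _]; last first.
  exact: (ip_ge0 hB).
by have /eqP := wi j (mem_index_enum _).
Qed.

Lemma norm2UE O (w : L2mx k O) : norm2U w = nrm (@ipL2mx O) w. Proof. by []. Qed.

Lemma L2mx_complete O : (leb O < +oo)%E -> fast_complete [set: L2mx k O] (@ipL2mx O).
Proof.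
move=> Ofin.
apply: (@fast_complete_graph R _ _ (fun _ => L2 O)
  (fun _ => @ipL2 O) (fun ij w => w ij.1 ij.2)).
- by move=> ?; exact: L2_semi_ip.
- by move=> ?; exact: L2_complete.
- by [].
- by move=> w z _ _; rewrite ipL2mxE pair_big.
- by [].
- by move=> x y K _ _; exists (fun i j => y (i, j)); split=> // -[i j].
Qed.

Lemma L2mx_eqP O (w z : L2mx k O) : w = z <-> aeqU O (L2mxrep w) (L2mxrep z).
Proof.
split=> [->|wz]; first exact: aeW.
apply/funext => i; apply/funext => j; apply/L2_eqP.
by apply: filterS (aeqU_entry i j wz) => x h /h; rewrite /L2mxrep !mxE.
Qed.

End L2Space.

(** * The fundamental lemma of the calculus of variations *)

Section FundamentalLemma.
Context {R : realType} {n : nat}.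
Local Notation Rd := 'rV[R]_n.+1.
Local Notation lebT := (@lebT R n).
Local Notation leb := (@leb R n).
Implicit Types (O : opens R n) (V : set Rd) (f g : Rd -> R).

Lemma flat1_ge0 (t : R) : 0 <= flat 1 t.
Proof. by rewrite /flat; case: ifP => // _; rewrite hornerC mul1r expR_ge0. Qed.

Lemma flat1_le1 (t : R) : flat 1 t <= 1.
Proof.
rewrite /flat; case: ifP => // t0; rewrite hornerC mul1r -expR0 ler_expR.
by rewrite oppr_le0 invr_ge0 ltW.
Qed.

Lemma flat1_gt0 (t : R) : (0 < flat 1 t) = (0 < t).
Proof. by rewrite /flat; case: ifP => // t0; rewrite hornerC mul1r expR_gt0. Qed.

Definition bump (a b : Rd) : Rd -> R :=
  fun x => \prod_i (flat 1 (1 * x 0 i + - a 0 i) * flat 1 (-1 * x 0 i + b 0 i)).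

Lemma smooth_bump a b : smooth (bump a b).
Proof.
by apply: smooth_prod => i _; apply: smoothM; exact: smooth_flat.
Qed.

Lemma bump_ge0 a b x : 0 <= bump a b x.
Proof. by apply: prodr_ge0 => i _; rewrite mulr_ge0// flat1_ge0. Qed.

Lemma bump_le1 a b x : bump a b x <= 1.
Proof.
apply: prodr_ile1 => i _; rewrite mulr_ge0 ?flat1_ge0//=.
by rewrite mulr_ile1 ?flat1_ge0 ?flat1_le1.
Qed.

Lemma bump_gt0 a b x : open_box a b x -> 0 < bump a b x.
Proof.
move=> xab; apply: prodr_gt0 => i _.
by rewrite mulr_gt0// flat1_gt0; have := xab i; lra.
Qed.

Lemma bump_eq0 a b x : ~ open_box a b x -> bump a b x = 0.
Proof.
have flat0 (t : R) : ~~ (0 < t) -> flat 1 t = 0 by rewrite /flat => /negPf ->.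
move=> /existsNP[i nxi]; rewrite /bump (bigD1 i)//=.
suff -> : flat 1 (1 * x 0 i - a 0 i) * flat 1 (-1 * x 0 i + b 0 i) = 0 by rewrite mul0r.
have [ax|ax] := ltP (a 0 i) (x 0 i); last by rewrite flat0 ?mul0r// -leNgt; lra.
have [xb|xb] := ltP (x 0 i) (b 0 i); last by rewrite mulrC flat0 ?mul0r// -leNgt; lra.
by case: nxi; rewrite ax.
Qed.

Lemma bounded_box (a b : Rd) : bounded_set (box a b).
Proof.
exists (`|a| + `|b|); split; first exact: num_real.
move=> M abM x xab; apply: (le_trans _ (ltW abM)).
rewrite [X in X <= _]/Num.norm/= mx_normrE; apply/bigmax_leP; split=> [|[u i] _]/=.
  by rewrite addr_ge0.
rewrite ord1; have := xab i; have := rV_le_norm a i; have := rV_le_norm b i.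
by move: `|a| `|b| => A B; rewrite !ler_norml; lra.
Qed.

Lemma test_bump (V : set Rd) a b : box a b `<=` V -> test_function V (bump a b).
Proof.
move=> abV; have sub : supp (bump a b) `<=` box a b.
  rewrite [X in _ `<=` X](closure_id _).1; last exact: closed_box.
  apply: closureS => x /= /eqP bx; apply: sub_open_box; apply: contrapT => nx.
  by apply: bx; exact: bump_eq0.
split; [exact: smooth_bump| |exact: subset_trans abV].
apply: (@subclosed_compact _ _ (box a b)) => //; first exact: closed_closure.
by apply: bounded_closed_compact; [exact: bounded_box|exact: closed_box].
Qed.

(** 1 - fg = (1 - f) + (1 - g) - (1 - f)(1 - g). Test functions have no unit, so products that equal
    1 near infinity are handled through their complements. *)
Lemma test_complM V f g : test_function V (fun x => 1 - f x) ->
  test_function V (fun x => 1 - g x) -> test_function V (fun x => 1 - f x * g x).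
Proof.
move=> tf tg; rewrite (_ : (fun x => _) = fun x =>
    ((1 - f x) + (1 - g x)) + -1 * ((1 - f x) * (1 - g x))).
  apply: testD; first exact: testD.
  by apply: test_scale; apply: test_mulr tf _; exact: test_smooth tg.
by apply/funext => x; ring.
Qed.

Lemma test_compl_exp V f m : test_function V (fun x => 1 - f x) ->
  test_function V (fun x => 1 - f x ^+ m).
Proof.
move=> tf; elim: m => [|m IH].
  by rewrite (_ : (fun x => _) = fun=> 0); [exact: test0|
    apply/funext => x; rewrite expr0 subrr].
rewrite (_ : (fun x => _) = fun x => 1 - f x * f x ^+ m); first exact: test_complM.
by apply/funext => x; rewrite exprS.
Qed.

Lemma test_compl_prod V (F : nat -> Rd -> R) m :
  (forall j, test_function V (fun x => 1 - F j x)) ->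
  test_function V (fun x => 1 - \prod_(j < m) F j x).
Proof.
move=> tF; elim: m => [|m IH].
  by rewrite (_ : (fun x => _) = fun=> 0); [exact: test0|
    apply/funext => x; rewrite big_ord0 subrr].
rewrite (_ : (fun x => _) = fun x => 1 - \prod_(j < m) F j x * F m x).
  exact: test_complM.
by apply/funext => x; rewrite big_ord_recr.
Qed.

Lemma open_rational_box V x : open V -> V x -> exists ab : 'rV[rat]_n.+1 * 'rV[rat]_n.+1,
  open_box (map_mx ratr ab.1) (map_mx ratr ab.2) x /\
  box (map_mx ratr ab.1) (map_mx ratr ab.2) `<=` V.
Proof.
move=> oV Vx; have /nbhs_ballP[e e0 xeV] := open_nbhs_nbhs (conj oV Vx).
have qe i : {q : rat * rat | x 0 i - e < ratr q.1 < x 0 i /\ x 0 i < ratr q.2 < x 0 i + e}.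
  apply: cid.
  have /rat_in_itvoo[q1 q1P] : x 0 i - e < x 0 i by rewrite ltrBlDr ltrDl.
  have /rat_in_itvoo[q2 q2P] : x 0 i < x 0 i + e by rewrite ltrDl.
  by exists (q1, q2); move: q1P q2P; rewrite !in_itv.
exists (\row_i (sval (qe i)).1, \row_i (sval (qe i)).2); split.
  by move=> i; rewrite !mxE; case: (qe i) => q /= [/andP[_ ->] /andP[-> _]].
move=> y yab; apply: xeV; split=> // i j; rewrite ord1.
have := yab j; rewrite !mxE; case: (qe j) => q /= [/andP[a1 a2] /andP[a3 a4]].
by move=> /andP[b1 b2]; rewrite /ball/= ltr_distl; lra.
Qed.

(** The rational boxes contained in [V] are countably many and their interiors cover [V]. An index
    that does not decode to such a box gets the zero function. *)
Lemma open_bumps V : open V -> exists phi : nat -> Rd -> R,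
  [/\ forall j, test_function V (phi j), forall j x, 0 <= phi j x <= 1,
      forall x, V x -> exists j, 0 < phi j x &
      forall j x, ~ V x -> phi j x = 0].
Proof.
move=> oV.
pose good (ab : 'rV[rat]_n.+1 * 'rV[rat]_n.+1) :=
  `[< box (map_mx ratr ab.1) (map_mx ratr ab.2) `<=` (V : set Rd) >].
pose phi j : Rd -> R := if unpickle j is Some ab then
  (if good ab then bump (map_mx ratr ab.1) (map_mx ratr ab.2) else fun=> 0)
  else fun=> 0.
have tphi j : test_function V (phi j).
  rewrite /phi; case: unpickle => [ab|]; last exact: test0.
  by case: ifPn => [/asboolP|_]; [exact: test_bump|exact: test0].
exists phi; split=> //.
- move=> j x; rewrite /phi; case: unpickle => [ab|]; last by rewrite lexx ler01.
  by case: ifPn => _; rewrite ?bump_ge0 ?bump_le1// lexx ler01.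
- move=> x Vx; have [ab [xab abV]] := open_rational_box oV Vx.
  exists (pickle ab); rewrite /phi pickleK ifT; first exact: bump_gt0.
  exact/asboolP.
- by move=> j x; exact: test_out (tphi j).
Qed.

(* [1 - \prod_(j < m) (1 - phi_j) ^+ m] for bumps [phi_j] whose supports exhaust [V] *)
Lemma indic_approx V : open V -> exists F : nat -> Rd -> R,
  [/\ forall m, test_function V (F m), forall m x, `|F m x| <= 1 &
      forall x, F m x @[m --> \oo] --> (\1_V x : R)].
Proof.
move=> /open_bumps[phi [tphi phi01 phi_gt0 phi_out]].
pose P m x := \prod_(j < m) (1 - phi j x) ^+ m.
have P01 m x : 0 <= P m x <= 1.
  have h j : 0 <= (1 - phi j x) ^+ m <= 1.
    have := phi01 j x => /andP[p0 p1].
    by rewrite exprn_ge0 ?exprn_ile1//; lra.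
  by rewrite prodr_ge0 ?prodr_ile1// => j _; have /andP[] := h j.
exists (fun m x => 1 - P m x); split.
- move=> m; apply: (@test_compl_prod V (fun j x => (1 - phi j x) ^+ m)) => j.
  apply: test_compl_exp; rewrite (_ : (fun x => _) = phi j)//.
  by apply/funext => x; rewrite opprB addrCA subrr addr0.
- by move=> m x; have /andP[p0 p1] := P01 m x; rewrite ger0_norm; lra.
- move=> x; rewrite indicE; have [Vx|nVx] := pselect (V x); last first.
    rewrite memNset// (_ : (fun m => _) = cst 0); first exact: cvg_cst.
    apply/funext => m; rewrite /P big1 ?subrr// => j _.
    by rewrite phi_out// subr0 expr1n.
  rewrite mem_set//= -[X in _ --> X]subr0; apply: cvgB; first exact: cvg_cst.
  have [j pj] := phi_gt0 x Vx; have /andP[p0 p1] := phi01 j x.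
  (* Once m > j, the product is at most its j-th factor (1 - phi_j(x))^m, which tends to 0 because
     phi_j(x) > 0. *)
  apply: (@squeeze_cvgr _ _ _ _ (cst 0) (GRing.exp (1 - phi j x))).
  + near=> m; have /andP[-> _] /= := P01 m x.
    have jm : (j < m)%N by near: m; exact: nbhs_infty_gt.
    rewrite /P (bigD1 (Ordinal jm))//= -[leRHS]mulr1 ler_wpM2l ?exprn_ge0 ?subr_ge0//.
    apply: prodr_ile1 => l _; have /andP[q0 q1] := phi01 l x.
    by rewrite exprn_ge0 ?exprn_ile1//; lra.
  + exact: cvg_cst.
  + by apply: cvg_expr; rewrite ger0_norm; lra.
Unshelve. all: by end_near.
Qed.

(** Outer regularity passes from open to measurable sets: [u] is orthogonal to the indicators of
    open subsets of [O], and one of these approximates any given measurable [E]. Orthogonality to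
    all indicators gives u = 0. *)
Theorem fundamental_lemma O (u : L2 O) : (leb O < +oo)%E ->
  (forall f, test_function O f -> ip O u f = 0) -> u = 0.
Proof.
move=> Ofin uf; have mO := measurable_opens O; have qu := L2_sqint u.
have opens0 V : open V -> V `<=` O -> ipf leb O u \1_V = 0.
  move=> oV VO; have [F [tF F1 cF]] := indic_approx oV.
  apply: (@ipf_lim0 _ lebT R leb O u F) => //.
  - by move=> m; exact: measurable_funS (test_measurable (tF m)).
  - by apply: measurable_indic; exact: open_measurable_leb.
  - by move=> m; apply: uf; exact: test_subset (tF m).
have E0 E : E `<=` O -> measurable (E : set lebT) -> ipf leb O u \1_E = 0.
  move=> EO mE; apply/eqP; rewrite -normr_eq0 eq_le normr_ge0 andbT.
  have Efin : (leb E < +oo)%E by apply: le_lt_trans Ofin; exact: le_lebesgue_outer.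
  apply: (@le0_of_geometric _ _ (nrm (ipf leb O) (u : Rd -> R^o))) => k.
  (* The tolerance is a square because [ipf_indic_dist] takes the square root of the measure of the
     difference. *)
  have e0 : 0 < (2^-1 ^+ k) ^+ 2 :> R by rewrite !exprn_gt0// invr_gt0.
  have [V [oV EV0 leV]] := outer_regular Efin e0.
  have mV : measurable (V : set lebT) by exact: open_measurable_leb.
  have oVO : open (V `&` O) by apply: openI => //; exact: oset_open.
  have mVO : measurable (V `&` O : set lebT) by exact: open_measurable_leb.
  have := @ipf_indic_dist _ lebT R leb O u E (V `&` O) mO Ofin qu mE mVO EO _ _.
  rewrite (opens0 _ oVO (@subIsetr _ _ _)) subr0.
  move=> h; apply: le_trans (h _ _) _; first exact: subIsetr.
    by apply: leb_null_sub EV0 => x [Ex nVO]; split=> // Vx; apply: nVO; split=> //; exact: EO.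
  rewrite ler_wpM2l ?sqrtr_ge0//.
  have r0 : 0 <= 2^-1 ^+ k :> R by rewrite exprn_ge0// invr_ge0.
  rewrite -[leRHS](ger0_norm r0) -[leRHS]sqrtr_sqr ler_wsqrtr// -lee_fin fineK; last first.
    rewrite ge0_fin_numE//; apply: le_lt_trans Ofin; apply: le_lebesgue_outer.
    by move=> x [[]].
  apply: (@le_trans _ _ (leb (V `\` E))).
    by apply: le_lebesgue_outer => x [[]].
  have VEE : leb (V `&` E) = leb E.
    by rewrite setIC [RHS](measureDI leb mE mV) [X in (X + _)%E]EV0 add0e.
  have Vfin : (leb V < +oo)%E.
    by apply: le_lt_trans leV _; rewrite lte_add_pinfty// ltry.
  by rewrite measureD// [X in (_ - X)%E]VEE leeBlDl// ge0_fin_numE.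
have u0 := sqint_eq0 mO Ofin qu E0.
apply/L2_eqP; apply: aeq_trans u0 _; apply: aeq_sym.
have := L2repZ 0 (0 : L2 O); rewrite scale0r => h; apply: aeq_trans h _.
by apply: aeW => x _; rewrite mul0r.
Qed.

End FundamentalLemma.

(** * Weak operators on a domain and on a mesh *)

Section Frobenius.
Context {R : realType} {n : nat} {k : Ukind}.
Local Notation Umat := (Umat R n k).
Implicit Types (M N : Umat).

Lemma frobC M N : frob M N = frob N M.
Proof. by apply: eq_bigr => i _; apply: eq_bigr => j _; rewrite mulrC. Qed.

Lemma frobDl M M' N : frob (M + M') N = frob M N + frob M' N.
Proof.
rewrite /frob -big_split; apply: eq_bigr => i _; rewrite -big_split.
by apply: eq_bigr => j _; rewrite mxE mulrDl.
Qed.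

Lemma frobZl a M N : frob (a *: M) N = a * frob M N.
Proof.
rewrite /frob mulr_sumr; apply: eq_bigr => i _; rewrite mulr_sumr.
by apply: eq_bigr => j _; rewrite mxE mulrA.
Qed.

Lemma frobDr M N N' : frob M (N + N') = frob M N + frob M N'.
Proof. by rewrite frobC frobDl !(frobC M). Qed.

Lemma frobZr a M N : frob M (a *: N) = a * frob M N.
Proof. by rewrite frobC frobZl (frobC M). Qed.

Lemma frob0l N : frob (0 : Umat) N = 0.
Proof. by rewrite -[0 : Umat](scale0r 0) frobZl mul0r. Qed.

Lemma frob_suml (I : Type) (r : seq I) (F : I -> Umat) N :
  frob (\sum_(i <- r) F i) N = \sum_(i <- r) frob (F i) N.
Proof. by elim/big_rec2 : _ => [|i y x _ <-]; rewrite ?frob0l ?frobDl. Qed.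

Lemma frob_delta M i j : frob M (delta_mx i j) = M i j.
Proof.
rewrite /frob (bigD1 i)//= (bigD1 j)//= !mxE !eqxx mulr1.
rewrite big1 ?addr0 => [|j' /negPf jj]; last by rewrite mxE jj andbF mulr0.
rewrite big1 ?addr0// => i' /negPf ii.
by rewrite big1// => j' _; rewrite mxE ii mulr0.
Qed.

Lemma frob_ge0 M : 0 <= frob M M.
Proof. by apply: sumr_ge0 => i _; apply: sumr_ge0 => j _; rewrite -expr2 sqr_ge0. Qed.

Lemma frob_eq0 M : frob M M = 0 -> M = 0.
Proof.
move=> /eqP; rewrite psumr_eq0 => [/allP M0|i _]; last first.
  by apply: sumr_ge0 => j _; rewrite -expr2 sqr_ge0.
apply/matrixP => i j; rewrite mxE; apply/eqP; rewrite -sqrf_eq0 expr2.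
have := M0 i (mem_index_enum _); rewrite psumr_eq0 => [/allP Mi|j' _]; last first.
  by rewrite -expr2 sqr_ge0.
exact: Mi j (mem_index_enum _).
Qed.

End Frobenius.

Section Projection.
Context {R : realType} {n : nat}.

(** The orthogonal projection onto U for the Frobenius product. It turns a matrix unit into an
    admissible U-valued direction that still picks out an entry of a U-valued field. *)
Definition projU k : Umat R n k -> Umat R n k :=
  match k with
  | Usym => fun M => 2^-1 *: (M + M^T)
  | _ => id
  end.

Lemma projU_in k (M : Umat R n k) : in_U k (projU M).
Proof. by case: k M => //= M i j; rewrite !mxE addrC. Qed.

Lemma projU_id k (M : Umat R n k) : in_U k M -> projU M = M.
Proof.
case: k M => //= M symM; apply/matrixP => i j; rewrite !mxE (symM j i).
by field.
Qed.

Lemma projUD k (M N : Umat R n k) : projU (M + N) = projU M + projU N.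
Proof. by case: k M N => //= M N; apply/matrixP => i j; rewrite !mxE; ring. Qed.

Lemma projUZ k a (M : Umat R n k) : projU (a *: M) = a *: projU M.
Proof. by case: k M => //= M; rewrite linearZ/= -scalerDr !scalerA mulrC. Qed.

Lemma frob_projU k (M N : Umat R n k) : frob (projU M) N = frob M (projU N).
Proof.
have trE (P Q : 'M[R]_n.+1) : @frob R n Usym P^T Q = @frob R n Usym P Q^T.
  by rewrite /frob exchange_big; apply: eq_bigr => i _; apply: eq_bigr => j _; rewrite !mxE.
by case: k M N => //= M N; rewrite frobZl frobZr frobDl frobDr trE.
Qed.

Lemma in_UD k (M N : Umat R n k) : in_U k M -> in_U k N -> in_U k (M + N).
Proof. by case: k M N => //= M N hM hN i j; rewrite !mxE hM hN. Qed.

Lemma in_UZ k a (M : Umat R n k) : in_U k M -> in_U k (a *: M).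
Proof. by case: k M => //= M hM i j; rewrite !mxE hM. Qed.

Lemma in_U0 k : in_U k (0 : Umat R n k).
Proof. by case: k => //= i j; rewrite !mxE. Qed.

Lemma in_U_sum k (I : Type) (r : seq I) (F : I -> Umat R n k) :
  (forall i, in_U k (F i)) -> in_U k (\sum_(i <- r) F i).
Proof. by move=> hF; elim/big_ind : _ => //; [exact: in_U0|exact: in_UD]. Qed.

Lemma L2U_rep k (O : opens R n) (w : L2mx k O) x : L2U w -> in_U k (L2mxrep w x).
Proof. by rewrite /L2U; case: k w => //= w hw i j; rewrite !mxE hw. Qed.

Lemma L2U_subspace k (O : opens R n) : is_subspace (@L2U R n k O).
Proof.
split; first by rewrite /L2U; case: k.
by rewrite /L2U; case: k => //= a x y hx hy i j;
  rewrite -[(a *: x + y) i j]/(a *: x i j + y i j) hx hy.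
Qed.

Lemma L2U_of_ae k (O : opens R n) (w : L2mx k O) (F : _ -> Umat R n k) :
  aeqU O (L2mxrep w) F -> (forall x, in_U k (F x)) -> L2U w.
Proof.
rewrite /L2U; case: k w F => //= w F wF hF i j; apply/L2_eqP.
apply: filterS wF => x wF Ox; have := wF Ox => /matrixP E.
by have := E i j; have := E j i; rewrite !mxE => -> ->; exact: hF.
Qed.

Lemma nrm_entry k (O : opens R n) (w : L2mx k O) i j :
  nrm (@ipL2 R n O) (w i j) <= nrm (@ipL2mx R n k O) w.
Proof.
rewrite ler_wsqrtr// ipL2mxE (bigD1 i)//= (bigD1 j)//= -addrA lerDl.
have h0 u v : 0 <= ipL2 (w u v) (w u v) by exact: (ip_ge0 (L2_semi_ip O)).
by rewrite addr_ge0// sumr_ge0// => u _; rewrite sumr_ge0.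
Qed.

Lemma L2U_closed k (O : opens R n) (w : nat -> L2mx k O) (v : L2mx k O) K :
  (forall m, L2U (w m)) -> (forall m, nrm (@ipL2mx R n k O) (w m - v) <= K * 2^-1 ^+ m) ->
  L2U v.
Proof.
rewrite /L2U; case: k w v => //= w v wU wv i j; apply/eqP; rewrite -subr_eq0; apply/eqP.
have hB := L2_semi_ip O; apply: ipL2_eq0.
apply/eqP; rewrite -(nrm_sqr hB)// sqrf_eq0 eq_le nrm_ge0 andbT.
apply: (@le0_of_geometric _ _ (K + K)) => m.
have -> : v i j - v j i = (w m - v) j i - (w m - v) i j.
  rewrite -[(w m - v) j i]/(w m j i - v j i) -[(w m - v) i j]/(w m i j - v i j).
  by rewrite (wU m i j) opprB [RHS]addrC addrA subrK.
rewrite mulrDl; apply: le_trans (nrmD hB _ _) _ => //.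
by rewrite (nrmN hB)//; apply: lerD; apply: le_trans (nrm_entry _ _ _) (wv m).
Qed.

End Projection.

Section FormalAdjoints.
Context {R : realType} {n : nat} {k : Ukind} (A : diffop R n k).
Local Notation Rd := 'rV[R]_n.+1.
Local Notation lebT := (@lebT R n).
Local Notation leb := (@leb R n).
Local Notation Umat := (Umat R n k).
Implicit Types (O : set Rd) (f g : Rd -> R) (F G : Rd -> Umat).

Lemma smooth_test_frob O (c : Umat) F : test_functionU O F ->
  test_function O (fun x => frob c (F x)).
Proof.
move=> [_ tF]; rewrite /frob; apply: test_sum => i; apply: test_sum => j.
exact: test_scale.
Qed.

Lemma test_opA O f : test_function O f -> test_functionU O (opA A f).
Proof.
move=> tf; split=> [x|i j].
  by apply: in_U_sum => s; apply: in_UZ; exact: do_coef_in.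
rewrite (_ : (fun x => _) =
    fun x => \sum_(s < do_size A) do_coef s i j * mi_deriv (do_mi s) f x).
  by apply: test_sum => s; apply: test_scale; exact: test_mi_deriv.
apply/funext => x; rewrite /opA summxE; apply: eq_bigr => s _.
by rewrite mxE mulrC.
Qed.

Lemma test_opAs O F : test_functionU O F -> test_function O (opAs A F).
Proof.
move=> tF; apply: test_sum => s; apply: test_scale; apply: test_mi_deriv.
exact: smooth_test_frob.
Qed.

Lemma opA_by_parts O O' f F : test_function O f -> test_functionU O' F ->
  \int[leb]_x frob (opA A f x) (F x) = \int[leb]_x (f x * opAs A F x).
Proof.
move=> tf tF; pose g (s : 'I_(do_size A)) x := frob (do_coef s) (F x).
have tg s : test_function O' (g s) by exact: smooth_test_frob.
have sg s := test_smooth (tg s).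
pose a (s : 'I_(do_size A)) x := mi_deriv (do_mi s) f x * g s x.
pose b (s : 'I_(do_size A)) x := (-1) ^+ mi_order (do_mi s) * (f x * mi_deriv (do_mi s) (g s) x).
have E1 : (fun x => frob (opA A f x) (F x)) = fun x => \sum_(s < do_size A) a s x.
  by apply/funext => x; rewrite /opA frob_suml; apply: eq_bigr => s _; rewrite frobZl.
have E2 : (fun x => f x * opAs A F x) = fun x => \sum_(s < do_size A) b s x.
  by apply/funext => x; rewrite /opAs mulr_sumr; apply: eq_bigr => s _; rewrite /b mulrCA.
have tfg s : test_function O (fun x => f x * mi_deriv (do_mi s) (g s) x).
  by apply: test_mulr tf _; exact: smooth_mi_deriv.
have ia s : leb.-integrable setT (EFin \o a s).
  by apply: (@test_integrable _ _ O); apply: test_mulr => //; exact: test_mi_deriv.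
have ib s : leb.-integrable setT (EFin \o b s).
  by apply: (@test_integrable _ _ O); exact: test_scale.
rewrite E1 E2.
rewrite (Rintegral_sum _ measurableT ia) (Rintegral_sum _ measurableT ib).
apply: eq_bigr => s _; rewrite (mi_deriv_by_parts _ tf (sg s)) RintegralZl//.
exact: test_integrable (tfg s).
Qed.

Lemma ip_subset (D D' : set lebT) f g : D `<=` D' -> (forall x, ~ D x -> g x = 0) ->
  ip D' f g = ip D f g.
Proof.
move=> DD' g0; rewrite /ip [LHS]Rintegral_mkcond [RHS]Rintegral_mkcond.
apply: eq_Rintegral => x _; rewrite !patchE.
case: ifPn => xD'; case: ifPn => xD //.
- by rewrite g0 ?mulr0//; apply/asboolPn; rewrite notin_setE in xD; apply/asboolP.
- by move: xD xD'; rewrite inE notin_setE => /DD'.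
Qed.

Lemma ipU_subset (D D' : set lebT) F G : D `<=` D' -> (forall x, ~ D x -> G x = 0) ->
  ipU D' F G = ipU D F G.
Proof.
move=> DD' g0; rewrite /ipU [LHS]Rintegral_mkcond [RHS]Rintegral_mkcond.
apply: eq_Rintegral => x _; rewrite !patchE.
case: ifPn => xD'; case: ifPn => xD //.
- by rewrite g0 ?(frobC _ 0) ?frob0l//; rewrite notin_setE in xD.
- by move: xD xD'; rewrite inE notin_setE => /DD'.
Qed.

Lemma testU_out O F x : test_functionU O F -> ~ O x -> F x = 0.
Proof.
by move=> [_ tF] nOx; apply/matrixP => i j; rewrite mxE; exact: test_out (tF i j) nOx.
Qed.

Lemma opA_adjoint O (D : set lebT) f F : test_function O f -> test_functionU D F ->
  ipU D (opA A f) F = ip D f (opAs A F).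
Proof.
move=> tf tF; have tAF := test_opAs tF.
have E : ipU setT (opA A f) F = ip setT f (opAs A F) by exact: opA_by_parts tf tF.
rewrite (@ipU_subset D) in E; [|exact: subsetT|move=> x; exact: testU_out].
by rewrite E; apply: ip_subset; [exact: subsetT|move=> x; exact: test_out].
Qed.

End FormalAdjoints.

Section Representatives.
Context {R : realType} {n : nat}.
Local Notation Rd := 'rV[R]_n.+1.
Local Notation lebT := (@lebT R n).
Local Notation leb := (@leb R n).

Definition toL2 (O : opens R n) (f : Rd -> R) : L2 O :=
  xget 0 [set u : L2 O | aeq leb O u f].

Lemma toL2P (O : opens R n) (f : Rd -> R) : sqint leb O f -> aeq leb O (toL2 O f) f.
Proof. by move=> /L2_exists h; exact: (xgetPex 0 h). Qed.

Lemma toL2_eq (O : opens R n) (f : Rd -> R) (u : L2 O) : sqint leb O f ->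
  aeq leb O u f -> toL2 O f = u.
Proof.
move=> qf uf; apply/L2_eqP; apply: aeq_trans (toL2P qf) _; exact: aeq_sym.
Qed.

Lemma ip_toL2 (O : opens R n) (f g : Rd -> R) : sqint leb O f -> sqint leb O g ->
  ip O f g = ipL2 (toL2 O f) (toL2 O g).
Proof.
move=> qf qg; apply: ip_aeq; first exact: measurable_opens.
- exact: aeq_sym (toL2P qf).
- exact: aeq_sym (toL2P qg).
- exact: sqint_measurable qf.
- exact: sqint_measurable qg.
Qed.

Lemma toL2_id (O : opens R n) (u : L2 O) : toL2 O u = u.
Proof. by apply: toL2_eq; [exact: L2_sqint|exact: aeq_refl]. Qed.

Context {k : Ukind}.

Definition toL2mx (O : opens R n) (F : Rd -> Umat R n k) : L2mx k O :=
  fun i j => toL2 O (fun x => F x i j).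

Lemma toL2mxP (O : opens R n) (F : Rd -> Umat R n k) : sqintU O F ->
  aeqU O (L2mxrep (toL2mx O F)) F.
Proof.
move=> qF; apply: aeqU_entries => i j.
by apply: filterS (toL2P (qF i j)) => x h /h; rewrite /L2mxrep mxE.
Qed.

Lemma ipU_toL2mx (O : opens R n) (F G : Rd -> Umat R n k) : sqintU O F -> sqintU O G ->
  ipU O F G = ipL2mx (toL2mx O F) (toL2mx O G).
Proof.
move=> qF qG; apply: ipU_aeq => //; first exact: measurable_opens.
- by apply: filterS (toL2mxP qF) => x h /h ->.
- by apply: filterS (toL2mxP qG) => x h /h ->.
Qed.

Lemma toL2mx_id (O : opens R n) (w : L2mx k O) : toL2mx O (L2mxrep w) = w.
Proof.
apply/funext => i; apply/funext => j; rewrite -[RHS]toL2_id; congr toL2.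
by apply/funext => x; rewrite mxE.
Qed.

Lemma toL2mx_in (O : opens R n) (F : Rd -> Umat R n k) : sqintU O F ->
  (forall x, in_U k (F x)) -> L2U (toL2mx O F).
Proof. by move=> qF; apply: L2U_of_ae; exact: toL2mxP. Qed.

Lemma test_sqint (O : set Rd) (D : set lebT) (f : Rd -> R) : measurable D ->
  (leb D < +oo)%E -> test_function O f -> sqint leb D f.
Proof.
move=> mD Dfin tf; have [M _ fM] := test_bounded tf.
apply: (@sqint_bounded _ _ _ _ _ _ M) => //.
exact: measurable_funS (test_measurable tf).
Qed.

Lemma test_sqintU (O : set Rd) (D : set lebT) (F : Rd -> Umat R n k) : measurable D ->
  (leb D < +oo)%E -> test_functionU O F -> sqintU D F.
Proof. by move=> mD Dfin [_ tF] i j; exact: test_sqint (tF i j). Qed.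

Lemma sqintUS (D D' : set lebT) (F : Rd -> Umat R n k) : measurable D -> measurable D' ->
  D' `<=` D -> sqintU D F -> sqintU D' F.
Proof. by move=> mD mD' DD' qF i j; exact: sqintS (qF i j). Qed.

End Representatives.

Section ClosedRelation.
Context {R : realType} {X Y : lmodType R}.
Variables (BX : X -> X -> R) (BY : Y -> Y -> R).
Hypotheses (hX : semi_ip setT BX) (hY : semi_ip setT BY).
Variables (S : set Y) (sS : is_subspace S) (P : set (Y * X)).

(** The adjoint of the relation [P], that is, a weak derivative with [P] as the graph of test pairs.
    It is linear for any [P], and closed when [S] is. *)
Definition adjoint_rel (x : X) (y : Y) : Prop :=
  S y /\ forall p, P p -> BY y p.1 = BX x p.2.

Lemma adjoint_rel_lin a x x' y y' : adjoint_rel x y -> adjoint_rel x' y' ->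
  adjoint_rel (a *: x + x') (a *: y + y').
Proof.
move=> [Sy xy] [Sy' xy']; split; first by case: sS => _; exact.
by move=> p Pp; rewrite (ip_lin hX)// (ip_lin hY)// xy// xy'.
Qed.

Lemma adjoint_rel0 : adjoint_rel 0 0.
Proof. by split; [case: sS|move=> p _; rewrite (ip0l hX)// (ip0l hY)]. Qed.

Hypothesis clS : forall (y : nat -> Y) z K, (forall m, S (y m)) ->
  (forall m, nrm BY (y m - z) <= K * 2^-1 ^+ m) -> S z.

Lemma adjoint_rel_closed (x : nat -> X) (y : nat -> Y) x0 y0 K K' :
  (forall m, adjoint_rel (x m) (y m)) ->
  (forall m, nrm BX (x m - x0) <= K * 2^-1 ^+ m) ->
  (forall m, nrm BY (y m - y0) <= K' * 2^-1 ^+ m) -> adjoint_rel x0 y0.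
Proof.
move=> xy xx0 yy0; split; first by apply: (clS _ yy0) => m; case: (xy m).
move=> p Pp; apply/eqP; rewrite -subr_eq0 -normr_eq0 eq_le normr_ge0 andbT.
apply: (@le0_of_geometric _ _ (K' * nrm BY p.1 + K * nrm BX p.2)) => m.
have [_ /(_ _ Pp) xym] := xy m.
have -> : BY y0 p.1 - BX x0 p.2 = BX (x m - x0) p.2 - BY (y m - y0) p.1.
  rewrite (ipBl hX)// (ipBl hY)// xym; ring.
rewrite addrC mulrDl; apply: le_trans (ler_normD _ _) _; rewrite normrN; apply: lerD.
  apply: le_trans (cauchy_schwarz hY _ _) _ => //.
  by rewrite mulrAC ler_wpM2r// nrm_ge0.
apply: le_trans (cauchy_schwarz hX _ _) _ => //.
by rewrite mulrAC ler_wpM2r// nrm_ge0.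
Qed.

End ClosedRelation.

(** * Gluing functions and splitting integrals over the mesh *)

Section Family.
Context {R : realType} {n : nat}.
Local Notation Rd := 'rV[R]_n.+1.
Local Notation lebT := (@lebT R n).
Local Notation leb := (@leb R n).

Lemma sqint_patch (D D' : set lebT) (f : lebT -> R) : measurable D -> measurable D' ->
  D `<=` D' -> sqint leb D f -> sqint leb D' (f \_ D).
Proof.
move=> mD mD' DD' [mf f2]; split.
  apply: (measurable_funS measurableT) => //.
  by apply/measurable_restrict => //; rewrite setTI.
have -> : (\int[leb]_(x in D') ((f \_ D) x ^+ 2)%:E =
           \int[leb]_(x in D) (f x ^+ 2)%:E)%E => [|//].
rewrite [LHS]integral_mkcond [RHS]integral_mkcond; apply: eq_integral => x _.
rewrite !patchE; case: ifPn => xD'; case: ifPn => xD //; last 1 first.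
- by move: xD xD'; rewrite inE notin_setE => /DD'.
- by rewrite expr0n.
Qed.

Variables (Om : opens R n) (Omfin : (leb Om < +oo)%E).
Variables (N : nat) (T : 'I_N -> opens R n).
Hypotheses (TOm : forall i, T i `<=` Om) (disjT : trivIset setT (fun i => T i : set Rd))
  (nullT : leb (Om `\` \bigcup_i T i) = 0%E).

Let mOm := measurable_opens Om.
Let mT i := measurable_opens (T i).

Lemma leb_family_fin i : (leb (T i) < +oo)%E.
Proof. by apply: le_lt_trans Omfin; exact: le_lebesgue_outer. Qed.

Lemma sum_patch (g : 'I_N -> lebT -> R) i (x : Rd) : (T i : set Rd) x ->
  \sum_j (g j \_ (T j)) x = g i x.
Proof.
move=> Tix; rewrite (bigD1 i)//= patchE mem_set// big1 ?addr0// => j ji.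
rewrite patchE; case: ifPn => //; rewrite inE => Tjx.
have : j = i by apply: (disjT _ _) => //; exists x.
by move/eqP; rewrite (negPf ji).
Qed.

Lemma sqint_sum_patch (g : 'I_N -> lebT -> R) : (forall i, sqint leb (T i) (g i)) ->
  sqint leb Om (fun x => \sum_j (g j \_ (T j)) x).
Proof.
move=> qg; have := sub_sum (ip_sub (sqint_semi_ip leb mOm)) (index_enum 'I_N)
  (F := fun i => (g i \_ (T i) : lebT -> R^o)) (fun i => sqint_patch (mT i) mOm (@TOm i) (qg i)).
by congr sqint; apply/funext => x; rewrite fct_sumE.
Qed.

(** The two sides differ at most on the skeleton: inside an element exactly one summand survives, by
    disjointness. *)
Lemma aeq_sum_patch (f : lebT -> R) : aeq leb Om f (fun x => \sum_j (f \_ (T j)) x).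
Proof.
have := negligible_null nullT; apply: negligibleS => x /= h.
split; first by apply: contrapT => nOx; apply: h => /nOx.
by move=> [i _ Tix]; apply: h => _; rewrite (@sum_patch (fun=> f) i).
Qed.

Lemma ip_family (f g : lebT -> R) : sqint leb Om f -> sqint leb Om g ->
  ip Om f g = \sum_i ip (T i) f g.
Proof.
move=> qf qg; have qgT i := sqintS mOm (mT i) (@TOm i) qg.
rewrite (ip_aeq mOm (aeq_refl _ _ _) (aeq_sum_patch g)); last 2 first.
- exact: sqint_measurable qf.
- exact: sqint_measurable qg.
have hB := sqint_semi_ip leb mOm.
have qp i := sqint_patch (mT i) mOm (@TOm i) (qgT i).
have E : ipf leb Om f (\sum_i (g \_ (T i) : lebT -> R^o)) =
    \sum_i ipf leb Om f (g \_ (T i)).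
  rewrite (ip_sym hB)//; last by apply: (sub_sum (ip_sub hB)) => i; exact: qp.
  by rewrite (ip_suml hB)//; apply: eq_bigr => i _; rewrite (ip_sym hB).
transitivity (ipf leb Om f (\sum_i (g \_ (T i) : lebT -> R^o))).
  by rewrite /ip /ipf; apply: eq_Rintegral => x _; rewrite fct_sumE.
rewrite E; apply: eq_bigr => i _.
rewrite -[LHS]/(ip Om f (g \_ (T i))) (@ip_subset _ _ (T i)) => [|//|x nx]; last 1 first.
- by rewrite patchE memNset.
- by apply: eq_Rintegral => x xT; rewrite patchE xT.
Qed.

Lemma ipU_family k (F G : lebT -> Umat R n k) : sqintU Om F -> sqintU Om G ->
  ipU Om F G = \sum_i ipU (T i) F G.
Proof.
move=> qF qG; rewrite ipU_sum//.
have qFT i := sqintUS mOm (mT i) (@TOm i) qF; have qGT i := sqintUS mOm (mT i) (@TOm i) qG.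
under [RHS]eq_bigr => i _ do rewrite (ipU_sum (mT i) (qFT i) (qGT i)).
rewrite [RHS]exchange_big; apply: eq_bigr => a _; rewrite [RHS]exchange_big.
by apply: eq_bigr => b _; exact: ip_family.
Qed.

End Family.

(** * Elementwise weak operators as relations on the whole domain *)

Section PiecewiseOperators.
Context {R : realType} {n : nat} {k : Ukind} (A : diffop R n k).
Local Notation Rd := 'rV[R]_n.+1.
Local Notation lebT := (@lebT R n).
Local Notation leb := (@leb R n).
Local Notation Umat := (Umat R n k).
Variable Om : opens R n.
Local Notation E := (L2 Om).
Local Notation G := (L2mx k Om).

Section Relations.
Variables (N : nat) (T : 'I_N -> opens R n).

(** The test functions of single elements are read as elements of the L2 spaces over [Om]. The
    elementwise derivatives then form one relation between global spaces, to which linearity and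
    closedness of [adjoint_rel] apply at once. *)
Definition testsA : set (G * E) :=
  [set p | exists i F, test_functionU (T i) F /\
           p = (toL2mx Om F, toL2 Om (opAs A F))].
Definition testsAs : set (E * G) :=
  [set p | exists i f, test_function (T i) f /\
           p = (toL2 Om f, toL2mx Om (opA A f))].

Definition relA : E -> G -> Prop := adjoint_rel (@ipL2 R n Om) (@ipL2mx R n k Om) (@L2U R n k Om) testsA.
Definition relAs : G -> E -> Prop := adjoint_rel (@ipL2mx R n k Om) (@ipL2 R n Om) setT testsAs.
End Relations.

Section Family.
Hypothesis (Omfin : (leb Om < +oo)%E).
Variables (N : nat) (T : 'I_N -> opens R n).
Hypotheses (TOm : forall i, T i `<=` Om) (disjT : trivIset setT (fun i => T i : set Rd))
  (nullT : leb (Om `\` \bigcup_i T i) = 0%E).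

Let mOm := measurable_opens Om.
Let mT i := measurable_opens (T i).

Lemma ip_test i (v : E) f : test_function (T i) f ->
  ipL2 v (toL2 Om f) = ip (T i) v f.
Proof.
move=> tf; have qf := test_sqint mOm Omfin tf.
rewrite -{1}[v]toL2_id -(ip_toL2 (L2_sqint v) qf).
by apply: ip_subset => // x; exact: test_out.
Qed.

Lemma ipU_test i (w : G) F : test_functionU (T i) F ->
  ipL2mx w (toL2mx Om F) = ipU (T i) (L2mxrep w) F.
Proof.
move=> tF; have qF := test_sqintU mOm Omfin tF.
rewrite -{1}[w]toL2mx_id -(ipU_toL2mx (L2mx_sqintU w) qF).
by apply: ipU_subset => // x; exact: testU_out.
Qed.

Lemma relAP (v : E) (g : G) : relA T v g <-> L2U g /\
  forall i F, test_functionU (T i) F -> ipU (T i) (L2mxrep g) F = ip (T i) v (opAs A F).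
Proof.
split=> -[gU h]; split; [exact: gU|move=> i F tF|exact: gU|move=> _ [i [F [tF ->]]] /=].
  rewrite -ipU_test// -ip_test; last exact: test_opAs.
  by apply: (h (_, _)); exists i, F.
by rewrite (ipU_test _ tF) h// (ip_test _ (test_opAs _ tF)).
Qed.

Lemma relAsP (w : G) (g : E) : relAs T w g <->
  forall i f, test_function (T i) f -> ip (T i) g f = ipU (T i) (L2mxrep w) (opA A f).
Proof.
split=> [[_ h]|h]; last split=> // _ [i [f [tf ->]]] /=.
  move=> i f tf; rewrite -ipU_test; last exact: test_opA.
  by rewrite -ip_test//; apply: (h (_, _)); exists i, f.
by rewrite (ip_test _ tf) h// (ipU_test _ (test_opA _ tf)).
Qed.

(** The fundamental lemma on each element; the skeleton, where nothing is tested, is null. *)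
Lemma L2_tests_eq0 (v : E) :
  (forall i f, test_function (T i) f -> ip (T i) v f = 0) -> v = 0.
Proof.
move=> v0; have v0T i : aeq leb (T i) v (fun=> 0).
  have qv := sqintS mOm (mT i) (@TOm i) (L2_sqint v).
  have vi := toL2P qv; apply: aeq_trans (aeq_sym vi) _.
  suff -> : toL2 (T i) v = 0.
    by have := L2repZ 0 (0 : L2 (T i)); rewrite scale0r; apply: filterS => x h /h ->; rewrite mul0r.
  apply: fundamental_lemma; first exact: (leb_family_fin Omfin TOm).
  move=> f tf; rewrite -(v0 i f tf); apply: ip_aeq => //; first exact: aeq_refl.
    exact: L2_measurable.
  exact: measurable_funS (test_measurable tf).
apply/L2_eqP; apply: aeq_trans (aeq_sum_patch disjT nullT v) _.
have : {ae leb, forall x : lebT, forall i, (T i : set lebT) x -> (v : lebT -> R) x = 0}.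
  by apply: ae_forall_fin => i; exact: v0T.
have := L2repZ 0 (0 : L2 Om); rewrite scale0r; apply: filterS2 => x h1 h2 Ox.
rewrite h1// mul0r big1// => i _; rewrite patchE; case: ifPn => //.
by rewrite inE => /h2.
Qed.

Lemma L2mx_tests_eq0 (w : G) : L2U w ->
  (forall i F, test_functionU (T i) F -> ipU (T i) (L2mxrep w) F = 0) -> w = 0.
Proof.
move=> wU w0; apply/funext => a; apply/funext => b; apply: L2_tests_eq0 => i f tf.
(* The projected matrix unit keeps [F] in U; since [w] is U-valued, the projection moves onto [w],
   where it is the identity, and the entry (a, b) remains. *)
pose F x : Umat := f x *: projU (delta_mx a b).
have tF : test_functionU (T i) F.
  split=> [x|c d]; first by apply: in_UZ; exact: projU_in.
  rewrite (_ : (fun x => _) = fun x => (projU (delta_mx a b) : Umat) c d * f x).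
    exact: test_scale.
  by apply/funext => x; rewrite /F mxE mulrC.
rewrite -(w0 i F tF); apply: eq_Rintegral => x _.
by rewrite frobZr -frob_projU projU_id ?frob_delta ?mxE 1?mulrC//; exact: L2U_rep.
Qed.

Lemma relA_uniq (v : E) (g g' : G) : relA T v g -> relA T v g' -> g = g'.
Proof.
move=> vg vg'; apply/eqP; rewrite -subr_eq0; apply/eqP.
have [dU d0] : relA T (v - v) (g - g').
  rewrite -scaleN1r addrC -[in X in relA T _ X]scaleN1r [g + _]addrC.
  exact: (adjoint_rel_lin (L2_semi_ip Om) (L2mx_semi_ip k Om) (L2U_subspace k Om) (-1) vg' vg).
rewrite subrr in d0; apply: L2mx_tests_eq0 => // i F tF; rewrite -ipU_test//.
have := d0 (toL2mx Om F, toL2 Om (opAs A F)); rewrite (ip0l (L2_semi_ip Om))//=.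
by apply; exists i, F.
Qed.

Lemma relAs_uniq (w : G) (g g' : E) : relAs T w g -> relAs T w g' -> g = g'.
Proof.
move=> wg wg'; apply/eqP; rewrite -subr_eq0; apply/eqP.
have [_ d0] : relAs T (w - w) (g - g').
  rewrite -scaleN1r addrC -[in X in relAs T _ X]scaleN1r [g + _]addrC.
  by apply: (adjoint_rel_lin (L2mx_semi_ip k Om) (L2_semi_ip Om) _ (-1) wg' wg); split.
rewrite subrr in d0; apply: L2_tests_eq0 => // i f tf; rewrite -ip_test//.
have := d0 (toL2 Om f, toL2mx Om (opA A f)); rewrite (ip0l (L2mx_semi_ip k Om))//=.
by apply; exists i, f.
Qed.

End Family.
End PiecewiseOperators.

Section WeakOperatorTheory.
Context {R : realType} {n : nat} {k : Ukind} (A : diffop R n k).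
Local Notation Rd := 'rV[R]_n.+1.
Local Notation lebT := (@lebT R n).
Local Notation leb := (@leb R n).
Local Notation Umat := (Umat R n k).
Implicit Types O Om : opens R n.

Definition single O : 'I_1 -> opens R n := fun=> O.

Lemma single_sub O i : single O i `<=` O. Proof. by []. Qed.

Lemma single_disj O : trivIset setT (fun i => single O i : set Rd).
Proof. by move=> i j _ _ _; rewrite !ord1. Qed.

Lemma single_null O : leb (O `\` \bigcup_i single O i) = 0%E.
Proof.
rewrite (_ : _ `\` _ = set0) ?measure0//; apply/seteqP; split=> // x [Ox] []; by exists ord0.
Qed.

Section OneDomain.
Variables (O : opens R n) (Ofin : (leb O < +oo)%E).

Lemma distrA_uniq (v : Rd -> R) (g g' : L2mx k O) :
  distrA A v g -> distrA A v g' -> g = g'.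
Proof.
move=> [gU vg] [gU' vg']; apply/eqP; rewrite -subr_eq0; apply/eqP.
have sTOm i := @single_sub O i.
apply: (L2mx_tests_eq0 Ofin sTOm (@single_disj O) (single_null O)).
  exact: (subB (L2U_subspace k O) gU gU').
move=> i F tF; rewrite -(ipU_test Ofin sTOm _ tF) (ipBl (L2mx_semi_ip k O))//.
by rewrite !(ipU_test Ofin sTOm _ tF) vg// vg'// subrr.
Qed.

Lemma distrAs_uniq (w : Rd -> Umat) (g g' : L2 O) :
  distrAs A w g -> distrAs A w g' -> g = g'.
Proof.
move=> wg wg'; apply/eqP; rewrite -subr_eq0; apply/eqP.
have sTOm i := @single_sub O i.
apply: (L2_tests_eq0 Ofin sTOm (@single_disj O) (single_null O)) => i f tf.
rewrite -(ip_test Ofin sTOm _ tf) (ipBl (L2_semi_ip O))//.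
by rewrite !(ip_test Ofin sTOm _ tf) wg// wg'// subrr.
Qed.

(** Uniqueness identifies the element chosen by [xget], so [weakA] can be computed from any
    witness. *)
Lemma weakA_eq (v : Rd -> R) (g : L2mx k O) : distrA A v g -> weakA A O v = g.
Proof.
move=> vg; apply: (distrA_uniq _ vg); rewrite /weakA.
have h : exists g, [set g0 : L2mx k O | distrA A v g0] g by exists g.
exact: (xgetPex 0 h).
Qed.

Lemma weakAs_eq (w : Rd -> Umat) (g : L2 O) : distrAs A w g -> weakAs A O w = g.
Proof.
move=> wg; apply: (distrAs_uniq _ wg); rewrite /weakAs.
have h : exists g, [set g0 : L2 O | distrAs A w g0] g by exists g.
exact: (xgetPex 0 h).
Qed.

Lemma relA_single (v : L2 O) (g : L2mx k O) : relA A (single O) v g <-> distrA A v g.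
Proof.
split=> [/(relAP A Ofin (@single_sub O))[gU h]|[gU h]]; first by split=> // F; exact: (h ord0).
by apply/(relAP A Ofin (@single_sub O)); split=> // i F; exact: h.
Qed.

Lemma relAs_single (w : L2mx k O) (g : L2 O) :
  relAs A (single O) w g <-> distrAs A (L2mxrep w) g.
Proof.
split=> [/(relAsP A Ofin (@single_sub O)) h f|h]; first exact: (h ord0).
by apply/(relAsP A Ofin (@single_sub O)) => i f; exact: h.
Qed.

End OneDomain.

Section Mesh.
Variables (Om : opens R n) (Omfin : (leb Om < +oo)%E).
Variables (N : nat) (T : 'I_N -> opens R n).
Hypotheses (TOm : forall i, T i `<=` Om) (disjT : trivIset setT (fun i => T i : set Rd))
  (nullT : leb (Om `\` \bigcup_i T i) = 0%E).

Let mOm := measurable_opens Om.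
Let mT i := measurable_opens (T i).

Lemma ip_res i (u g : L2 Om) : ip (T i) u (toL2 (T i) g) = ip (T i) u g.
Proof.
have q (v : L2 Om) := sqintS mOm (mT i) (@TOm i) (L2_sqint v).
apply: (ip_aeq (mT i)); [exact: aeq_refl|exact: (toL2P (q g))|exact: sqint_measurable (q u)|].
exact: L2_measurable.
Qed.

Lemma sqintU_res i (w : L2mx k Om) : sqintU (T i) (L2mxrep w).
Proof. exact: sqintUS mOm (mT i) (@TOm i) (L2mx_sqintU w). Qed.

Lemma ipU_res i (w g : L2mx k Om) :
  ipU (T i) (L2mxrep w) (L2mxrep (toL2mx (T i) (L2mxrep g))) =
  ipU (T i) (L2mxrep w) (L2mxrep g).
Proof.
apply: (ipU_aeq (mT i)); [exact: aeW|exact: (toL2mxP (@sqintU_res i g))|exact: sqintU_res|].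
exact: L2mx_sqintU.
Qed.

Lemma sum_ip_res (u g : L2 Om) : \sum_i ip (T i) u (toL2 (T i) g) = ipL2 u g.
Proof.
under eq_bigr do rewrite ip_res.
exact: (esym (ip_family TOm disjT nullT (L2_sqint u) (L2_sqint g))).
Qed.

Lemma sum_ipU_res (w g : L2mx k Om) :
  \sum_i ipU (T i) (L2mxrep w) (L2mxrep (toL2mx (T i) (L2mxrep g))) = ipL2mx w g.
Proof.
under eq_bigr do rewrite ipU_res.
exact: (esym (ipU_family TOm disjT nullT (L2mx_sqintU w) (L2mx_sqintU g))).
Qed.

Lemma sum_ip_res2 (u g : L2 Om) :
  \sum_i ip (T i) (toL2 (T i) u) (toL2 (T i) g) = ipL2 u g.
Proof.
rewrite -sum_ip_res; apply: eq_bigr => i _.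
have q (v : L2 Om) := sqintS mOm (mT i) (@TOm i) (L2_sqint v).
apply: (ip_aeq (mT i)); [exact: (toL2P (q u))|exact: aeq_refl|exact: L2_measurable|].
exact: L2_measurable.
Qed.

Lemma sum_ipU_res2 (w g : L2mx k Om) :
  \sum_i ipU (T i) (L2mxrep (toL2mx (T i) (L2mxrep w)))
    (L2mxrep (toL2mx (T i) (L2mxrep g))) = ipL2mx w g.
Proof.
rewrite -sum_ipU_res; apply: eq_bigr => i _.
apply: (ipU_aeq (mT i)); [exact: (toL2mxP (@sqintU_res i w))|exact: aeW|exact: L2mx_sqintU|].
exact: L2mx_sqintU.
Qed.

Lemma relA_distr (v : L2 Om) (g : L2mx k Om) i : relA A T v g ->
  distrA A v (toL2mx (T i) (L2mxrep g)).
Proof.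
move=> /(relAP A Omfin TOm)[gU vg]; split.
  by apply: toL2mx_in; [exact: sqintU_res|move=> x; exact: L2U_rep].
move=> F tF; rewrite -vg//; apply: (ipU_aeq (mT i)).
- exact: toL2mxP (@sqintU_res i g).
- exact: aeW.
- exact: L2mx_sqintU.
- exact: (test_sqintU (mT i) (leb_family_fin Omfin TOm i) tF).
Qed.

Lemma relAs_distr (w : L2mx k Om) (g : L2 Om) i : relAs A T w g ->
  distrAs A (L2mxrep w) (toL2 (T i) g).
Proof.
move=> /(relAsP A Omfin TOm) wg f tf; rewrite -wg//.
have q := sqintS mOm (mT i) (@TOm i) (L2_sqint g).
apply: (ip_aeq (mT i)); [exact: (toL2P q)|exact: aeq_refl|exact: L2_measurable|].
exact: measurable_funS (test_measurable tf).
Qed.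

Lemma weakA_rel (v : L2 Om) (g : L2mx k Om) i : relA A T v g ->
  weakA A (T i) v = toL2mx (T i) (L2mxrep g).
Proof.
move=> vg; apply: weakA_eq; first exact: (leb_family_fin Omfin TOm i).
exact: relA_distr.
Qed.

Lemma weakAs_rel (w : L2mx k Om) (g : L2 Om) i : relAs A T w g ->
  weakAs A (T i) (L2mxrep w) = toL2 (T i) g.
Proof.
move=> vg; apply: weakAs_eq; first exact: (leb_family_fin Omfin TOm i).
exact: relAs_distr.
Qed.

Lemma aeq_res i (f g : lebT -> R) : aeq leb Om f g -> aeq leb (T i) f g.
Proof. by apply: aeqS; exact: TOm. Qed.

Lemma aeq_glue (g : 'I_N -> lebT -> R) i :
  aeq leb (T i) (fun x => \sum_j (g j \_ (T j)) x) (g i).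
Proof. by apply: aeW => x Tx; exact: sum_patch. Qed.

(** The elementwise derivatives are extended by zero and added; the sum is square integrable,
    U-valued, and equals the given derivative on each element. Conversely a global witness is
    restricted. *)
Lemma HAT_rel (v : L2 Om) : HAT A Om T v <-> exists g, relA A T v g.
Proof.
split=> [vg|[g vg] i]; last by exists (toL2mx (T i) (L2mxrep g)); exact: relA_distr.
pose g i : L2mx k (T i) := sval (cid (vg i)).
have vgi i : distrA A v (g i) := svalP (cid (vg i)).
pose F x : Umat := \sum_j (if x \in (T j : set Rd) then L2mxrep (g j) x else 0).
have FE a b : (fun x => F x a b) =
    fun x => \sum_j ((g j a b : lebT -> R) \_ (T j)) x.
  apply/funext => x; rewrite summxE; apply: eq_bigr => j _; rewrite patchE.
  by case: ifP => _; rewrite mxE.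
have qF : sqintU Om F.
  by move=> a b; rewrite FE; apply: (sqint_sum_patch TOm) => j; exact: L2_sqint.
have FU x : in_U k (F x).
  apply: in_U_sum => j; case: ifP => _; last exact: in_U0.
  by apply: L2U_rep; case: (vgi j).
have hF := toL2mxP qF.
exists (toL2mx Om F); apply/(relAP A Omfin TOm); split; first exact: toL2mx_in.
move=> i H tH; have [_ <-//] := vgi i; apply: (ipU_aeq (mT i)).
- apply: aeqU_entries => a b; have h1 := @aeq_res i _ _ (aeqU_entry a b hF).
  rewrite FE in h1; have h2 := aeq_trans h1 (aeq_glue (fun j => L2rep (g j a b)) i).
  by apply: filterS h2 => x e /e ->; rewrite mxE.
- exact: aeW.
- exact: sqintU_res.
- exact: (test_sqintU (mT i) (leb_family_fin Omfin TOm i) tH).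
Qed.

Lemma HAsT_rel (w : L2mx k Om) : HAsT A Om T w <-> L2U w /\ exists g, relAs A T w g.
Proof.
split=> [[wU wg]|[wU [g wg]]]; last first.
  by split=> // i; exists (toL2 (T i) g); exact: relAs_distr.
split=> //; pose g i : L2 (T i) := sval (cid (wg i)).
have wgi i : distrAs A (L2mxrep w) (g i) := svalP (cid (wg i)).
pose F x : R := \sum_j ((g j : lebT -> R) \_ (T j)) x.
have qF : sqint leb Om F by apply: (sqint_sum_patch TOm) => j; exact: L2_sqint.
exists (toL2 Om F); apply/(relAsP A Omfin TOm) => i f tf.
rewrite -wgi//; apply: (ip_aeq (mT i)).
- have h1 := @aeq_res i _ _ (toL2P qF).
  exact: (aeq_trans h1 (aeq_glue (fun j => L2rep (g j)) i)).
- exact: aeq_refl.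
- exact: sqint_measurable (sqintS mOm (mT i) (@TOm i) (L2_sqint _)).
- exact: measurable_funS (test_measurable tf).
Qed.

Lemma relA_mesh (v : L2 Om) (g : L2mx k Om) : distrA A v g -> relA A T v g.
Proof.
move=> /(relA_single Omfin)[gU h]; split=> // p [i [F [tF ->]]].
apply: h; exists ord0, F; split=> //; case: tF => FU tF; split=> // a b.
exact: test_subset (tF a b).
Qed.

Lemma relAs_mesh (w : L2mx k Om) (g : L2 Om) : distrAs A (L2mxrep w) g -> relAs A T w g.
Proof.
move=> /(relAs_single Omfin)[gU h]; split=> // p [i [f [tf ->]]].
by apply: h; exists ord0, f; split=> //; exact: test_subset tf.
Qed.

End Mesh.

Section TestFunctionsAsElements.
Variables (Om : opens R n) (Omfin : (leb Om < +oo)%E).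
Let mOm := measurable_opens Om.

Lemma test_distrAs (F : Rd -> Umat) : test_functionU Om F ->
  distrAs A (L2mxrep (toL2mx Om F)) (toL2 Om (opAs A F)).
Proof.
move=> tF; apply/(relAs_single Omfin)/(relAsP A Omfin (@single_sub Om)) => i f tf.
have sTOm i := @single_sub Om i.
have qF := test_sqintU mOm Omfin tF; have tAf := test_opA A tf.
rewrite -[LHS](ip_test Omfin sTOm _ tf) -(ipU_test Omfin sTOm _ tAf).
have tAF := test_opAs A tF.
rewrite -(ip_toL2 (test_sqint mOm Omfin tAF) (test_sqint mOm Omfin tf)).
rewrite -(ipU_toL2mx qF (test_sqintU mOm Omfin tAf)).
transitivity (ip Om f (opAs A F)).
  by apply: eq_Rintegral => x _; rewrite mulrC.
by rewrite -(opA_adjoint A tf tF); apply: eq_Rintegral => x _; rewrite frobC.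
Qed.

Lemma test_distrA (f : Rd -> R) : test_function Om f ->
  distrA A (toL2 Om f) (toL2mx Om (opA A f)).
Proof.
move=> tf; apply/(relA_single Omfin)/(relAP A Omfin (@single_sub Om)).
have sTOm i := @single_sub Om i.
have tAf := test_opA A tf; have qAf := test_sqintU mOm Omfin tAf.
split; first by apply: toL2mx_in => //; case: tAf.
move=> i F tF; have tAF := test_opAs A tF.
rewrite -[LHS](ipU_test Omfin sTOm _ tF) -(ip_test Omfin sTOm _ tAF).
rewrite -(ipU_toL2mx qAf (test_sqintU mOm Omfin tF)).
by rewrite -(ip_toL2 (test_sqint mOm Omfin tf) (test_sqint mOm Omfin tAF)) (opA_adjoint A tf tF).
Qed.

Lemma test_HAs (F : Rd -> Umat) : test_functionU Om F -> HAs A Om (toL2mx Om F).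
Proof.
move=> tF; split; last by exists (toL2 Om (opAs A F)); exact: test_distrAs.
by apply: toL2mx_in; [exact: test_sqintU tF|case: tF].
Qed.

(** The vanishing of the trace against w is the distributional definition of A^* w tested with [f],
    read backwards. *)
Lemma test_H0A (f : Rd -> R) : test_function Om f -> H0A A Om (toL2 Om f).
Proof.
move=> tf; have tA := test_distrA tf.
split; first by exists (toL2mx Om (opA A f)).
apply/funext => w; rewrite /gammaA_Gamma /functional_on patchE; case: ifPn => //.
rewrite inE => -[wU [g wg]]; rewrite (weakA_eq Omfin tA) (weakAs_eq Omfin wg).
have sTOm i := @single_sub Om i; have tAf := test_opA A tf.
have := wg f tf; rewrite -(ip_test (i := ord0) Omfin sTOm _ tf) -(ipU_test (i := ord0) Omfin sTOm _ tAf).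
rewrite (ip_sym (L2_semi_ip Om))// (ip_sym (L2mx_semi_ip k Om))// => E.
by apply/eqP; rewrite subr_eq0; apply/eqP; exact: esym E.
Qed.

End TestFunctionsAsElements.
End WeakOperatorTheory.

(** * Closed operators and inf-sup stability *)

Section EquivalentForms.
Context {R : realType} {E : lmodType R}.
Variables (S : set E) (B B' : E -> E -> R).
Hypotheses (hB : semi_ip S B) (hB' : semi_ip S B').

(** Dividing the sequence by [m] absorbs the equivalence constant, so its increments stay below
    2^{-n} in the other norm; the limit is scaled back. *)
Lemma fast_complete_equiv m M : 0 < m -> 0 < M ->
  (forall x, S x -> nrm B x <= m * nrm B' x) ->
  (forall x, S x -> nrm B' x <= M * nrm B x) ->
  fast_complete S B -> fast_complete S B'.
Proof.
move=> m0 M0 BB' B'B cB x Sx fx; have sS := ip_sub hB.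
have [||y [K [Sy yK]]] := cB (fun n => m^-1 *: x n).
- by move=> n; exact: subZ.
- move=> n; have Sd := subB sS (Sx n.+1) (Sx n).
  rewrite -scalerBr (nrmZ hB)// gtr0_norm ?invr_gt0// ler_pdivrMl//.
  by apply: le_trans (BB' _ Sd) _; rewrite ler_pM2l.
exists (m *: y), (m * (M * K)); split; first exact: subZ.
move=> n; have Sd : S (m^-1 *: x n - y) by apply: subB => //; exact: subZ.
have -> : x n - m *: y = m *: (m^-1 *: x n - y).
  by rewrite scalerBr scalerA mulfV ?gt_eqF// scale1r.
rewrite (nrmZ hB')// gtr0_norm// -!mulrA ler_pM2l//.
by apply: le_trans (B'B _ Sd) _; rewrite ler_pM2l.
Qed.

End EquivalentForms.

Section CoerciveOperator.
Context {R : realType} {G : lmodType R}.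
Variables (S : set G) (B : G -> G -> R) (hB : semi_ip S B) (cB : fast_complete S B).
Hypothesis (B_eq0 : forall w, S w -> B w w = 0 -> w = 0).
Variables (C : G -> G) (c0 c1 : R).
Hypotheses (c0_gt0 : 0 < c0) (CS : forall w, S w -> S (C w))
  (Clin : forall a w z, S w -> S z -> C (a *: w + z) = a *: C w + C z)
  (Csym : forall w z, S w -> S z -> B (C w) z = B w (C z))
  (Cbound : forall w, S w -> nrm B (C w) <= c1 * nrm B w)
  (Ccoer : forall w, S w -> c0 * B w w <= B (C w) w).

Lemma coercive_semi_ip : semi_ip S (fun w z => B (C w) z).
Proof.
split; first exact: ip_sub hB.
- by move=> a x y z Sx Sy Sz; rewrite Clin// (ip_lin hB)//; exact: CS.
- by move=> x y Sx Sy; rewrite Csym// (ip_sym hB)//; exact: CS.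
- by move=> x Sx; apply: le_trans (Ccoer Sx); rewrite mulr_ge0 ?(ip_ge0 hB)// ltW.
Qed.

Lemma coercive_le w : S w -> nrm B w <= (Num.sqrt c0)^-1 * nrm (fun x y => B (C x) y) w.
Proof.
move=> Sw; rewrite ler_pdivlMl ?sqrtr_gt0// -sqrtrM; last exact: ltW.
by rewrite ler_wsqrtr//; exact: Ccoer.
Qed.

Lemma bounded_le w : S w -> nrm (fun x y => B (C x) y) w <= Num.sqrt `|c1| * nrm B w.
Proof.
move=> Sw; have SCw := CS Sw.
rewrite -[nrm B w]ger0_norm ?nrm_ge0// -(sqrtr_sqr (nrm B w)) -sqrtrM// ler_wsqrtr//.
apply: le_trans (ler_norm _) _; apply: le_trans (cauchy_schwarz hB SCw Sw) _.
rewrite expr2 mulrA ler_wpM2r ?nrm_ge0//; apply: le_trans (Cbound Sw) _.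
by rewrite ler_wpM2r ?nrm_ge0// ler_norm.
Qed.

Lemma coercive_complete : fast_complete S (fun w z => B (C w) z).
Proof.
apply: (fast_complete_equiv hB coercive_semi_ip (m := (Num.sqrt c0)^-1)
    (M := Num.sqrt `|c1| + 1)) cB.
- by rewrite invr_gt0 sqrtr_gt0.
- by rewrite ltr_wpDl// sqrtr_ge0.
- exact: coercive_le.
- move=> x Sx; apply: le_trans (bounded_le Sx) _.
  by rewrite ler_wpM2r ?nrm_ge0// lerDl.
Qed.

(** Riesz's theorem for the complete form (C w, z) solves (C z, x) = (g, x) on [S], and definiteness
    of [B] upgrades this to C z = g. *)
Lemma coercive_inverse g : S g -> exists2 z, S z & C z = g.
Proof.
move=> Sg; have hC := coercive_semi_ip.
have [||z Sz zg] := riesz (l := B g) (M := nrm B g * (Num.sqrt c0)^-1) hC coercive_complete.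
- by move=> a x y Sx Sy; have Sax := subZ (ip_sub hB) a Sx; rewrite (ipDr hB)// (ipZr hB).
- move=> x Sx; apply: le_trans (cauchy_schwarz hB Sg Sx) _.
  by rewrite -mulrA ler_wpM2l ?nrm_ge0//; exact: coercive_le.
exists z => //; have sS := ip_sub hB; have SCz := CS Sz.
apply/eqP; rewrite -subr_eq0; apply/eqP; apply: B_eq0; first exact: subB.
by rewrite (ipBl hB) ?zg ?subrr//; exact: subB.
Qed.

End CoerciveOperator.

(** * Closed operators and completeness of their graph norms *)

Section ClosedOperator.
Context {R : realType} {X Y : lmodType R}.
Variables (BX : X -> X -> R) (BY : Y -> Y -> R).
Hypotheses (hX : semi_ip setT BX) (hY : semi_ip setT BY).
Variables (rel : X -> Y -> Prop).
Hypotheses (rel_lin : forall a x x' y y', rel x y -> rel x' y' ->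
    rel (a *: x + x') (a *: y + y'))
  (rel_uniq : forall x y y', rel x y -> rel x y' -> y = y').

Definition dom : set X := [set x | exists y, rel x y].
Definition op (x : X) : Y := xget 0 [set y | rel x y].

Lemma opP x : dom x -> rel x (op x).
Proof. by move=> h; exact: (xgetPex 0 h). Qed.

Lemma opE x y : rel x y -> op x = y.
Proof. by move=> xy; apply: (rel_uniq _ xy); apply: opP; exists y. Qed.

Lemma op_lin a x y : dom x -> dom y -> op (a *: x + y) = a *: op x + op y.
Proof. by move=> /opP xy /opP xy'; apply: opE; exact: rel_lin. Qed.

Definition graph_ip (x y : X) : R := BX x y + BY (op x) (op y).

Variables (S : set X) (sS : is_subspace S) (SD : S `<=` dom).

Lemma graph_semi_ip : semi_ip S graph_ip.
Proof.
split=> //.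
- move=> a x y z Sx Sy Sz; rewrite /graph_ip op_lin; try exact: SD.
  by rewrite (ip_lin hX)// (ip_lin hY)//; ring.
- by move=> x y Sx Sy; rewrite /graph_ip (ip_sym hX)// (ip_sym hY).
- by move=> x Sx; rewrite addr_ge0// ?(ip_ge0 hX)// (ip_ge0 hY).
Qed.

Lemma graph_nrm_ge x : nrm BX x <= nrm graph_ip x.
Proof. by rewrite ler_wsqrtr// lerDl (ip_ge0 hY). Qed.

Lemma graph_nrm_ge_op x : nrm BY (op x) <= nrm graph_ip x.
Proof. by rewrite ler_wsqrtr// lerDr (ip_ge0 hX). Qed.

Lemma graph_nrm_le x : nrm graph_ip x <= nrm BX x + nrm BY (op x).
Proof.
rewrite -[leRHS]ger0_norm ?addr_ge0 ?nrm_ge0// -sqrtr_sqr ler_wsqrtr//.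
rewrite sqrrD (nrm_sqr hX)// (nrm_sqr hY)// /graph_ip addrAC lerDl.
by rewrite mulrn_wge0// mulr_ge0 ?nrm_ge0.
Qed.

(** Arguments and values converge separately, closedness of the relation joins the two limits, and
    closedness of [S] in the graph norm puts the limit in [S]. *)
Lemma graph_complete : fast_complete setT BX -> fast_complete setT BY ->
  (forall (x : nat -> X) (y : nat -> Y) x0 y0 K K', (forall m, rel (x m) (y m)) ->
    (forall m, nrm BX (x m - x0) <= K * 2^-1 ^+ m) ->
    (forall m, nrm BY (y m - y0) <= K' * 2^-1 ^+ m) -> rel x0 y0) ->
  (forall x, dom x -> (forall e, 0 < e -> exists2 y, S y & nrm graph_ip (x - y) < e) -> S x) ->
  fast_complete S graph_ip.
Proof.
move=> cX cY rel_closed clS x Sx fx.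
have opB a b : dom a -> dom b -> op (a - b) = op a - op b.
  by move=> da db; rewrite addrC -scaleN1r op_lin// scaleN1r addrC.
have DS y : S y -> dom y by exact: SD.
have [||x0 [K [_ xx0]]] := cX x => // [m|].
  exact: le_trans (graph_nrm_ge _) (fx m).
have [||y0 [K' [_ yy0]]] := cY (op \o x) => // [m|] /=.
  by rewrite -opB; [exact: le_trans (graph_nrm_ge_op _) (fx m)|exact: DS|exact: DS].
have r0 : rel x0 y0.
  by apply: (rel_closed x (op \o x) x0 y0 K K') => // m; apply: opP; exact: DS.
have d0 : dom x0 by exists y0.
have dist m : nrm graph_ip (x m - x0) <= (K + K') * 2^-1 ^+ m.
  apply: le_trans (graph_nrm_le _) _; rewrite mulrDl lerD// opB//; last exact: DS.
  by rewrite (opE r0); exact: yy0.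
exists x0, (K + K'); split=> //; apply: clS => // e e0.
have [m me] : exists m, (K + K') * 2^-1 ^+ m < e.
  apply: contrapT => /forallNP h; have : e <= 0.
    apply: (@le0_of_geometric _ _ (K + K')) => m.
    by have /negP := h m; rewrite -leNgt.
  by rewrite leNgt e0.
exists (x m) => //; apply: le_lt_trans me; apply: le_trans (dist m).
(* [x0] is not yet known to lie in [S], so the symmetry of the norm is checked on the two components
   of the graph rather than through [graph_semi_ip]. *)
have -> : x0 - x m = - (x m - x0) by rewrite opprB.
rewrite /nrm /graph_ip -scaleN1r -[_ *: (x m - x0)]addr0.
have d1 : dom (x m - x0).
  by rewrite addrC -scaleN1r; exists (-1 *: y0 + op (x m)); apply: rel_lin => //; apply: opP; exact: DS.
have -> : -1 *: (x m - x0) + 0 = x0 - x m by rewrite addr0 scaleN1r opprB.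
have -> : op (x0 - x m) = - op (x m - x0) by rewrite !opB ?opprB//; exact: DS.
by rewrite -[x0 - x m]opprB !(ipNl hX, ipNr hX, ipNl hY, ipNr hY)// !opprK.
Qed.

End ClosedOperator.

Section Inequalities.
Context {R : realType}.

Lemma sqr_lin_le (a b c e : R) :
  (a * b + c * e) ^+ 2 <= (c ^+ 2 + a ^+ 2) * (b ^+ 2 + e ^+ 2).
Proof. have := sqr_ge0 (a * e - c * b); nra. Qed.

Context {E : lmodType R} {S : set E} {B : E -> E -> R} (hB : semi_ip S B).

Lemma ip_young x y : S x -> S y -> 2 * B x y <= B x x + B y y.
Proof.
move=> Sx Sy; have Sxy := subB (ip_sub hB) Sx Sy; have := ip_ge0 hB Sxy.
have SNy := subN (ip_sub hB) Sy.
rewrite (ip_sqD hB)// !(ipNr hB)// (ipNl hB)//; lra.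
Qed.

Lemma ip_youngN x y : S x -> S y -> - (2 * B x y) <= B x x + B y y.
Proof.
by move=> Sx Sy; have := ip_ge0 hB (subD (ip_sub hB) Sx Sy); rewrite (ip_sqD hB)//; lra.
Qed.

Lemma ip_lin_sq a b x y : S x -> S y ->
  B (a *: x + b *: y) (a *: x + b *: y) <= 2 * a ^+ 2 * B x x + 2 * b ^+ 2 * B y y.
Proof.
move=> Sx Sy; have Sax := subZ (ip_sub hB) a Sx; have Sby := subZ (ip_sub hB) b Sy.
rewrite (ip_sqD hB)//; have := ip_young Sax Sby.
rewrite (ipZl hB a Sx Sax) (ipZr hB a Sx Sx) (ipZl hB b Sy Sby) (ipZr hB b Sy Sy).
move: (B x x) (B y y) (B _ _) => X Y Z; lra.
Qed.

Lemma lin_comb (F : lmodType R) (f : E -> F) a b x y : is_subspace S ->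
  (forall a x y, S x -> S y -> f (a *: x + y) = a *: f x + f y) -> S x -> S y ->
  f (a *: x + b *: y) = a *: f x + b *: f y.
Proof.
move=> sS fl Sx Sy; have S0 := sub0 sS.
have f0 : f 0 = 0.
  apply: (addIr (f 0)); have := fl 1 0 0 S0 S0; rewrite !scale1r => <-.
  by rewrite addr0 add0r.
rewrite fl//; last exact: subZ.
by rewrite -{1}[b *: y]addr0 fl// f0 addr0.
Qed.
End Inequalities.

(** The bound of a trace pairing: with a = A v, b = w, c = v and d = A^* w, the factors on the right
    are the graph norms of v and w. *)
Lemma cauchy_schwarz_pair (R : realType) (E G : lmodType R) (BE : E -> E -> R)
    (BG : G -> G -> R) (a b : G) (c d : E) : semi_ip setT BE -> semi_ip setT BG ->
  `|BG a b - BE c d| <= Num.sqrt (BE c c + BG a a) * Num.sqrt (BG b b + BE d d).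
Proof.
move=> hE hG; rewrite -sqrtrM ?addr_ge0 ?(ip_ge0 hE) ?(ip_ge0 hG)//.
rewrite -sqrtr_sqr ler_wsqrtr//.
have h1 := cauchy_schwarz hG (x := a) (y := b) I I.
have h2 := cauchy_schwarz hE (x := c) (y := d) I I.
rewrite -!(nrm_sqr hG)// -!(nrm_sqr hE)//.
apply: le_trans (sqr_lin_le _ _ _ _).
rewrite -[leLHS]real_normK ?num_real// ler_sqr ?nnegrE ?addr_ge0 ?mulr_ge0 ?nrm_ge0//.
by apply: le_trans (ler_normB _ _) _; exact: lerD.
Qed.

(** * Inf-sup stability for an abstract pair of adjoint operators *)

Section InfSup.
Context {R : realType} {E G : lmodType R}.
Variables (BE : E -> E -> R) (BG : G -> G -> R).
Hypotheses (hE : semi_ip setT BE) (hG : semi_ip setT BG).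
Variables (GU : set G) (sGU : is_subspace GU).
Variables (A AT : E -> G) (As AsT : G -> E).
Variables (DA H0 HtA : set E) (DAs HtAs : set G).
Hypotheses (sH0 : is_subspace H0) (sHtA : is_subspace HtA) (sHtAs : is_subspace HtAs).
Hypotheses (HtAsU : HtAs `<=` GU) (DAsHtAs : DAs `<=` HtAs) (H0HtA : H0 `<=` HtA).
Hypotheses (Alin : forall a x y, H0 x -> H0 y -> A (a *: x + y) = a *: A x + A y)
  (AU : forall x, H0 x -> GU (A x)) (ATU : forall x, HtA x -> GU (AT x))
  (ATlin : forall a x y, HtA x -> HtA y -> AT (a *: x + y) = a *: AT x + AT y)
  (AsTlin : forall a x y, HtAs x -> HtAs y -> AsT (a *: x + y) = a *: AsT x + AsT y)
  (ATE : forall x, H0 x -> AT x = A x) (AsTE : forall x, DAs x -> AsT x = As x).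
Let gA x y := BE x y + BG (A x) (A y).
Let gAT x y := BE x y + BG (AT x) (AT y).
Let gAsT x y := BG x y + BE (AsT x) (AsT y).
Hypotheses (hAT : semi_ip HtA gAT) (hAsT : semi_ip HtAs gAsT) (hA : semi_ip H0 gA).
Hypotheses (cA : fast_complete H0 gA) (cAT : fast_complete HtA gAT)
  (cAsT : fast_complete HtAs gAsT).
Hypotheses (adjoint : forall v w, H0 v -> DAs w -> BG (A v) w = BE v (As w))
  (maximalA : forall v g, GU g -> (forall w, DAs w -> BG g w = BE v (As w)) ->
     DA v /\ A v = g)
  (maximalAs : forall w g, GU w -> (forall v, H0 v -> BE g v = BG w (A v)) ->
     DAs w /\ As w = g).
Variables (C K : G -> G) (CPF c0 c1 : R).
Hypotheses (CPF_gt0 : 0 < CPF) (c0_gt0 : 0 < c0) (c1_gt0 : 0 < c1).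
Hypotheses (poincare : forall v, H0 v -> nrm BE v <= CPF * nrm BG (A v)).
Hypotheses (CU : forall w, GU w -> GU (C w))
  (Clin : forall a w z, GU w -> GU z -> C (a *: w + z) = a *: C w + C z)
  (Csym : forall w z, GU w -> GU z -> BG (C w) z = BG w (C z))
  (Cbound : forall w, GU w -> nrm BG (C w) <= c1 * nrm BG w)
  (Ccoer : forall w, GU w -> c0 * BG w w <= BG (C w) w)
  (KU : forall w, GU w -> GU (K w)) (CK : forall w, GU w -> C (K w) = w).

(** For the solution of [solve_field], c0 |A du| <= CPF |u| + c1 |w|; squaring with Cauchy-Schwarz
    in R^2 gives |A du|^2 <= q (|u|^2 + |w|^2). *)
Let q := (CPF ^+ 2 + c1 ^+ 2) / c0 ^+ 2.
Let t := 2 + c0 ^- 2.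
(** The bracket is the bound of [solve_field] on the squared norm of the field pair. The outer
    factors come from |t x - 2 y|^2 <= 2 t^2 |x|^2 + 8 |y|^2. *)
Definition infsup_const : R :=
  2 * t ^+ 2 * ((CPF ^+ 2 + 1) * q + 2 * c1 ^+ 2 * (q + 1) + 1) + 8.

Lemma infsup_const_ge0 : 0 <= infsup_const.
Proof.
have q0 : 0 <= q by rewrite mulr_ge0 ?addr_ge0 ?invr_ge0 ?sqr_ge0.
rewrite /infsup_const addr_ge0// mulr_ge0//; first by rewrite mulr_ge0 ?sqr_ge0.
have := sqr_ge0 CPF; have := sqr_ge0 c1; move: (CPF ^+ 2) (c1 ^+ 2) => C2 d2 C20 d20.
have := mulr_ge0 C20 q0; have := mulr_ge0 d20 q0; move: q0; move: q => Q; lra.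
Qed.

(* Riesz's theorem on [H0] with the form [(C A v, A v')], an inner product by [poincare] *)
Lemma solve_field u w : GU w -> exists du dw,
  [/\ H0 du, DAs dw, As dw = - u, dw = C (A du + w) &
      gA du du + (BG dw dw + BE (As dw) (As dw)) <=
      ((CPF ^+ 2 + 1) * q + 2 * c1 ^+ 2 * (q + 1) + 1) * (BE u u + BG w w)].
Proof.
move=> Uw; have UCw := CU Uw.
pose B v v' := BG (C (A v)) (A v').
have ABlin a x y z : H0 x -> H0 y -> H0 z -> B (a *: x + y) z = a * B x z + B y z.
  by move=> x0 y0 z0; rewrite /B Alin// Clin ?(ip_lin hG)//; exact: AU.
have hB : semi_ip H0 B.
  split=> //.
  - move=> x y x0 y0; rewrite /B Csym; [|exact: AU|exact: AU].
    by rewrite (ip_sym hG).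
  - move=> x x0; apply: le_trans (Ccoer (AU x0)).
    by rewrite mulr_ge0 ?(ip_ge0 hG)// ltW.
have cB : fast_complete H0 B.
  have s0 : 0 < Num.sqrt c0 by rewrite sqrtr_gt0.
  have AleB v : H0 v -> nrm BG (A v) <= (Num.sqrt c0)^-1 * nrm B v.
    move=> v0; rewrite ler_pdivlMl// -sqrtrM; last exact: ltW.
    by rewrite ler_wsqrtr//; exact: Ccoer (AU v0).
  have gle v : nrm gA v <= nrm BE v + nrm BG (A v).
    rewrite -[leRHS]ger0_norm ?addr_ge0 ?nrm_ge0// -sqrtr_sqr ler_wsqrtr//.
    rewrite sqrrD (nrm_sqr hE)// (nrm_sqr hG)// /gA addrAC lerDl.
    by rewrite mulrn_wge0// mulr_ge0 ?nrm_ge0.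
  (* Poincare's inequality gives |v|_A <= (CPF + 1) |A v|, and coercivity bounds |A v| by c0^{-1/2}
     times the norm of [B]. *)
  apply: (fast_complete_equiv hA hB (m := (CPF + 1) * (Num.sqrt c0)^-1)
      (M := Num.sqrt c1)) cA.
  - by rewrite mulr_gt0 ?invr_gt0// addr_gt0.
  - by rewrite sqrtr_gt0.
  - move=> v v0; apply: le_trans (gle v) _; rewrite -mulrA.
    apply: (@le_trans _ _ ((CPF + 1) * nrm BG (A v))).
      by rewrite mulrDl mul1r lerD2r; exact: poincare.
    by rewrite ler_wpM2l ?AleB// addr_ge0// ltW.
  - move=> v v0; rewrite -sqrtrM; last exact: ltW.
    have UA := AU v0; have UCA := CU UA.
    rewrite ler_wsqrtr//; apply: le_trans (ler_norm _) _.
    apply: le_trans (cauchy_schwarz hG _ _) _ => //.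
    apply: (@le_trans _ _ (c1 * (nrm BG (A v) * nrm BG (A v)))).
      by rewrite mulrA ler_wpM2r ?nrm_ge0//; exact: Cbound.
    rewrite ler_pM2l// -expr2 (nrm_sqr hG)// lerDr.
    by rewrite (ip_ge0 hE).
(* Chosen so that the Riesz identity reads (C (A du + w), A v) = - (u, v) on [H0], which by
   maximality says that C (A du + w) lies in [DAs] and has adjoint derivative - u. *)
pose l v := - BE u v - BG (C w) (A v).
have [||du du0 duE] := riesz (l := l) (M := (nrm BE u * CPF + nrm BG (C w)) / Num.sqrt c0) hB cB.
- move=> a x y x0 y0; rewrite /l Alin// (ipDr hE)// (ipZr hE)// (ipDr hG)// (ipZr hG)//.
  ring.
- move=> v v0; rewrite /l; apply: le_trans (ler_normB _ _) _; rewrite normrN.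
  apply: (@le_trans _ _ ((nrm BE u * CPF + nrm BG (C w)) * nrm BG (A v))).
    rewrite mulrDl lerD// ?(cauchy_schwarz hG)// -mulrA.
    apply: le_trans (cauchy_schwarz hE _ _) _ => //.
    by rewrite ler_wpM2l ?nrm_ge0//; exact: poincare.
  rewrite -mulrA ler_wpM2l//.
    by rewrite addr_ge0 ?mulr_ge0 ?nrm_ge0// ltW.
  rewrite ler_pdivlMl ?sqrtr_gt0// -sqrtrM; last exact: ltW.
  by rewrite ler_wsqrtr//; exact: Ccoer (AU v0).
have UAdu := AU du0.
have US : GU (A du + w) by exact: subD.
have [dws dwE] : DAs (C (A du + w)) /\ As (C (A du + w)) = - u.
  apply: maximalAs; first exact: CU.
  move=> v v0; rewrite -{1}[A du]scale1r Clin// scale1r (ipDl hG)//.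
  by have := duE v v0; rewrite /B /l => ->; rewrite subrK (ipNl hE).
exists du, (C (A du + w)); split=> //; rewrite dwE.
(* The equation is tested with [du] itself, |du| is bounded by CPF |A du|, and one factor |A du| is
   cancelled. *)
have hp : c0 * nrm BG (A du) <= CPF * nrm BE u + c1 * nrm BG w.
  have := duE du du0; rewrite /B /l => E1.
  have h1 := Ccoer UAdu; rewrite E1 -(nrm_sqr hG)// in h1.
  have h2 := le_trans (ler_norm _) (cauchy_schwarz hE (x := - u) (y := du) I I).
  have h3 := le_trans (ler_norm _) (cauchy_schwarz hG (x := - C w) (y := A du) I I).
  rewrite (ipNl hE)// (nrmN hE)// in h2; rewrite (ipNl hG)// (nrmN hG)// in h3.
  have h4 := ler_wpM2l (nrm_ge0 (B := BE) u) (poincare du0).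
  have h5 := ler_wpM2r (nrm_ge0 (B := BG) (A du)) (Cbound Uw).
  have := nrm_ge0 (B := BG) (A du); rewrite le_eqVlt => /predU1P[<-|p0].
    by rewrite mulr0 addr_ge0// mulr_ge0 ?nrm_ge0// ltW.
  rewrite -(ler_pM2r p0); move: h1 h2 h3 h4 h5.
  move: (BE _ _) (BG _ _) (nrm BG (C w) * _) (nrm BE du) => X1 X2 X3 X4.
  move: (nrm BG (A du)) (nrm BE u) (nrm BG w) => X5 X6 X7 h1 h2 h3 h4 h5.
  nra.
have hd := poincare du0.
have hC := Cbound US; have hD := nrmD hG (x := A du) (y := w) I I.
rewrite /gA (ipNl hE)// (ipNr hE)// opprK.
rewrite -!(nrm_sqr hG)// -!(nrm_sqr hE)//.
move: (nrm_ge0 (B := BE) du) (nrm_ge0 (B := BG) (A du)) (nrm_ge0 (B := BG) (C (A du + w)))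
  (nrm_ge0 (B := BE) u) (nrm_ge0 (B := BG) w) (nrm_ge0 (B := BG) (A du + w)) hp hd hC hD.
move: (nrm BE du) (nrm BG (A du)) (nrm BG (C (A du + w))) (nrm BE u) (nrm BG w)
  (nrm BG (A du + w)) => d p z a b s d0 p0 z0 a0 b0 s0 hp hd hC hD.
have hq : p ^+ 2 <= q * (a ^+ 2 + b ^+ 2).
  rewrite /q mulrAC ler_pdivlMr ?exprn_gt0// -exprMn mulrC.
  apply: (@le_trans _ _ ((CPF * a + c1 * b) ^+ 2)).
    by rewrite ler_sqr ?nnegrE ?addr_ge0 ?mulr_ge0// ltW.
  by rewrite [leRHS]mulrC [CPF ^+ 2 + _]addrC mulrC; exact: sqr_lin_le.
have hd2 : d ^+ 2 <= CPF ^+ 2 * p ^+ 2.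
  by rewrite -exprMn ler_sqr ?nnegrE ?mulr_ge0// ltW.
have hz2 : z ^+ 2 <= c1 ^+ 2 * (2 * p ^+ 2 + 2 * b ^+ 2).
  apply: (@le_trans _ _ (c1 ^+ 2 * (p + b) ^+ 2)).
    rewrite -exprMn ler_sqr ?nnegrE ?mulr_ge0 ?addr_ge0//; [|exact: ltW..].
    by apply: le_trans hC _; rewrite ler_pM2l.
  rewrite ler_wpM2l ?sqr_ge0//; exact: sqrrD_le.
have Q1 : CPF ^+ 2 * p ^+ 2 <= CPF ^+ 2 * (q * (a ^+ 2 + b ^+ 2)).
  by rewrite ler_wpM2l ?sqr_ge0.
have Q2 : c1 ^+ 2 * (2 * p ^+ 2 + 2 * b ^+ 2) <=
    c1 ^+ 2 * (2 * (q * (a ^+ 2 + b ^+ 2)) + 2 * (a ^+ 2 + b ^+ 2)).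
  by rewrite ler_wpM2l ?sqr_ge0// lerD// ler_pM2l// lerDr sqr_ge0.
have := sqr_ge0 b; move: hd2 hz2 Q1 Q2 hq.
move: (d ^+ 2) (p ^+ 2) (z ^+ 2) (a ^+ 2) (b ^+ 2) (CPF ^+ 2) (c1 ^+ 2) q => *.
lra.
Qed.

Variables (v' : E) (w' : G) (H0v : H0 v') (DAsw : DAs w').
Let phi d := BG (A v') d - BE v' (AsT d).
Let psi d := BE (As w') d - BG w' (AT d).

Lemma solve_traceA : exists dw v1, [/\ HtAs dw, DA v1,
  forall d, HtAs d -> BG (A v1) d - BE v1 (AsT d) = phi d,
  phi dw = gAsT dw dw & BE v1 v1 + BG (A v1) (A v1) = gAsT dw dw].
Proof.
have [||dw Sdw dwE] := riesz (l := phi) (M := nrm gA v') hAsT cAsT.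
- move=> a x y Sx Sy; rewrite /phi AsTlin// (ipDr hG)// (ipZr hG)// (ipDr hE)// (ipZr hE)//.
  ring.
- by move=> d _; exact: cauchy_schwarz_pair.
(* [phi] vanishes on [DAs] because v' lies in [H0], so there the Riesz identity reads (dw, w) = (-
   AsT dw, As w), which is the maximality condition for v1 = - AsT dw. On all of [HtAs] the same
   identity says that v1 has the trace of v'. *)
have [||D1 A1] := maximalA (v := - AsT dw) (g := dw); first exact: HtAsU.
  move=> w Dw; have Sw := DAsHtAs Dw; have := dwE w Sw; rewrite /phi /gAsT (AsTE Dw).
  by rewrite (adjoint H0v Dw) subrr => /eqP; rewrite addr_eq0 (ipNl hE)// => /eqP.
exists dw, (- AsT dw); split=> //.
- by move=> d Sd; rewrite A1 -dwE// /gAsT (ipNl hE)// opprK.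
- by rewrite -dwE.
- by rewrite A1 (ipNl hE)// (ipNr hE)// opprK addrC.
Qed.

Lemma solve_traceAs : exists du w1, [/\ HtA du, DAs w1,
  forall d, HtA d -> BE (As w1) d - BG w1 (AT d) = psi d,
  psi du = gAT du du & BG w1 w1 + BE (As w1) (As w1) = gAT du du].
Proof.
have [||du Sdu duE] := riesz (l := psi) (M := Num.sqrt (BG w' w' + BE (As w') (As w'))) hAT cAT.
- move=> a x y Sx Sy; rewrite /psi ATlin// (ipDr hG)// (ipZr hG)// (ipDr hE)// (ipZr hE)//.
  ring.
- by move=> d _; rewrite /psi; exact: cauchy_schwarz_pair.
have UAT := ATU Sdu.
(* [psi] vanishes on [H0], and maximality of [As] is tested on [H0] alone; this gives w1 = - AT du
   in [DAs] with derivative [du]. *)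
have [||D1 A1] := maximalAs (w := - AT du) (g := du); first exact: subN.
  move=> v v0; have Sv := H0HtA v0; have := duE v Sv; rewrite /psi /gAT (ATE v0).
  rewrite (ip_sym hE (x := As w'))// (ip_sym hG (x := w'))// (adjoint v0 DAsw) subrr => /eqP.
  by rewrite addr_eq0 (ipNl hG)// => /eqP.
exists du, (- AT du); split=> //.
- by move=> d Sd; rewrite A1 -duE// /gAT (ipNl hG)// opprK.
- by rewrite -duE.
- by rewrite A1 (ipNl hG)// (ipNr hG)// opprK addrC.
Qed.

(** The sum [s] measures the traces by the extensions v1 and w1 instead of by infima. It therefore
    dominates the squared trial norm, and its trace part equals the squared norms of the two trace
    test functions. *)
Theorem infsup_abstract u w : GU w -> exists du dw v1 w1,
  [/\ [/\ HtA du, HtAs dw, DA v1 & DAs w1],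
   forall d, HtAs d -> BG (A v1) d - BE v1 (AsT d) = phi d,
   forall d, HtA d -> BE (As w1) d - BG w1 (AT d) = psi d &
   let s := BE u u + BG w w + (BE v1 v1 + BG (A v1) (A v1)) +
     (BG w1 w1 + BE (As w1) (As w1)) in
   s <= BG (K w) dw - BE u (AsT dw) - phi dw - BG w (AT du) - psi du /\
   gAT du du + gAsT dw dw <= infsup_const * s].
Proof.
move=> Uw; have [du0 [dw0 [du00 Dw0 Asw0 dw0E n0]]] := solve_field u Uw.
have [dw1 [v1 [Sdw1 Dv1 v1E phi1 nv1]]] := solve_traceA.
have [du1 [w1 [Sdu1 Dw1 w1E psi1 nw1]]] := solve_traceAs.
have Sdu0 := H0HtA du00; have Sdw0 := DAsHtAs Dw0.
exists (t *: du0 + (-2) *: du1), (t *: dw0 + (-2) *: dw1), v1, w1.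
have SN2 := subZ sHtA (-2) Sdu1; have SM2 := subZ sHtAs (-2) Sdw1.
have St0 := subZ sHtA t Sdu0; have Stw0 := subZ sHtAs t Sdw0.
have Gw0 := HtAsU Sdw0; have Kw := KU Uw.
split; [split=> //; [exact: subD|exact: subD]|exact: v1E|exact: w1E|cbv zeta].
rewrite nv1 nw1 /phi /psi.
rewrite (lin_comb _ _ sHtAs AsTlin)// (lin_comb _ _ sHtA ATlin)// (AsTE Dw0) (ATE du00) Asw0.
have hsq := lerD (ip_lin_sq hAT t (-2) Sdu0 Sdu1) (ip_lin_sq hAsT t (-2) Sdw0 Sdw1).
have p0 : BG (A v') dw0 = - BE v' u by rewrite adjoint// Asw0 (ipNr hE).
have p1 : BE (As w') du0 = BG w' (A du0).
  by rewrite (ip_sym hE)// (ip_sym hG (x := w'))// adjoint.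
have p2 : BG (K w) dw0 = BG w (A du0) + BG w w.
  have UAdu := AU du00; rewrite dw0E -Csym// ?CK ?(ipDr hG)//; exact: subD.
have lE x a b (y z : E) : BE x (a *: y + b *: z) = a * BE x y + b * BE x z.
  by rewrite (ipDr hE)// !(ipZr hE).
have lG x a b (y z : G) : BG x (a *: y + b *: z) = a * BG x y + b * BG x z.
  by rewrite (ipDr hG)// !(ipZr hG).
(* [y1], [y2] and [y3] are the three cross terms between the fields and the trace test functions,
   which carry the factor 2 of the combination. *)
have y1 := ip_young hG (x := K w) (y := dw1) I I.
have y2 := ip_youngN hE (x := u) (y := AsT dw1) I I.
have y3 := ip_youngN hG (x := w) (y := AT du1) I I.
have y4 := ip_young hG (x := c0 *: K w) (y := w) I I.
have y5 := Ccoer Kw; rewrite CK// in y5.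
rewrite !lE !lG !(ipNr hE)// p0 p1 p2.
rewrite !(ipZl hG)// (ipZr hG)// (ip_sym hG (x := K w))// in y4.
(* Coercivity at K w gives c0 |K w|^2 <= (w, K w); multiplied by 2 c0 and combined with Young's
   inequality this leaves c0^2 |K w|^2 <= |w|^2. *)
have X1le : BG (K w) (K w) <= c0 ^- 2 * BG w w.
  rewrite ler_pdivlMl ?exprn_gt0//; have := ler_wpM2l (ltW c0_gt0) y5.
  by move: y4; move: (BG w w) (BG w (K w)) (BG (K w) (K w)) => *; lra.
have q0 : 0 <= q by rewrite mulr_ge0 ?addr_ge0 ?invr_ge0 ?sqr_ge0.
have r0 : 0 <= c0 ^- 2 by rewrite invr_ge0 sqr_ge0.
have a0 := mulr_ge0 r0 (ip_ge0 hE (x := u) I).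
have g0 := ip_ge0 hAT Sdu1; have g1 := ip_ge0 hAsT Sdw1.
split; last first.
  have n1 : gAT du0 du0 + gAsT dw0 dw0 <=
      ((CPF ^+ 2 + 1) * q + 2 * c1 ^+ 2 * (q + 1) + 1) * (BE u u + BG w w).
    by apply: le_trans n0; rewrite /gAT /gAsT (ATE du00) (AsTE Dw0).
  have M0 : 0 <= (CPF ^+ 2 + 1) * q + 2 * c1 ^+ 2 * (q + 1) + 1.
    have := sqr_ge0 CPF; have := sqr_ge0 c1; move: (CPF ^+ 2) (c1 ^+ 2) => C2 d2 C20 d20.
    have := mulr_ge0 C20 q0; have := mulr_ge0 d20 q0; move: q0; move: q => Q; lra.
  have t0 : 0 <= 2 * t ^+ 2 by rewrite mulr_ge0 ?sqr_ge0.
  have n2 := ler_wpM2l t0 n1.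
  have M1 := mulr_ge0 (mulr_ge0 t0 M0) (addr_ge0 g0 g1).
  have s0 := addr_ge0 (ip_ge0 hE (x := u) I) (ip_ge0 hG (x := w) I).
  move: hsq n2 M1 s0; rewrite /infsup_const.
  move: (2 * t ^+ 2) ((CPF ^+ 2 + 1) * q + 2 * c1 ^+ 2 * (q + 1) + 1) (gAT du1 du1)
    (gAsT dw1 dw1) (gAT du0 du0) (gAsT dw0 dw0) (BE u u) (BG w w).
  move: (gAT _ _) (gAsT _ _) => X Y Z1 Z2 Z3 Z4 Z5 Z6 Z7 Z8; rewrite sqrrN => *; lra.
have d0 := ip_ge0 hE (x := du1) I.
move: phi1 psi1 y1 y2 y3 X1le a0 d0; rewrite /phi /psi /t /gAT /gAsT.
move: (c0 ^- 2) => r; move: (BG w (A du0)) (BE v' u).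
move: (BG (A v') dw1) (BE v' (AsT dw1)) (BG dw1 dw1) (BE (AsT dw1) (AsT dw1)).
move: (BE du1 du1) (BG (AT du1) (AT du1)) (BE u u) (BG w w) (BE u (AsT dw1)).
move: (BG w (AT du1)) (BG (K w) dw1) (BG (K w) (K w)) (BE (As w') du1) (BG w' (AT du1)) (BG w' (A du0)).
by move=> *; lra.
Qed.

End InfSup.

(** * The tensor field *)

Lemma sqint_ae_le d (T : measurableType d) (R : realType) (mu : {measure set T -> \bar R})
    (D : set T) (f h : T -> R) : measurable D -> measurable_fun D f ->
  mu.-integrable D (EFin \o h) -> {ae mu, forall x, D x -> f x ^+ 2 <= h x} ->
  sqint mu D f.
Proof.
move=> mD mf /integrableP[mh ih] fh; split=> //; apply: le_lt_trans ih.
apply: ae_ge0_le_integral => //.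
- by move=> x _; rewrite lee_fin sqr_ge0.
- by apply/measurable_EFinP; exact: measurable_funX.
- exact: measurableT_comp.
- by apply: filterS fh => x fx Dx; rewrite /= lee_fin; apply: le_trans (ler_norm _); exact: fx.
Qed.

Lemma ae_le_Rintegral d (T : measurableType d) (R : realType) (mu : {measure set T -> \bar R})
    (D : set T) (f g : T -> R) : measurable D -> mu.-integrable D (EFin \o f) ->
  mu.-integrable D (EFin \o g) -> {ae mu, forall x, D x -> f x <= g x} ->
  \int[mu]_(x in D) f x <= \int[mu]_(x in D) g x.
Proof.
move=> mD jf jg fg; rewrite -subr_ge0 -RintegralB//.
have mh : measurable_fun D (fun x => g x - f x).
  by apply: measurable_funB; apply/measurable_EFinP; [case/integrableP: jg|case/integrableP: jf].
rewrite (_ : \int[mu]_(x in D) (g x - f x) = \int[mu]_(x in D) `|g x - f x|).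
  exact: Rintegral_ge0.
rewrite /Rintegral; congr fine; apply: ae_eq_integral => //.
- exact/measurable_EFinP.
- by apply/measurable_EFinP; exact: measurableT_comp.
- by apply: filterS fg => x h Dx; rewrite ger0_norm// subr_ge0 h.
Qed.

Section TensorOperator.
Context {R : realType} {n : nat} {k : Ukind}.
Local Notation Rd := 'rV[R]_n.+1.
Local Notation lebT := (@lebT R n).
Local Notation leb := (@leb R n).
Local Notation Umat := (Umat R n k).
Variables (Om : opens R n) (Omfin : (leb Om < +oo)%E).
Variables (C : Rd -> Umat -> Umat) (hC : spd_tensor_field Om C).

Let mOm := measurable_opens Om.
Let basisU i j : Umat := projU (delta_mx i j).

(* the entries of [C x] on [U], extended to all matrices through the projection *)
Let coefC a b i j (x : Rd) : R := frob (C x (basisU i j)) (basisU a b).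
Let fieldC (w : Rd -> Umat) (x : Rd) : Umat :=
  \matrix_(a, b) \sum_i \sum_j w x i j * coefC a b i j x.

Lemma measurable_coefC a b i j : measurable_fun (Om : set lebT) (coefC a b i j : lebT -> R).
Proof. by case: hC => mC _ _ _ _; apply: mC; exact: projU_in. Qed.

Lemma ae_linC : {ae leb, forall x : lebT, (Om : set lebT) x ->
  [/\ forall M : Umat, in_U k M -> in_U k (C x M),
      forall (a : R) (M N : Umat), in_U k M -> in_U k N -> C x (a *: M + N) = a *: C x M + C x N &
      forall M N : Umat, in_U k M -> in_U k N -> frob (C x M) N = frob M (C x N)]}.
Proof.
case: hC => _ aeL aeS _ _; apply: filterS2 aeL aeS => x h1 h2 Ox.
by have [? ?] := h1 Ox; split=> //; exact: h2.
Qed.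

Lemma delta_sum (M : Umat) : in_U k M -> M = \sum_i \sum_j M i j *: basisU i j.
Proof.
move=> MU; rewrite -{1}(projU_id MU) {1}[M]matrix_sum_delta.
have pE (I : Type) (r : seq I) (F : I -> Umat) : projU (\sum_(i <- r) F i) = \sum_(i <- r) projU (F i).
  elim: r => [|i r IH]; rewrite ?big_nil ?big_cons ?projUD ?IH//.
  by rewrite -[0 : Umat](scale0r 0) projUZ !scale0r.
by rewrite pE; apply: eq_bigr => i _; rewrite pE; apply: eq_bigr => j _; rewrite projUZ.
Qed.

(** Measurability is given only for x |-> (C x M) : N with M and N fixed. Expanding a field in the
    projected matrix units makes [C] applied to it a finite sum of products of measurable functions,
    equal to the pointwise application off one null set. *)
Lemma ae_fieldC : {ae leb, forall x : lebT, (Om : set lebT) x -> forall w : Rd -> Umat,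
  in_U k (w x) -> fieldC w x = C x (w x)}.
Proof.
apply: filterS ae_linC => x h Ox w wU; have [CU Cl _] := h Ox.
have C0 : C x 0 = 0.
  have := Cl 1 0 0 (in_U0 _) (in_U0 _); rewrite !scale1r addr0 => E.
  by apply: (addIr (C x 0)); rewrite add0r.
have Csum (I : Type) (r : seq I) (F : I -> Umat) : (forall i, in_U k (F i)) ->
    C x (\sum_(i <- r) F i) = \sum_(i <- r) C x (F i).
  move=> FU; elim: r => [|i r IH]; first by rewrite !big_nil.
  by rewrite !big_cons -[F i]scale1r Cl ?IH ?scale1r//; exact: in_U_sum.
have CZ a (M : Umat) : in_U k M -> C x (a *: M) = a *: C x M.
  by move=> MU; rewrite -[a *: M]addr0 Cl ?C0 ?addr0//; exact: in_U0.
have bU i j : in_U k (basisU i j) by exact: projU_in.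
apply/matrixP => a b; rewrite mxE.
have -> : C x (w x) a b = frob (C x (w x)) (basisU a b).
  by rewrite -frob_projU projU_id ?frob_delta//; exact: CU.
rewrite {2}(delta_sum wU) Csum => [|i]; last by apply: in_U_sum => j; exact: in_UZ.
rewrite frob_suml; apply: eq_bigr => i _.
rewrite Csum => [|j]; last exact: in_UZ.
by rewrite frob_suml; apply: eq_bigr => j _; rewrite CZ// frobZl.
Qed.

Lemma tensor_bound : exists2 c1, 0 < c1 & {ae leb, forall x : lebT, (Om : set lebT) x ->
  forall M : Umat, in_U k M -> frob (C x M) (C x M) <= c1 ^+ 2 * frob M M}.
Proof.
(* The bound [c] is dominated by the square of a positive number, so that it becomes a bound on
   norms. *)
case: hC => _ _ _ [c cP] _; exists (`|c| + 1); first by rewrite ltr_wpDl.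
apply: filterS cP => x h Ox M MU; apply: le_trans (h Ox M MU) _.
rewrite ler_wpM2r ?frob_ge0//; apply: le_trans (ler_norm _) _.
have := normr_ge0 c; move: `|c| => r r0; nra.
Qed.

Lemma integrable_frob2 (w z : L2mx k Om) :
  leb.-integrable (Om : set lebT) (fun x : lebT => (frob (L2mxrep w x) (L2mxrep z x))%:E).
Proof.
apply: (@integrable_Rsum _ lebT R leb Om _ _ (fun i (x : lebT) =>
  \sum_j L2mxrep w x i j * L2mxrep z x i j)) => // i.
apply: (@integrable_Rsum _ lebT R leb Om _ _ (fun j (x : lebT) =>
  L2mxrep w x i j * L2mxrep z x i j)) => // j.
exact: sqint_mul mOm (L2mx_sqintU w i j) (L2mx_sqintU z i j).
Qed.

Lemma frob_entry_le (M : Umat) a b : M a b ^+ 2 <= frob M M.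
Proof.
rewrite /frob (bigD1 a)//= (bigD1 b)//= -addrA expr2 lerDl addr_ge0//.
  by apply: sumr_ge0 => j _; rewrite -expr2 sqr_ge0.
by apply: sumr_ge0 => i _; apply: sumr_ge0 => j _; rewrite -expr2 sqr_ge0.
Qed.

Lemma sqint_fieldC (w : L2mx k Om) : L2U w -> sqintU Om (fieldC (L2mxrep w)).
Proof.
move=> wU a b; have [c1 c10 c1P] := tensor_bound.
have mf : measurable_fun (Om : set lebT) (fun x : lebT => fieldC (L2mxrep w) x a b).
  rewrite (_ : (fun x => _) = fun x => \sum_i \sum_j L2mxrep w x i j * coefC a b i j x).
    apply: measurable_sum => i; apply: measurable_sum => j; apply: measurable_funM.
      exact: sqint_measurable (L2mx_sqintU w i j).
    exact: measurable_coefC.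
  by apply/funext => x; rewrite mxE.
apply: (@sqint_ae_le _ lebT R leb Om _ (fun x => c1 ^+ 2 * frob (L2mxrep w x) (L2mxrep w x))) => //.
  exact: (integrableZl mOm (c1 ^+ 2) (integrable_frob2 w w)).
apply: filterS2 ae_fieldC c1P => x h1 h2 Ox; have wxU := L2U_rep x wU.
by rewrite h1//; apply: le_trans (frob_entry_le _ a b) _; exact: h2.
Qed.

Definition tensor_op (w : L2mx k Om) : L2mx k Om := toL2mx Om (fieldC (L2mxrep w)).

Lemma tensor_opP w : L2U w ->
  {ae leb, forall x : lebT, (Om : set lebT) x -> L2mxrep (tensor_op w) x = C x (L2mxrep w x)}.
Proof.
move=> wU; apply: filterS2 (toL2mxP (sqint_fieldC wU)) ae_fieldC => x h1 h2 Ox.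
by rewrite h1// h2//; exact: L2U_rep.
Qed.

Lemma L2mxrepD (w z : L2mx k Om) a :
  aeqU Om (L2mxrep (a *: w + z)) (fun x => a *: L2mxrep w x + L2mxrep z x).
Proof.
apply: aeqU_entries => i j.
have h1 := aeq_trans (L2repD (a *: w i j) (z i j)) (aeqD (L2repZ a (w i j)) (aeq_refl _ _ _)).
by apply: filterS h1 => x e /e; rewrite !mxE.
Qed.

Lemma L2U_of_ae_in (w : L2mx k Om) :
  {ae leb, forall x : lebT, (Om : set lebT) x -> in_U k (L2mxrep w x)} -> L2U w.
Proof.
rewrite /L2U; case: k w => //= w h i j; apply/L2_eqP.
by apply: filterS h => x h Ox; have := h Ox i j; rewrite !mxE.
Qed.

Lemma tensor_opU w : L2U w -> L2U (tensor_op w).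
Proof.
move=> wU; apply: L2U_of_ae_in; apply: filterS2 (tensor_opP wU) ae_linC => x h1 h2 Ox.
by rewrite h1//; have [CU _ _] := h2 Ox; apply: CU; exact: L2U_rep.
Qed.

Lemma tensor_op_lin a w z : L2U w -> L2U z ->
  tensor_op (a *: w + z) = a *: tensor_op w + tensor_op z.
Proof.
move=> wU zU; have awU : L2U (a *: w + z) by case: (L2U_subspace k Om) => _; exact.
apply/L2mx_eqP; have h1 := tensor_opP awU; have h2 := tensor_opP wU; have h3 := tensor_opP zU.
have h4 := L2mxrepD (tensor_op w) (tensor_op z) a; have h5 := L2mxrepD w z a.
have E1 : aeqU Om (L2mxrep (tensor_op (a *: w + z)))
    (fun x => C x (a *: L2mxrep w x + L2mxrep z x)).
  by apply: filterS2 h1 h5 => x e1 e2 Ox; rewrite e1// e2.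
have E2 : aeqU Om (L2mxrep (tensor_op (a *: w + z)))
    (fun x => a *: C x (L2mxrep w x) + C x (L2mxrep z x)).
  apply: filterS2 E1 ae_linC => x e1 h Ox; have [_ Cl _] := h Ox.
  by rewrite e1// Cl//; exact: L2U_rep.
have E3 : aeqU Om (L2mxrep (tensor_op (a *: w + z)))
    (fun x => a *: L2mxrep (tensor_op w) x + L2mxrep (tensor_op z) x).
  by apply: filterS3 E2 h2 h3 => x e1 e2 e3 Ox; rewrite e1// e2// e3.
by apply: filterS2 E3 h4 => x e1 e2 Ox; rewrite e1// e2.
Qed.

Lemma tensor_op_sym w z : L2U w -> L2U z ->
  ipL2mx (tensor_op w) z = ipL2mx w (tensor_op z).
Proof.
move=> wU zU; rewrite /ipL2mx /ipU /Rintegral; congr fine.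
apply: (ae_eq_integral _ _ mOm).
- by have /integrableP[] := integrable_frob2 (tensor_op w) z.
- by have /integrableP[] := integrable_frob2 w (tensor_op z).
apply: filterS3 (tensor_opP wU) (tensor_opP zU) ae_linC => x e1 e2 h Ox; have [_ _ Cs] := h Ox.
by rewrite e1// e2// Cs//; exact: L2U_rep.
Qed.

Lemma ipL2mx_le (w z w' z' : L2mx k Om) (a : R) :
  {ae leb, forall x : lebT, (Om : set lebT) x ->
    a * frob (L2mxrep w x) (L2mxrep z x) <= frob (L2mxrep w' x) (L2mxrep z' x)} ->
  a * ipL2mx w z <= ipL2mx w' z'.
Proof.
move=> h; have iwz := integrable_frob2 w z.
rewrite /ipL2mx /ipU -(RintegralZl a mOm iwz).
exact: ae_le_Rintegral mOm (integrableZl mOm a iwz) (integrable_frob2 w' z') h.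
Qed.

Lemma tensor_op_coercive : exists2 c0, 0 < c0 & forall w, L2U w ->
  c0 * ipL2mx w w <= ipL2mx (tensor_op w) w.
Proof.
case: hC => _ _ _ _ [c0 c00 c0P]; exists c0 => // w wU; apply: ipL2mx_le.
apply: filterS2 (tensor_opP wU) c0P => x h1 h2 Ox.
by rewrite h1//; apply: h2 => //; exact: L2U_rep.
Qed.

Lemma tensor_op_bounded : exists2 c1, 0 < c1 & forall w, L2U w ->
  nrm (@ipL2mx R n k Om) (tensor_op w) <= c1 * nrm (@ipL2mx R n k Om) w.
Proof.
have [c1 c10 c1P] := tensor_bound; exists c1 => // w wU.
rewrite -[leRHS]ger0_norm ?mulr_ge0 ?nrm_ge0//; last exact: ltW.
rewrite -sqrtr_sqr ler_wsqrtr// exprMn (nrm_sqr (L2mx_semi_ip k Om))// -ler_pdivrMl ?exprn_gt0//.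
apply: ipL2mx_le; apply: filterS2 (tensor_opP wU) c1P => x h1 h2 Ox.
by rewrite h1// ler_pdivrMl ?exprn_gt0//; apply: h2 => //; exact: L2U_rep.
Qed.

(** Pointwise coercivity makes C x injective on U, so the preimage chosen by [tensor_inv] must be
    the value of [z]. *)
Lemma tensor_inv_eq (w z : L2mx k Om) : L2U w -> L2U z -> tensor_op z = w ->
  aeqU Om (fun x => tensor_inv C x (L2mxrep w x)) (L2mxrep z).
Proof.
move=> wU zU zw; case: hC => _ _ _ _ [c0 c00 c0P].
have h := tensor_opP zU; rewrite zw in h.
apply: filterS3 h c0P ae_linC => x e1 e2 h3 Ox; have [_ Cl _] := h3 Ox.
have zxU := L2U_rep x zU.
have ex : [set N : Umat | in_U k N /\ C x N = L2mxrep w x] (L2mxrep z x) by rewrite e1.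
have [NU CN] := xgetPex 0 (ex_intro _ _ ex).
rewrite -/(tensor_inv C x (L2mxrep w x)) in NU CN.
set N := tensor_inv C x (L2mxrep w x) in NU CN *.
have dU : in_U k (-1 *: L2mxrep z x + N) by apply: in_UD => //; exact: in_UZ.
have C0 : C x (-1 *: L2mxrep z x + N) = 0.
  by rewrite Cl// CN e1// scaleN1r addNr.
have d0 : frob (-1 *: L2mxrep z x + N) (-1 *: L2mxrep z x + N) = 0.
  have := e2 Ox _ dU; rewrite C0 frob0l => d0.
  by apply/eqP; rewrite eq_le frob_ge0 andbT -(pmulr_rle0 _ c00).
by have /eqP := frob_eq0 d0; rewrite scaleN1r addrC subr_eq0 => /eqP.
Qed.

(** [tensor_inv] is a pointwise choice without evident measurability. The operator is therefore
    inverted on L2 by Riesz's theorem, and the result is identified almost everywhere with the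
    pointwise inverse. *)
Lemma tensor_inv_op : exists K : L2mx k Om -> L2mx k Om, forall w, L2U w ->
  [/\ L2U (K w), tensor_op (K w) = w &
      forall z, ipU Om (fun x => tensor_inv C x (L2mxrep w x)) (L2mxrep z) = ipL2mx (K w) z].
Proof.
have [c0 c00 c0P] := tensor_op_coercive; have [c1 c10 c1P] := tensor_op_bounded.
have hB := L2mx_semi_ip k Om.
have hU : semi_ip (@L2U R n k Om) (@ipL2mx R n k Om).
  split; first exact: L2U_subspace.
  - by move=> *; exact: (ip_lin hB).
  - by move=> *; exact: (ip_sym hB).
  - by move=> *; exact: (ip_ge0 hB).
have cU : fast_complete (@L2U R n k Om) (@ipL2mx R n k Om).
  move=> x xU fx; have [y [K [_ yK]]] := L2mx_complete Omfin (fun m => I) fx.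
  by exists y, K; split=> //; exact: L2U_closed xU yK.
have inv w : exists z, L2U w -> L2U z /\ tensor_op z = w.
  have [wU|nU] := pselect (L2U w); last by exists 0.
  have [z zU zw] := coercive_inverse hU cU (fun w _ => @ipL2mx_eq0 _ _ _ _ w) c00 tensor_opU
    tensor_op_lin tensor_op_sym c1P c0P wU.
  by exists z.
have [K KP] := choice inv; exists K => w wU; have [KU CK] := KP w wU; split=> // z.
have tK := tensor_inv_eq wU KU CK.
have tK' : aeqU Om (L2mxrep (K w)) (fun x => tensor_inv C x (L2mxrep w x)).
  by apply: filterS tK => x h Ox; rewrite h.
apply/esym; apply: (ipU_aeq mOm tK'); [exact: aeW|exact: L2mx_sqintU|exact: L2mx_sqintU].
Qed.

End TensorOperator.

(** * The abstract mixed scheme *)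

Section FiniteDimensional.
Context {R : realType} {W : lmodType R}.

Definition span_of p (g : 'I_p -> W) : set W :=
  [set x | exists c : 'I_p -> R, x = \sum_i c i *: g i].

Lemma span_subspace p (g : 'I_p -> W) : is_subspace (span_of g).
Proof.
split; first by exists (fun=> 0); rewrite big1// => i _; rewrite scale0r.
move=> a _ _ [c ->] [c' ->]; exists (fun i => a * c i + c' i).
rewrite scaler_sumr -big_split; apply: eq_bigr => i _ /=.
by rewrite scalerA scalerDl.
Qed.

Lemma span_mem p (g : 'I_p -> W) i : span_of g (g i).
Proof.
exists (fun j => (j == i)%:R); rewrite (bigD1 i)//= eqxx scale1r big1 ?addr0//.
by move=> j /negPf ->; rewrite scale0r.
Qed.

Variables (p : nat) (g : 'I_p -> W).
Let S := span_of g.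
Variables (B : W -> W -> R) (l : W -> R).
Hypotheses (Blin : forall a x y z, S x -> S y -> S z -> B (a *: x + y) z = a * B x z + B y z)
  (Bsym : forall x y, S x -> S y -> B x y = B y x)
  (llin : forall a x y, S x -> S y -> l (a *: x + y) = a * l x + l y)
  (Binj : forall x, S x -> (forall y, S y -> B x y = 0) -> x = 0).

Let lin_form0 (h : W -> R) :
  (forall a x y, S x -> S y -> h (a *: x + y) = a * h x + h y) -> h 0 = 0.
Proof.
move=> hl; have S0 := sub0 (span_subspace g).
by apply: (addIr (h 0)); have := hl 1 0 0 S0 S0; rewrite scale1r mul1r addr0 add0r.
Qed.

Let sum_lin (h : W -> R) (c : 'I_p -> R) :
  (forall a x y, S x -> S y -> h (a *: x + y) = a * h x + h y) ->
  h (\sum_i c i *: g i) = \sum_i c i * h (g i).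
Proof.
move=> hl; have S0 := sub0 (span_subspace g); have h0 := lin_form0 hl.
have [_ <-] : S (\sum_i c i *: g i) /\ h (\sum_i c i *: g i) = \sum_i c i * h (g i) => //.
elim/big_rec2 : _ => [//|i y x _ [Sx <-]]; have Sg := span_mem g i.
by split; [case: (span_subspace g) => _; exact|exact: hl].
Qed.

(* The Gram matrix is symmetric, so its cokernel consists of coefficient vectors of
   the radical of [B], on which [l] vanishes. *)
Lemma symmetric_solve : exists2 x, S x & forall y, S y -> B x y = l y.
Proof.
pose M := \matrix_(i, j) B (g i) (g j); pose r := \row_j l (g j).
have Sg i : S (g i) := span_mem g i.
have expand (c : 'I_p -> R) j : B (\sum_i c i *: g i) (g j) = \sum_i c i * B (g i) (g j).
  by apply: (sum_lin (h := fun x => B x (g j))) => a x y Sx Sy; exact: Blin.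
have expandr x (c : 'I_p -> R) : S x -> B x (\sum_i c i *: g i) = \sum_i c i * B x (g i).
  move=> Sx; apply: (sum_lin (h := B x)) => a y z Sy Sz.
  have Sayz : S (a *: y + z) by case: (span_subspace g) => _; exact.
  by rewrite Bsym// Blin// (Bsym Sx Sy) (Bsym Sx Sz).
have /submxP[D rD] : (r <= M)%MS.
  rewrite submxE; apply/eqP/rowP => j; rewrite !mxE.
  pose c i := cokermx M i j; have Sc : S (\sum_i c i *: g i) by exists c.
  have c0 : \sum_i c i *: g i = 0.
    apply: Binj => // y [d ->]; rewrite expandr// big1// => i _.
    rewrite expand (_ : \sum_k _ = (M *m cokermx M) i j); last first.
      by rewrite mxE; apply: eq_bigr => k _; rewrite mxE mulrC Bsym.
    by rewrite mulmx_coker mxE mulr0.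
  have := sum_lin c llin; rewrite c0 (lin_form0 llin) => E; rewrite [RHS]E.
  by apply: eq_bigr => i _; rewrite mxE mulrC.
exists (\sum_i D 0 i *: g i); first by exists (fun i => D 0 i).
move=> _ [c ->]; rewrite expandr; last by exists (fun i => D 0 i).
rewrite (sum_lin c llin); apply: eq_bigr => j _; congr (_ * _).
rewrite expand; have /rowP/(_ j) := rD; rewrite !mxE => ->.
by apply: eq_bigr => i _; rewrite mxE.
Qed.

End FiniteDimensional.

(** * Unique solvability and quasi-optimality of the abstract scheme *)

Section MixedScheme.
Context {R : realType} {U V : lmodType R}.
Variables (US : set U) (VS : set V) (sU : is_subspace US).
Variables (BV : V -> V -> R) (hV : semi_ip VS BV) (V_eq0 : forall v, VS v -> BV v v = 0 -> v = 0).
Variables (nU : U -> R) (U_eq0 : forall x, US x -> nU x = 0 -> x = 0).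
Hypotheses (nU_ge0 : forall x, 0 <= nU x) (nUN : forall x, US x -> nU (- x) = nU x)
  (nUD : forall x y, US x -> US y -> nU (x + y) ^+ 2 <= 2 * nU x ^+ 2 + 2 * nU y ^+ 2).
Variables (b : U -> V -> R) (M K CF : R).
Hypotheses (M_ge0 : 0 <= M) (K_ge0 : 0 <= K) (CF_ge0 : 0 <= CF).
Hypotheses (bl : forall a x y v, US x -> US y -> VS v -> b (a *: x + y) v = a * b x v + b y v)
  (br : forall a x v w, US x -> VS v -> VS w -> b x (a *: v + w) = a * b x v + b x w)
  (bM : forall x v, US x -> VS v -> `|b x v| <= M * nU x * nrm BV v)
  (infsup : forall x, US x -> exists v s, [/\ VS v, nU x ^+ 2 <= s, s <= b x v &
     BV v v <= K * s]).
Variables (p q : nat) (e : 'I_p -> V) (f : 'I_q -> U).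
Let Vh := span_of e.
Let Uh := span_of f.
Hypotheses (VhV : Vh `<=` VS) (UhU : Uh `<=` US).
Variable F : V -> V.
Hypotheses (FVh : forall v, VS v -> Vh (F v))
  (Fb : forall x v, Uh x -> VS v -> b x (v - F v) = 0)
  (Fn : forall v, VS v -> nrm BV (F v) <= CF * nrm BV v).

Let sV := ip_sub hV.

Lemma b_subl x y v : US x -> US y -> VS v -> b (x - y) v = b x v - b y v.
Proof.
by move=> Ux Uy Vv; rewrite addrC -scaleN1r bl// mulN1r addrC.
Qed.

Lemma b0l v : VS v -> b 0 v = 0.
Proof. by move=> Vv; have := b_subl (sub0 sU) (sub0 sU) Vv; rewrite !subrr. Qed.

Lemma b_subr x v w : US x -> VS v -> VS w -> b x (v - w) = b x v - b x w.
Proof. by move=> Ux Vv Vw; rewrite addrC -scaleN1r br// mulN1r addrC. Qed.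

Lemma fortin x v : Uh x -> VS v -> b x v = b x (F v).
Proof.
move=> Ux Vv; have UFv := VhV (FVh Vv); apply/eqP; rewrite -subr_eq0 -b_subr ?Fb//.
exact: UhU.
Qed.

(** The continuous inf-sup test function of [x] may be replaced by its image under [F], which lies
    in [Vh]. *)
Lemma discrete_inj x : Uh x -> (forall v, Vh v -> b x v = 0) -> x = 0.
Proof.
move=> Ux bx0; have USx := UhU Ux; have [v [s [Vv xs sb _]]] := infsup USx.
apply: U_eq0 => //; apply/eqP; rewrite -sqrf_eq0 eq_le sqr_ge0 andbT.
by apply: le_trans xs (le_trans sb _); rewrite fortin// bx0//; exact: FVh.
Qed.

Definition scheme (l : V -> R) (vh : V) (uh : U) : Prop :=
  [/\ Vh vh, Uh uh, forall v, Vh v -> BV vh v + b uh v = l v &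
      forall x, Uh x -> b x vh = 0].

(** Testing the difference of the first equations with vh - vh' removes the [b] term by the second
    equations; definiteness gives vh = vh', and [discrete_inj] then gives uh = uh'. *)
Lemma scheme_uniq l vh uh vh' uh' : scheme l vh uh -> scheme l vh' uh' ->
  vh = vh' /\ uh = uh'.
Proof.
move=> [Vv Uu e1 e2] [Vv' Uu' e1' e2'].
have Vd := subB (span_subspace e) Vv Vv'; have Ud := subB (span_subspace f) Uu Uu'.
have h v : Vh v -> BV (vh - vh') v + b (uh - uh') v = 0.
  move=> Vhv; have := e1 _ Vhv; rewrite -(e1' _ Vhv).
  have VSv := VhV Vhv; rewrite (ipBl hV) ?b_subl//; try exact: UhU; try exact: VhV.
  by move=> e3; rewrite addrACA e3 -opprD subrr.
have v0 : vh - vh' = 0.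
  apply: V_eq0; first exact: VhV.
  have := h _ Vd; rewrite b_subr; [|exact: UhU|exact: VhV|exact: VhV].
  by rewrite e2// e2'// subrr addr0.
have u0 : uh - uh' = 0.
  apply: discrete_inj => // v Vhv; have := h _ Vhv.
  by rewrite v0 (ip0l hV) ?add0r//; exact: VhV.
by split; apply/eqP; rewrite -subr_eq0 ?v0 ?u0.
Qed.

(** The saddle point system is one symmetric form [B] on the span of pairs, so [symmetric_solve]
    applies; its injectivity hypothesis is uniqueness for zero data. *)
Lemma scheme_exists l : (forall a v w, VS v -> VS w -> l (a *: v + w) = a * l v + l w) ->
  exists vh uh, scheme l vh uh.
Proof.
move=> ll; pose g (i : 'I_(p + q)) : V * U :=
  match fintype.split i with inl i => (e i, 0) | inr j => (0, f j) end.
pose B (x y : V * U) := BV x.1 y.1 + b x.2 y.1 + b y.2 x.1.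
have spanE x : span_of g x <-> Vh x.1 /\ Uh x.2.
  have gl i : g (lshift q i) = (e i, 0) by rewrite /g -[lshift _ _]/(unsplit (inl _)) unsplitK.
  have gr j : g (rshift p j) = (0, f j) by rewrite /g -[rshift _ _]/(unsplit (inr _)) unsplitK.
  have E (c : 'I_(p + q) -> R) : \sum_i c i *: g i =
      (\sum_i c (lshift q i) *: e i, \sum_j c (rshift p j) *: f j).
    have pairE (I : finType) (h : I -> V * U) : \sum_i h i = (\sum_i (h i).1, \sum_i (h i).2).
      by rewrite [LHS]surjective_pairing; congr pair; apply: (big_morph _ _ (erefl _)).
    rewrite pairE; congr pair; rewrite big_split_ord /=.
      rewrite [X in _ + X]big1 ?addr0 => [|j _]; last by rewrite gr /= scaler0.
      by apply: eq_bigr => i _; rewrite gl.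
    rewrite [X in X + _]big1 ?add0r => [|i _]; last by rewrite gl /= scaler0.
    by apply: eq_bigr => j _; rewrite gr.
  split=> [[c ->]|[[c cE] [d dE]]].
    by rewrite E /=; split; [exists (fun i => c (lshift q i))|exists (fun j => c (rshift p j))].
  exists (fun i => match fintype.split i with inl i => c i | inr j => d j end).
  rewrite E [LHS]surjective_pairing cE dE; congr pair; apply: eq_bigr => i _.
    by rewrite -[lshift _ _]/(unsplit (inl _)) unsplitK.
  by rewrite -[rshift _ _]/(unsplit (inr _)) unsplitK.
have spanVU x : span_of g x -> VS x.1 /\ US x.2.
  by move=> /spanE[/VhV ? /UhU ?].
have B1 a x y z : span_of g x -> span_of g y -> span_of g z ->
    B (a *: x + y) z = a * B x z + B y z.
  move=> /spanVU[x1 x2] /spanVU[y1 y2] /spanVU[z1 z2].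
  by rewrite /B /= (ip_lin hV)// bl// br//; ring.
have [x Sx xE] : exists2 x, span_of g x & forall y, span_of g y -> B x y = l y.1.
  apply: (symmetric_solve (B := B) (l := fun x => l x.1)) => //.
  - by move=> x y /spanVU[x1 x2] /spanVU[y1 y2]; rewrite /B (ip_sym hV)// addrAC.
  - by move=> a x y /spanVU[x1 _] /spanVU[y1 _]; rewrite ll.
  - move=> x Sx h; have [Vx Ux] := (spanE x).1 Sx.
    have s1 : scheme (fun=> 0) x.1 x.2.
      split=> // [v Vv|z Uz].
        have Sv : span_of g (v, 0) by apply/spanE; split=> //; exact: sub0 (span_subspace f).
        by have := h _ Sv; rewrite /B /= b0l ?addr0//; exact: VhV.
      have Sz : span_of g (0, z) by apply/spanE; split=> //; exact: sub0 (span_subspace e).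
      have := h _ Sz; rewrite /B /= (ip0r hV); last exact: VhV.
      have b00 : b x.2 0 = 0.
        have V0 := sub0 sV; have := br 1 (UhU Ux) V0 V0; rewrite scale1r addr0 mul1r => E.
        by apply: (addIr (b x.2 0)); rewrite add0r.
      by rewrite b00 !add0r.
    have s0 : scheme (fun=> 0) 0 0.
      split; [exact: sub0 (span_subspace e)|exact: sub0 (span_subspace f)| |].
        by move=> v Vv; rewrite (ip0l hV) ?b0l ?addr0//; exact: VhV.
      move=> z Uz; have V0 := sub0 sV; have := br 1 (UhU Uz) V0 V0.
      rewrite scale1r addr0 mul1r => E.
      by apply: (addIr (b z 0)); rewrite add0r.
    have [x1 x2] := scheme_uniq s1 s0.
    by rewrite [x]surjective_pairing x1 x2.
have [Vx Ux] := (spanE x).1 Sx; exists x.1, x.2; split=> // [v Vv|z Uz].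
  have Sv : span_of g (v, 0) by apply/spanE; split=> //; exact: sub0 (span_subspace f).
  by have := xE _ Sv; rewrite /B /= b0l ?addr0//; exact: VhV.
have Sz : span_of g (0, z) by apply/spanE; split=> //; exact: sub0 (span_subspace e).
have V0 := sub0 sV; have := xE _ Sz; rewrite /B /= (ip0r hV); last exact: VhV.
have -> : b x.2 0 = 0.
  have := br 1 (UhU Ux) V0 V0; rewrite scale1r addr0 mul1r => E.
  by apply: (addIr (b x.2 0)); rewrite add0r.
have -> : l 0 = 0.
  have := ll 1 0 0 V0 V0; rewrite scale1r addr0 mul1r => E.
  by apply: (addIr (l 0)); rewrite add0r.
by rewrite !add0r.
Qed.

Lemma scheme_unique_exists l :
  (forall a v w, VS v -> VS w -> l (a *: v + w) = a * l v + l w) ->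
  exists! p : V * U, scheme l p.1 p.2.
Proof.
move=> /scheme_exists[vh [uh sh]]; exists (vh, uh); split=> // -[vh' uh'] sh'.
by have [-> ->] := scheme_uniq sh sh'.
Qed.

(** From |a + b|^2 <= 2 |a|^2 + 2 |b|^2: the first 2 multiplies |u - w|^2, and 8 is twice the 4
    obtained by squaring the factor 2 in [s_le]. *)
Definition quasi_const : R := 2 + 8 * (M ^+ 2 * CF ^+ 2 * K).

Lemma quasi_optimal l u vh uh : US u -> (forall v, VS v -> b u v = l v) ->
  scheme l vh uh -> forall w, Uh w -> nU (u - uh) ^+ 2 <= quasi_const * nU (u - w) ^+ 2.
Proof.
move=> Uu bu [Vvh Uuh e1 e2] w Uw.
have USw := UhU Uw; have USuh := UhU Uuh; have VSvh := VhV Vvh.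
have USuw := subB sU Uu USw; have USx := subB sU USuh USw.
(* Tested with [vh], the first equation reads |vh|^2 = b(u, vh), since b(uh, vh) = 0; as b(w, vh) =
   0 too, this is b(u - w, vh). *)
have vhM : nrm BV vh <= M * nU (u - w).
  have h : nrm BV vh ^+ 2 <= M * nU (u - w) * nrm BV vh.
    apply: le_trans (bM USuw VSvh); apply: le_trans (ler_norm _).
    rewrite (nrm_sqr hV)// b_subl// (e2 _ Uw) subr0 bu// -e1// (e2 _ Uuh) addr0.
    exact: lexx.
  have := nrm_ge0 (B := BV) vh; rewrite le_eqVlt => /predU1P[<-|v0].
    by rewrite mulr_ge0.
  by rewrite -(ler_pM2r v0) -expr2.
have [y [s [Vy xs sb ys]]] := infsup USx.
have VFy := FVh Vy; have VSFy := VhV VFy.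
have s_le : s <= 2 * M * nU (u - w) * (CF * nrm BV y).
  apply: le_trans sb _; rewrite fortin//; last exact: (subB (span_subspace f)).
  (* Galerkin identity: on [Vh] the values of [b] at u and at uh differ by the residual term with
     [vh], which [vhM] already controls. *)
  have -> : b (uh - w) (F y) = b (u - w) (F y) - BV vh (F y).
    rewrite !b_subl// bu// -(e1 _ VFy); ring.
  apply: le_trans (ler_norm _) _; apply: le_trans (ler_normB _ _) _.
  apply: (@le_trans _ _ (2 * M * nU (u - w) * nrm BV (F y))); last first.
    by rewrite ler_wpM2l ?Fn// !mulr_ge0.
  have h1 := bM USuw VSFy; have h2 := cauchy_schwarz hV VSvh VSFy.
  have h3 := ler_wpM2r (nrm_ge0 (B := BV) (F y)) vhM.
  have -> : 2 * M * nU (u - w) * nrm BV (F y) =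
      M * nU (u - w) * nrm BV (F y) + M * nU (u - w) * nrm BV (F y) by ring.
  by apply: lerD => //; exact: le_trans h2 h3.
have s0 : 0 <= s by apply: le_trans xs; exact: sqr_ge0.
have s_le2 : s <= 4 * (M ^+ 2 * CF ^+ 2 * K) * nU (u - w) ^+ 2.
  have ynK : nrm BV y ^+ 2 <= K * s by rewrite (nrm_sqr hV).
  have y0 := nrm_ge0 (B := BV) y; have a0 := nU_ge0 (u - w).
  (* After squaring, |y|^2 <= K s trades the test norm for [s] itself, and one factor [s] is
     cancelled. *)
  have h : s ^+ 2 <= (4 * (M ^+ 2 * CF ^+ 2 * K) * nU (u - w) ^+ 2) * s.
    apply: (@le_trans _ _ ((2 * M * nU (u - w) * (CF * nrm BV y)) ^+ 2)).
      by rewrite ler_sqr// nnegrE !mulr_ge0.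
    have -> : (2 * M * nU (u - w) * (CF * nrm BV y)) ^+ 2 =
        (4 * (M ^+ 2 * CF ^+ 2) * nU (u - w) ^+ 2) * nrm BV y ^+ 2 by ring.
    have -> : 4 * (M ^+ 2 * CF ^+ 2 * K) * nU (u - w) ^+ 2 * s =
        (4 * (M ^+ 2 * CF ^+ 2) * nU (u - w) ^+ 2) * (K * s) by ring.
    by rewrite ler_wpM2l// !mulr_ge0// sqr_ge0.
  move: s0; rewrite le_eqVlt => /predU1P[<-|s0].
    by rewrite !mulr_ge0// ?sqr_ge0.
  by rewrite -(ler_pM2r s0) -expr2.
have -> : u - uh = (u - w) + - (uh - w) by rewrite opprB addrA subrK.
apply: le_trans (nUD USuw (subN sU USx)) _; rewrite nUN//.
have h := le_trans xs s_le2.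
apply: (@le_trans _ _ (2 * nU (u - w) ^+ 2 +
    2 * (4 * (M ^+ 2 * CF ^+ 2 * K) * nU (u - w) ^+ 2))).
  by apply: lerD => //; rewrite ler_wpM2l.
by rewrite /quasi_const le_eqVlt; apply/orP; left; apply/eqP; ring.
Qed.

End MixedScheme.

(** * Trace spaces and the bilinear form *)

Section QuotientNorm.
Context {R : realType} {X : lmodType R} {Y : Type}.
Variables (D : set X) (sD : is_subspace D) (N : X -> R) (gam : X -> Y -> R^o).
Hypotheses (N_ge0 : forall x, 0 <= N x) (ND : forall x y, D x -> D y -> N (x + y) <= N x + N y)
  (NN : forall x, D x -> N (- x) = N x)
  (gamlin : forall a x y, D x -> D y -> gam (a *: x + y) = a *: gam x + gam y).

Definition quotient_norm (phi : Y -> R^o) : R :=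
  inf [set N v | v in [set v | D v /\ gam v = phi]].

Lemma quotient_norm_le v : D v -> quotient_norm (gam v) <= N v.
Proof.
move=> Dv; apply: ge_inf; last by exists v.
by exists 0 => _ [w _ <-].
Qed.

Lemma quotient_norm_ge r v : D v -> (forall w, D w -> gam w = gam v -> r <= N w) ->
  r <= quotient_norm (gam v).
Proof.
move=> Dv h; apply: lb_le_inf; first by exists (N v), v.
by move=> _ [w [Dw wv] <-]; exact: h.
Qed.

Lemma quotient_norm_ge0 phi : 0 <= quotient_norm phi.
Proof.
have [[v [Dv <-]]|h] := pselect (exists v, D v /\ gam v = phi).
  by apply: quotient_norm_ge.
rewrite /quotient_norm (_ : [set N v | v in _] = set0) ?inf0//.
by apply/seteqP; split=> // z [v vP _]; apply: h; exists v.
Qed.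

Lemma gamD x y : D x -> D y -> gam (x + y) = gam x + gam y.
Proof. by move=> Dx Dy; rewrite -[x]scale1r gamlin// !scale1r. Qed.

Lemma gamN x : D x -> gam (- x) = - gam x.
Proof.
move=> Dx; have D0 := sub0 sD; have g0 : gam 0 = 0.
  by apply: (addIr (gam 0)); rewrite -gamD// addr0 add0r.
by rewrite -[- x]addr0 -scaleN1r gamlin// g0 addr0 scaleN1r.
Qed.

Lemma quotient_normD x y : D x -> D y ->
  quotient_norm (gam x + gam y) <= quotient_norm (gam x) + quotient_norm (gam y).
Proof.
move=> Dx Dy; rewrite -lerBlDr; apply: quotient_norm_ge => // v Dv vx.
rewrite lerBlDr -lerBlDl; apply: quotient_norm_ge => // w Dw wy.
rewrite lerBlDl -vx -wy -gamD//; apply: le_trans (quotient_norm_le _) _.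
  exact: subD.
by apply: le_trans (ND _ _) _.
Qed.

Lemma quotient_normN x : D x -> quotient_norm (- gam x) = quotient_norm (gam x).
Proof.
move=> Dx; apply/eqP; rewrite eq_le; apply/andP; split.
  apply: quotient_norm_ge => // v Dv vx; rewrite -(NN Dv) -vx -gamN//.
  by apply: quotient_norm_le; exact: subN.
rewrite -gamN//; apply: quotient_norm_ge => [|v Dv vx]; first exact: subN.
rewrite -(NN Dv) -[gam x]opprK -gamN// -vx -gamN//.
by apply: quotient_norm_le; exact: subN.
Qed.

(** Every extension of the trace gives a bound on its value, and the infimum is taken after dividing
    by r; the case r = 0 is separate. *)
Lemma quotient_norm_bound x d (r : R) : 0 <= r -> D x ->
  (forall v, D v -> gam v = gam x -> `|gam v d| <= N v * r) ->
  `|gam x d| <= quotient_norm (gam x) * r.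
Proof.
rewrite le_eqVlt => /predU1P[<-|r0] Dx h.
  by rewrite mulr0; have := h x Dx erefl; rewrite mulr0.
rewrite -ler_pdivrMr//; apply: quotient_norm_ge => // v Dv vx.
by rewrite ler_pdivrMr// -vx; exact: h.
Qed.

End QuotientNorm.

(** * Broken operators and their graph forms *)

Section BrokenOperators.
Context {R : realType} {n : nat} {k : Ukind} (A : diffop R n k).
Local Notation Rd := 'rV[R]_n.+1.
Local Notation lebT := (@lebT R n).
Local Notation leb := (@leb R n).
Variables (Om : opens R n) (Omfin : (leb Om < +oo)%E).
Local Notation E := (L2 Om).
Local Notation G := (L2mx k Om).
Local Notation BE := (@ipL2 R n Om).
Local Notation BG := (@ipL2mx R n k Om).
Let hE := L2_semi_ip Om.
Let hG := L2mx_semi_ip k Om.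
Variables (N : nat) (T : 'I_N -> opens R n).
Hypotheses (TOm : forall i, T i `<=` Om) (disjT : trivIset setT (fun i => T i : set Rd))
  (nullT : leb (Om `\` \bigcup_i T i) = 0%E).

(** [relAs] does not ask its argument to be U-valued, whereas [HAsT] does; with this condition the
    domain of the relation is [HAsT]. *)
Definition relAsU (w : G) (g : E) : Prop := L2U w /\ relAs A T w g.

Lemma relA_lin a (x x' : E) (y y' : G) : relA A T x y -> relA A T x' y' ->
  relA A T (a *: x + x') (a *: y + y').
Proof. exact: (adjoint_rel_lin hE hG (L2U_subspace k Om) a). Qed.

Lemma relAsU_lin a (x x' : G) (y y' : E) : relAsU x y -> relAsU x' y' ->
  relAsU (a *: x + x') (a *: y + y').
Proof.
move=> [xU xy] [xU' xy']; split; first by case: (L2U_subspace k Om) => _; exact.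
by apply: (adjoint_rel_lin hG hE _ a xy xy'); split.
Qed.

Lemma relAsU_uniq w g g' : relAsU w g -> relAsU w g' -> g = g'.
Proof. by move=> [_ h] [_ h']; exact: (relAs_uniq Omfin TOm disjT nullT h h'). Qed.

Lemma relA_uniqT (v : E) (g g' : G) : relA A T v g -> relA A T v g' -> g = g'.
Proof. by move=> h h'; exact: (relA_uniq Omfin TOm disjT nullT h h'). Qed.

Lemma relA_closed (x : nat -> E) (y : nat -> G) x0 y0 K K' :
  (forall m, relA A T (x m) (y m)) ->
  (forall m, nrm BE (x m - x0) <= K * 2^-1 ^+ m) ->
  (forall m, nrm BG (y m - y0) <= K' * 2^-1 ^+ m) -> relA A T x0 y0.
Proof. by apply: (adjoint_rel_closed hE hG) => *; exact: (L2U_closed _ _). Qed.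

Lemma relAsU_closed (x : nat -> G) (y : nat -> E) x0 y0 K K' :
  (forall m, relAsU (x m) (y m)) ->
  (forall m, nrm BG (x m - x0) <= K * 2^-1 ^+ m) ->
  (forall m, nrm BE (y m - y0) <= K' * 2^-1 ^+ m) -> relAsU x0 y0.
Proof.
move=> xy xx0 yy0; split; first by apply: (L2U_closed _ xx0) => m; case: (xy m).
by apply: (adjoint_rel_closed hG hE _ _ xx0 yy0) => // m; case: (xy m).
Qed.

Definition opAT : E -> G := op (relA A T).
Definition opAsT : G -> E := op relAsU.

Lemma HAT_dom v : HAT A Om T v <-> dom (relA A T) v.
Proof. exact: HAT_rel. Qed.

Lemma HAsT_dom w : HAsT A Om T w <-> dom relAsU w.
Proof.
split=> [/(HAsT_rel A Omfin TOm disjT)[wU [g wg]]|[g [wU wg]]]; first by exists g.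
by apply/(HAsT_rel A Omfin TOm disjT); split=> //; exists g.
Qed.

Lemma opAT_rel v : HAT A Om T v -> relA A T v (opAT v).
Proof. by move=> /HAT_dom; exact: opP. Qed.

Lemma opAsT_rel w : HAsT A Om T w -> relAs A T w (opAsT w).
Proof. by move=> /HAsT_dom /opP[]. Qed.

Lemma opAT_U v : HAT A Om T v -> L2U (opAT v).
Proof. by move=> /opAT_rel[]. Qed.

Lemma opAT_lin a x y : HAT A Om T x -> HAT A Om T y ->
  opAT (a *: x + y) = a *: opAT x + opAT y.
Proof. by move=> /HAT_dom hx /HAT_dom hy; exact: (op_lin relA_lin relA_uniqT). Qed.

Lemma opAsT_lin a x y : HAsT A Om T x -> HAsT A Om T y ->
  opAsT (a *: x + y) = a *: opAsT x + opAsT y.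
Proof. by move=> /HAsT_dom hx /HAsT_dom hy; exact: (op_lin relAsU_lin relAsU_uniq). Qed.

Lemma ipT_AE w v : HAT A Om T v -> ipT_A A T w v = BG w (opAT v).
Proof.
move=> /opAT_rel h; rewrite -(sum_ipU_res TOm disjT nullT); apply: eq_bigr => i _.
by rewrite (weakA_rel Omfin TOm i h).
Qed.

Lemma ipT_AsE v w : HAsT A Om T w -> ipT_As A T v w = BE v (opAsT w).
Proof.
move=> /opAsT_rel h; rewrite -(sum_ip_res TOm disjT nullT); apply: eq_bigr => i _.
by rewrite (weakAs_rel Omfin TOm i h).
Qed.

Definition gipA : E -> E -> R := graph_ip BE BG (relA A T).
Definition gipAs : G -> G -> R := graph_ip BG BE relAsU.

Lemma ipVT_gip y z : HAT A Om T y.1 -> HAT A Om T z.1 -> HAsT A Om T y.2 -> HAsT A Om T z.2 ->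
  ipVT A T y z = gipA y.1 z.1 + gipAs y.2 z.2.
Proof.
move=> /opAT_rel y1 /opAT_rel z1 /opAsT_rel y2 /opAsT_rel z2.
rewrite /ipVT /gipA /gipAs /graph_ip; congr (_ + _ + (_ + _)).
  rewrite -(sum_ipU_res2 TOm disjT nullT); apply: eq_bigr => i _.
  by rewrite (weakA_rel Omfin TOm i y1) (weakA_rel Omfin TOm i z1).
rewrite -(sum_ip_res2 TOm disjT nullT); apply: eq_bigr => i _.
by rewrite (weakAs_rel Omfin TOm i y2) (weakAs_rel Omfin TOm i z2).
Qed.

Lemma normAT_gip v : HAT A Om T v -> normAT A T v = nrm gipA v.
Proof.
move=> /opAT_rel h; rewrite /normAT /nrm; congr Num.sqrt; rewrite /gipA /graph_ip.
rewrite (nrm_sqr hE)//; congr (_ + _).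
rewrite -(sum_ipU_res2 TOm disjT nullT); apply: eq_bigr => i _.
by rewrite (weakA_rel Omfin TOm i h) norm2UE (nrm_sqr (L2mx_semi_ip k (T i))).
Qed.

Lemma normAsT_gip w : HAsT A Om T w -> normAsT A T w = nrm gipAs w.
Proof.
move=> /opAsT_rel h; rewrite /normAsT /nrm; congr Num.sqrt; rewrite /gipAs /graph_ip.
rewrite norm2UE (nrm_sqr hG)//; congr (_ + _).
rewrite -(sum_ip_res2 TOm disjT nullT); apply: eq_bigr => i _.
by rewrite (weakAs_rel Omfin TOm i h) norm2E (nrm_sqr (L2_semi_ip (T i))).
Qed.

Lemma HAT_subB x y : HAT A Om T x -> HAT A Om T y -> HAT A Om T (x - y).
Proof.
move=> /opAT_rel hx /opAT_rel hy; apply/HAT_dom; rewrite addrC -scaleN1r.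
by exists (-1 *: opAT y + opAT x); exact: relA_lin.
Qed.

Lemma HAsT_subB x y : HAsT A Om T x -> HAsT A Om T y -> HAsT A Om T (x - y).
Proof.
move=> /HAsT_dom[g hx] /HAsT_dom[g' hy]; apply/HAsT_dom; rewrite addrC -scaleN1r.
by exists (-1 *: g' + g); exact: relAsU_lin.
Qed.

Section ClosedSubspaces.
Variables (HtA : set E) (HtAs : set G).
Hypotheses (clA : closed_subspace (normAT A T) (HAT A Om T) HtA)
  (clAs : closed_subspace (normAsT A T) (HAsT A Om T) HtAs).

Lemma gipA_semi_ip : semi_ip HtA gipA.
Proof.
have [sA subA _] := clA; apply: (graph_semi_ip hE hG relA_lin relA_uniqT sA).
by move=> v /subA /HAT_dom.
Qed.

Lemma gipAs_semi_ip : semi_ip HtAs gipAs.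
Proof.
have [sA subA _] := clAs; apply: (graph_semi_ip hG hE relAsU_lin relAsU_uniq sA).
by move=> v /subA /HAsT_dom.
Qed.

Lemma gipA_complete : fast_complete HtA gipA.
Proof.
have [sA subA cA] := clA.
apply: (graph_complete hE hG relA_lin relA_uniqT).
- by move=> v /subA /HAT_dom.
- exact: L2_complete.
- exact: L2mx_complete.
- exact: relA_closed.
move=> x /HAT_dom hx h; apply: cA => // e e0; have [y Sy xy] := h e e0; exists y => //.
by rewrite normAT_gip//; apply: HAT_subB => //; exact: subA.
Qed.

Lemma gipAs_complete : fast_complete HtAs gipAs.
Proof.
have [sA subA cA] := clAs.
apply: (graph_complete hG hE relAsU_lin relAsU_uniq).
- by move=> v /subA /HAsT_dom.
- exact: L2mx_complete.
- exact: L2_complete.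
- exact: relAsU_closed.
move=> x /HAsT_dom hx h; apply: cA => // e e0; have [y Sy xy] := h e e0; exists y => //.
by rewrite normAsT_gip//; apply: HAsT_subB => //; exact: subA.
Qed.

End ClosedSubspaces.
End BrokenOperators.

(** * The operators on the whole domain and their maximality *)

Section GlobalOperators.
Context {R : realType} {n : nat} {k : Ukind} (A : diffop R n k).
Local Notation Rd := 'rV[R]_n.+1.
Local Notation lebT := (@lebT R n).
Local Notation leb := (@leb R n).
Variables (Om : opens R n) (Omfin : (leb Om < +oo)%E).
Local Notation E := (L2 Om).
Local Notation G := (L2mx k Om).
Local Notation BE := (@ipL2 R n Om).
Local Notation BG := (@ipL2mx R n k Om).
Let hE := L2_semi_ip Om.
Let hG := L2mx_semi_ip k Om.

Definition opA0 (v : E) : G := weakA A Om v.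
Definition opAs0 (w : G) : E := weakAs A Om (L2mxrep w).

Lemma HA_distr (v : E) : HA A Om v -> distrA A v (opA0 v).
Proof. by move=> h; exact: (xgetPex 0 h). Qed.

Lemma HAs_distr (w : G) : HAs A Om w -> distrAs A (L2mxrep w) (opAs0 w).
Proof. by move=> [_ h]; exact: (xgetPex 0 h). Qed.

Lemma distr_HA (v : E) (g : G) : distrA A v g -> HA A Om v /\ opA0 v = g.
Proof. by move=> h; split; [exists g|exact: weakA_eq]. Qed.

Lemma distr_HAs (w : G) (g : E) : L2U w -> distrAs A (L2mxrep w) g ->
  HAs A Om w /\ opAs0 w = g.
Proof. by move=> wU h; split; [split=> //; exists g|exact: weakAs_eq]. Qed.

Lemma HA_lin a (x y : E) : HA A Om x -> HA A Om y ->
  HA A Om (a *: x + y) /\ opA0 (a *: x + y) = a *: opA0 x + opA0 y.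
Proof.
move=> /HA_distr/(relA_single A Omfin) hx /HA_distr/(relA_single A Omfin) hy.
by apply: distr_HA; apply/(relA_single A Omfin); exact: relA_lin.
Qed.

Lemma HAs_lin a (x y : G) : HAs A Om x -> HAs A Om y ->
  HAs A Om (a *: x + y) /\ opAs0 (a *: x + y) = a *: opAs0 x + opAs0 y.
Proof.
move=> hx hy; have xU := hx.1; have yU := hy.1.
have rx := (relAs_single A Omfin x _).2 (HAs_distr hx).
have ry := (relAs_single A Omfin y _).2 (HAs_distr hy).
have [hU h] := relAsU_lin a (conj xU rx) (conj yU ry).
by apply: distr_HAs => //; apply/(relAs_single A Omfin).
Qed.

Lemma HA_subspace : is_subspace (HA A Om).
Proof.
split; last by move=> a x y hx hy; have [] := HA_lin a hx hy.
exists 0; apply/(relA_single A Omfin).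
exact: (adjoint_rel0 hE hG (L2U_subspace k Om)).
Qed.

Lemma HAs_subspace : is_subspace (HAs A Om).
Proof.
split; last by move=> a x y hx hy; have [] := HAs_lin a hx hy.
split; first by case: (L2U_subspace k Om).
exists 0; apply/(relAs_single A Omfin).
by apply: (adjoint_rel0 hG hE); split.
Qed.

Lemma opA0_U v : HA A Om v -> L2U (opA0 v).
Proof. by move=> /HA_distr[]. Qed.

Lemma H0AP (v : E) : H0A A Om v <->
  HA A Om v /\ forall w, HAs A Om w -> BG (opA0 v) w = BE v (opAs0 w).
Proof.
split=> -[hv h]; split; [exact: hv|move=> w hw|exact: hv|].
  have := congr1 (fun g => g w) h; rewrite /gammaA_Gamma /functional_on patchE mem_set//.
  by move=> /eqP; rewrite subr_eq0 => /eqP.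
apply/funext => w; rewrite /gammaA_Gamma /functional_on patchE; case: ifPn => //.
by rewrite inE => hw; apply/eqP; rewrite subr_eq0; apply/eqP; exact: h.
Qed.

Lemma H0A_subspace : is_subspace (H0A A Om).
Proof.
split.
  apply/H0AP; split; first by case: HA_subspace.
  move=> w hw; have [z0 zE] := distr_HA ((relA_single A Omfin _ _).1 (adjoint_rel0 hE hG (L2U_subspace k Om) _)).
  by rewrite zE (ip0l hE)// (ip0l hG).
move=> a x y /H0AP[hx x0] /H0AP[hy y0]; have [hxy xyE] := HA_lin a hx hy.
apply/H0AP; split=> // w hw; rewrite xyE (ip_lin hE)// (ip_lin hG)//.
by rewrite x0// y0.
Qed.

Lemma H0A_HA v : H0A A Om v -> HA A Om v. Proof. by case. Qed.

Lemma op_single v : op (relA A (single Om)) v = opA0 v.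
Proof.
rewrite /op /opA0 /weakA; congr (xget 0); apply/seteqP.
by split=> g /(relA_single A Omfin).
Qed.

Definition gA0 (x y : E) : R := BE x y + BG (opA0 x) (opA0 y).
Definition gAs0 (x y : G) : R := BG x y + BE (opAs0 x) (opAs0 y).

Lemma gA0E : gA0 = graph_ip BE BG (relA A (single Om)).
Proof. by apply/funext => x; apply/funext => y; rewrite /gA0 /graph_ip !op_single. Qed.

Let sTOm i := @single_sub R n Om i.
Let sdisj := @single_disj R n Om.
Let snull := single_null Om.

Lemma HA_dom v : HA A Om v <-> dom (relA A (single Om)) v.
Proof. by split=> -[g h]; exists g; apply/(relA_single A Omfin). Qed.

Lemma gA0_semi_ip : semi_ip (HA A Om) gA0.
Proof.
rewrite gA0E; apply: (graph_semi_ip hE hG (@relA_lin _ _ _ A Om _ (single Om))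
  (relA_uniqT Omfin sTOm sdisj snull) HA_subspace).
by move=> v /HA_dom.
Qed.

Lemma gAs0_semi_ip : semi_ip (HAs A Om) gAs0.
Proof.
split; first exact: HAs_subspace.
- move=> a x y z hx hy hz; have [_ E1] := HAs_lin a hx hy; rewrite /gAs0 E1.
  by rewrite (ip_lin hE a I I I) (ip_lin hG a I I I) addrACA -mulrDr.
- by move=> x y _ _; rewrite /gAs0 (ip_sym hE)// (ip_sym hG).
- by move=> x _; rewrite addr_ge0 ?(ip_ge0 hE)// (ip_ge0 hG).
Qed.

Lemma gA0_semi_ip0 : semi_ip (H0A A Om) gA0.
Proof.
have h := gA0_semi_ip; split; first exact: H0A_subspace.
- by move=> a x y z /H0A_HA hx /H0A_HA hy /H0A_HA hz; exact: (ip_lin h).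
- by move=> x y /H0A_HA hx /H0A_HA hy; exact: (ip_sym h).
- by move=> x /H0A_HA hx; exact: (ip_ge0 h).
Qed.

(** [H0A] is the common kernel of the functionals v |-> (A v, w) - (v, A^* w), each continuous for
    the graph norm, hence closed in the domain of the closed operator A. *)
Lemma gA0_complete : fast_complete (H0A A Om) gA0.
Proof.
have h0 := gA0_semi_ip.
have domH x : H0A A Om x -> HA A Om x := @H0A_HA x.
rewrite gA0E; apply: (graph_complete hE hG (@relA_lin _ _ _ A Om _ (single Om))
  (relA_uniqT Omfin sTOm sdisj snull)).
- by move=> v /H0A_HA/HA_dom.
- exact: L2_complete.
- exact: L2mx_complete.
- exact: relA_closed.
rewrite -gA0E => x /HA_dom hx h; apply/H0AP; split=> // w hw.
apply/eqP; rewrite -subr_eq0 -normr_eq0 eq_le normr_ge0 andbT.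
apply: (@le0_of_geometric _ _ (nrm BG w + nrm BE (opAs0 w))) => m.
have e0 : 0 < 2^-1 ^+ m :> R by rewrite exprn_gt0// invr_gt0.
have [y y0 xy] := h _ e0; have [hy /(_ _ hw) yw] := (H0AP y).1 y0.
have [hd dE] := HA_lin (-1) hy hx.
have xyE : x - y = -1 *: y + x by rewrite scaleN1r addrC.
have -> : BG (opA0 x) w - BE x (opAs0 w) = BG (opA0 (x - y)) w - BE (x - y) (opAs0 w).
  by rewrite xyE dE !(ip_lin hG, ip_lin hE)// yw; ring.
have n1 : nrm BE (x - y) <= nrm gA0 (x - y) by rewrite ler_wsqrtr// lerDl (ip_ge0 hG).
have n2 : nrm BG (opA0 (x - y)) <= nrm gA0 (x - y) by rewrite ler_wsqrtr// lerDr (ip_ge0 hE).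
apply: le_trans (ler_normB _ _) _; rewrite mulrDl; apply: lerD.
  apply: le_trans (cauchy_schwarz hG I I) _; rewrite mulrC ler_wpM2l ?nrm_ge0//.
  exact: le_trans n2 (ltW xy).
apply: le_trans (cauchy_schwarz hE I I) _; rewrite mulrC ler_wpM2l ?nrm_ge0//.
exact: le_trans n1 (ltW xy).
Qed.

Lemma normA_gA0 v : normA A v = nrm gA0 v.
Proof.
by rewrite /normA /nrm /gA0 norm2E norm2UE (nrm_sqr hE)// (nrm_sqr hG).
Qed.

Lemma normAs_gAs0 w : normAs A w = nrm gAs0 w.
Proof.
by rewrite /normAs /nrm /gAs0 norm2E norm2UE (nrm_sqr hE)// (nrm_sqr hG).
Qed.

(** U-valued test functions belong to [HAs], so the identity against [HAs] contains the
    distributional one. *)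
Lemma maximal_A (v : E) (g : G) : L2U g ->
  (forall w, HAs A Om w -> BG g w = BE v (opAs0 w)) -> HA A Om v /\ opA0 v = g.
Proof.
move=> gU h; apply: distr_HA; apply/(relA_single A Omfin); split=> // p [i [F [tF ->]]] /=.
have tF' : test_functionU Om F by [].
have [hw <-] := distr_HAs (test_HAs A Omfin tF').1 (test_distrAs A Omfin tF'); exact: h.
Qed.

(** Scalar test functions lie in [H0A]; testing on functions with zero trace is thus enough to
    determine A^* w. *)
Lemma maximal_As (w : G) (g : E) : L2U w ->
  (forall v, H0A A Om v -> BE g v = BG w (opA0 v)) -> HAs A Om w /\ opAs0 w = g.
Proof.
move=> wU h; apply: distr_HAs => //; apply/(relAs_single A Omfin); split=> // p [i [f [tf ->]]] /=.
have tf' : test_function Om f by [].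
have [_ <-] := distr_HA (test_distrA A Omfin tf'); apply: h; exact: test_H0A.
Qed.

Section Mesh.
Variables (N : nat) (T : 'I_N -> opens R n).
Hypotheses (TOm : forall i, T i `<=` Om) (disjT : trivIset setT (fun i => T i : set Rd))
  (nullT : leb (Om `\` \bigcup_i T i) = 0%E).

Lemma opAT_HA v : HA A Om v -> opAT A T v = opA0 v.
Proof.
move=> /HA_distr/(relA_mesh Omfin TOm) h; apply: opE h.
exact: (relA_uniqT Omfin TOm disjT nullT).
Qed.

Lemma opAsT_HAs w : HAs A Om w -> opAsT A T w = opAs0 w.
Proof.
move=> hw; have h := relAs_mesh Omfin TOm (HAs_distr hw).
apply: (opE (relAsU_uniq Omfin TOm disjT nullT)); split=> //; exact: hw.1.
Qed.
End Mesh.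
End GlobalOperators.

Lemma sum4_eq0 (R : realDomainType) (a b c d : R) : 0 <= a -> 0 <= b -> 0 <= c -> 0 <= d ->
  0 = a + b + c + d -> [/\ a = 0, b = 0, c = 0 & d = 0].
Proof. by move=> *; split; lra. Qed.

(** * Trace norms, and continuity and stability of the bilinear form *)

Section TraceSpaces.
Context {R : realType} {n : nat} {k : Ukind} (A : diffop R n k).
Local Notation Rd := 'rV[R]_n.+1.
Local Notation leb := (@leb R n).
Variables (Om : opens R n) (Omfin : (leb Om < +oo)%E).
Local Notation E := (L2 Om).
Local Notation G := (L2mx k Om).
Local Notation BE := (@ipL2 R n Om).
Local Notation BG := (@ipL2mx R n k Om).
Let hE := L2_semi_ip Om.
Let hG := L2mx_semi_ip k Om.
Variables (N : nat) (T : 'I_N -> opens R n).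
Hypotheses (TOm : forall i, T i `<=` Om) (disjT : trivIset setT (fun i => T i : set Rd))
  (nullT : leb (Om `\` \bigcup_i T i) = 0%E).
Variables (HtA : set E) (HtAs : set G).
Hypotheses (clA : closed_subspace (normAT A T) (HAT A Om T) HtA)
  (clAs : closed_subspace (normAsT A T) (HAsT A Om T) HtAs)
  (H0HtA : H0A A Om `<=` HtA) (HAsHtAs : HAs A Om `<=` HtAs).

Local Notation AT := (opAT A T).
Local Notation AsT := (opAsT A T).
Local Notation A0 := (@opA0 R n k A Om).
Local Notation As0 := (@opAs0 R n k A Om).
Local Notation gam := (@gammaA_S R n k A Om N T HtAs).
Local Notation gams := (@gammaAs_S R n k A Om N T HtA).

Lemma HtA_HAT v : HtA v -> HAT A Om T v. Proof. by case: clA => _ h _ /h. Qed.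
Lemma HtAs_HAsT w : HtAs w -> HAsT A Om T w. Proof. by case: clAs => _ h _ /h. Qed.
Lemma HtAs_U w : HtAs w -> L2U w. Proof. by move=> /HtAs_HAsT[]. Qed.

Lemma gammaA_SE v w : HtAs w -> gam v w = BG (A0 v) w - BE v (AsT w).
Proof.
move=> hw; rewrite /gammaA_S /functional_on patchE mem_set//.
by rewrite (ipT_AsE Omfin TOm disjT nullT v (HtAs_HAsT hw)).
Qed.

Lemma gammaAs_SE w v : HtA v -> gams w v = BE (As0 w) v - BG w (AT v).
Proof.
move=> hv; rewrite /gammaAs_S /functional_on patchE mem_set//.
by rewrite (ipT_AE Omfin TOm disjT nullT w (HtA_HAT hv)).
Qed.

Lemma gammaA_S_out v w : ~ HtAs w -> gam v w = 0.
Proof. by move=> h; rewrite /gammaA_S /functional_on patchE memNset. Qed.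

Lemma gammaAs_S_out w v : ~ HtA v -> gams w v = 0.
Proof. by move=> h; rewrite /gammaAs_S /functional_on patchE memNset. Qed.

Lemma gammaA_S_lin a x y : HA A Om x -> HA A Om y ->
  gam (a *: x + y) = a *: gam x + gam y.
Proof.
move=> hx hy; apply/funext => w.
rewrite -[RHS]/(a * (gam x w : R) + (gam y w : R)).
have [hw|hw] := pselect (HtAs w); last by rewrite !gammaA_S_out// mulr0 addr0.
have [_ E1] := HA_lin Omfin a hx hy; rewrite !gammaA_SE// E1.
rewrite (ip_lin hG a I I I) (ip_lin hE a I I I).
move: (BG (A0 x) w) (BG (A0 y) w) (BE x (AsT w)) (BE y (AsT w)) => p1 p2 p3 p4; ring.
Qed.

Lemma gammaAs_S_lin a x y : HAs A Om x -> HAs A Om y ->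
  gams (a *: x + y) = a *: gams x + gams y.
Proof.
move=> hx hy; apply/funext => v.
rewrite -[RHS]/(a * (gams x v : R) + (gams y v : R)).
have [hv|hv] := pselect (HtA v); last by rewrite !gammaAs_S_out// mulr0 addr0.
have [_ E1] := HAs_lin Omfin a hx hy; rewrite !gammaAs_SE// E1.
rewrite (ip_lin hG a I I I) (ip_lin hE a I I I).
move: (BE (As0 x) v) (BE (As0 y) v) (BG x (AT v)) (BG y (AT v)) => p1 p2 p3 p4; ring.
Qed.

Let normA_ge0 (v : E) : 0 <= normA A v. Proof. exact: sqrtr_ge0. Qed.
Let normAs_ge0 (w : G) : 0 <= normAs A w. Proof. exact: sqrtr_ge0. Qed.

Let normAD (x y : E) : HA A Om x -> HA A Om y -> normA A (x + y) <= normA A x + normA A y.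
Proof. by move=> hx hy; rewrite !normA_gA0; exact: (nrmD (gA0_semi_ip A Omfin)). Qed.

Let normAsD (x y : G) : HAs A Om x -> HAs A Om y ->
  normAs A (x + y) <= normAs A x + normAs A y.
Proof. by move=> hx hy; rewrite !normAs_gAs0; exact: (nrmD (gAs0_semi_ip A Omfin)). Qed.

Let normAN (x : E) : HA A Om x -> normA A (- x) = normA A x.
Proof. by move=> hx; rewrite !normA_gA0; exact: (nrmN (gA0_semi_ip A Omfin)). Qed.

Let normAsN (x : G) : HAs A Om x -> normAs A (- x) = normAs A x.
Proof. by move=> hx; rewrite !normAs_gAs0; exact: (nrmN (gAs0_semi_ip A Omfin)). Qed.

Lemma normA_S_ge0 phi : 0 <= normA_S A T HtAs phi.
Proof. exact: (quotient_norm_ge0 (HA A Om) gam normA_ge0 phi). Qed.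

Lemma normAs_S_ge0 psi : 0 <= normAs_S A T HtA psi.
Proof. exact: (quotient_norm_ge0 (HAs A Om) gams normAs_ge0 psi). Qed.

Lemma normA_S_le v : HA A Om v -> normA_S A T HtAs (gam v) <= normA A v.
Proof. exact: (quotient_norm_le gam normA_ge0). Qed.

Lemma normAs_S_le w : HAs A Om w -> normAs_S A T HtA (gams w) <= normAs A w.
Proof. exact: (quotient_norm_le gams normAs_ge0). Qed.

Lemma normA_SD x y : HA A Om x -> HA A Om y ->
  normA_S A T HtAs (gam x + gam y) <= normA_S A T HtAs (gam x) + normA_S A T HtAs (gam y).
Proof. exact: (quotient_normD (HA_subspace A Omfin) normA_ge0 normAD gammaA_S_lin). Qed.

Lemma normAs_SD x y : HAs A Om x -> HAs A Om y ->
  normAs_S A T HtA (gams x + gams y) <= normAs_S A T HtA (gams x) + normAs_S A T HtA (gams y).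
Proof. exact: (quotient_normD (HAs_subspace A Omfin) normAs_ge0 normAsD gammaAs_S_lin). Qed.

Lemma normA_SN x : HA A Om x -> normA_S A T HtAs (- gam x) = normA_S A T HtAs (gam x).
Proof. exact: (quotient_normN (HA_subspace A Omfin) normA_ge0 normAN gammaA_S_lin). Qed.

Lemma normAs_SN x : HAs A Om x -> normAs_S A T HtA (- gams x) = normAs_S A T HtA (gams x).
Proof. exact: (quotient_normN (HAs_subspace A Omfin) normAs_ge0 normAsN gammaAs_S_lin). Qed.

(** The dual norm of a trace is at most its quotient norm. This gives both the continuity of the
    trace terms of [b] and the definiteness of the trace norm. *)
Lemma gammaA_S_bound x w : HA A Om x -> HtAs w ->
  `|gam x w| <= normA_S A T HtAs (gam x) * nrm (gipAs A T) w.
Proof.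
move=> hx hw; apply: (quotient_norm_bound (D := HA A Om)) => //; first exact: nrm_ge0.
by move=> v hv _; rewrite gammaA_SE// normA_gA0; exact: cauchy_schwarz_pair.
Qed.

Lemma gammaAs_S_bound x v : HAs A Om x -> HtA v ->
  `|gams x v| <= normAs_S A T HtA (gams x) * nrm (gipA A T) v.
Proof.
move=> hx hv; apply: (quotient_norm_bound (D := HAs A Om)) => //; first exact: nrm_ge0.
by move=> w hw _; rewrite gammaAs_SE// normAs_gAs0; exact: cauchy_schwarz_pair.
Qed.

Section Form.
Variables (C : Rd -> Umat R n k -> Umat R n k) (K : G -> G).
Hypothesis (hC : spd_tensor_field Om C).
Hypothesis (KP : forall w, L2U w -> [/\ L2U (K w), tensor_op C (K w) = w &
  forall z, ipU Om (fun x => tensor_inv C x (L2mxrep w x)) (L2mxrep z) = BG (K w) z]).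
Variables (c0 : R) (c0_gt0 : 0 < c0).
Hypothesis (Ccoer : forall w : G, L2U w -> c0 * BG w w <= BG (tensor_op C w) w).

Local Notation US := (UT A Om T HtA HtAs).
Local Notation VS := (VT HtA HtAs).
Local Notation b := (@bform R n k A Om N T C).
Local Notation nU := (@normUT R n k A Om N T HtA HtAs).

Lemma UTP (x : trial k Om) : US x <->
  [/\ L2U x.1.1.2, exists2 v, H0A A Om v & gam v = x.1.2 & exists2 w, HAs A Om w & gams w = x.2].
Proof. by case: x => [[[u w] phi] psi]; split=> -[h1 h2 h3]; split. Qed.

Lemma UT_subspace : is_subspace US.
Proof.
have s0 := H0A_subspace A Omfin; have ss := HAs_subspace A Omfin.
split.
  apply/UTP; split; first by case: (L2U_subspace k Om).
  - exists 0; first by case: s0.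
    have := gammaA_S_lin (-1) (sub0 (HA_subspace A Omfin)) (sub0 (HA_subspace A Omfin)).
    by rewrite scaler0 addr0 scaleN1r addNr.
  - exists 0; first by case: ss.
    have := gammaAs_S_lin (-1) (sub0 ss) (sub0 ss).
    by rewrite scaler0 addr0 scaleN1r addNr.
move=> a x y /UTP[x1 [v v0 vx] [w hw wx]] /UTP[y1 [v' v0' vy] [w' hw' wy]].
apply/UTP; rewrite -[(a *: x + y).1.1.2]/(a *: x.1.1.2 + y.1.1.2).
rewrite -[(a *: x + y).1.2]/(a *: x.1.2 + y.1.2) -[(a *: x + y).2]/(a *: x.2 + y.2).
split; first exact: ((L2U_subspace k Om).2 a _ _ x1 y1).
- exists (a *: v + v'); first by case: s0 => _; exact.
  by rewrite gammaA_S_lin; [rewrite vx vy|exact: H0A_HA|exact: H0A_HA].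
- exists (a *: w + w'); first by case: ss => _; exact.
  by rewrite gammaAs_S_lin// wx wy.
Qed.

Lemma bformE x y : US x -> VS y -> b x y =
  BG (K x.1.1.2) y.2 - BE x.1.1.1 (AsT y.2) - (x.1.2 y.2 : R) - BG x.1.1.2 (AT y.1) - (x.2 y.1 : R).
Proof.
case: x y => [[[u w] phi] psi] [du dw] [/= wU _ _] [/= hdu hdw].
have [_ _ KE] := KP wU; rewrite KE.
rewrite (ipT_AsE Omfin TOm disjT nullT _ (HtAs_HAsT hdw)).
by rewrite (ipT_AE Omfin TOm disjT nullT _ (HtA_HAT hdu)).
Qed.

(** [K] comes from a choice and its linearity is not recorded. Moved onto the test function, it
    leaves a pairing that is visibly linear in [w]. *)
Lemma K_sym w z : L2U w -> L2U z -> BG (K w) z = BG w (K z).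
Proof.
move=> wU zU; have [KwU CKw _] := KP wU; have [KzU CKz _] := KP zU.
by rewrite -{1}CKz -(tensor_op_sym hC KwU KzU) CKw.
Qed.

Lemma K_bound w : L2U w -> nrm BG (K w) <= c0^-1 * nrm BG w.
Proof.
move=> wU; have [KwU CKw _] := KP wU; rewrite ler_pdivlMl//.
have h := Ccoer KwU; rewrite CKw -(nrm_sqr hG)// in h.
have := nrm_ge0 (B := BG) (K w); rewrite le_eqVlt => /predU1P[<-|p0].
  by rewrite mulr0 nrm_ge0.
rewrite -(ler_pM2r p0) -mulrA -expr2; apply: le_trans h _.
exact: le_trans (ler_norm _) (cauchy_schwarz hG I I).
Qed.

Lemma bform_linl a x y v : US x -> US y -> VS v -> b (a *: x + y) v = a * b x v + b y v.
Proof.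
move=> Ux Uy Vv; have Uxy := UT_subspace.2 a _ _ Ux Uy.
rewrite (bformE Uxy Vv) (bformE Ux Vv) (bformE Uy Vv).
have [x1 _ _] := (UTP x).1 Ux; have [y1 _ _] := (UTP y).1 Uy.
have [/= V1 V2] := Vv; have v2U := HtAs_U V2.
have [xyU _ _] := (UTP _).1 Uxy.
rewrite (K_sym xyU v2U) (K_sym x1 v2U) (K_sym y1 v2U).
rewrite -[(a *: x + y).1.1.2]/(a *: x.1.1.2 + y.1.1.2).
rewrite -[((a *: x.1.2 + y.1.2) v.2 : R)]/(a * (x.1.2 v.2 : R) + (y.1.2 v.2 : R)).
rewrite -[((a *: x.2 + y.2) v.1 : R)]/(a * (x.2 v.1 : R) + (y.2 v.1 : R)).
rewrite !(ip_lin hG a I I I) (ip_lin hE a I I I).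
move: (BG _ _) (BG _ _) (BE _ _) (BE _ _) (BG _ _) (BG _ _) (x.1.2 v.2 : R) (y.1.2 v.2 : R)
  (x.2 v.1 : R) (y.2 v.1 : R) => *; ring.
Qed.

(** The trace components are given as functions; their linearity on the test space is read off from
    extensions [z] and [z']. *)
Lemma bform_linr a x v w : US x -> VS v -> VS w -> b x (a *: v + w) = a * b x v + b x w.
Proof.
move=> Ux [v1 v2] [w1 w2]; have [x1 [z z0 zx] [z' hz' zx']] := (UTP x).1 Ux.
have [sA _ _] := clA; have [sAs _ _] := clAs.
have V1 : HtA (a *: v.1 + w.1) by case: sA => _; exact.
have V2 : HtAs (a *: v.2 + w.2) by case: sAs => _; exact.
have Vvw : VS (a *: v + w) by split.
rewrite !bformE// -zx -zx'.
rewrite -[(a *: v + w).1]/(a *: v.1 + w.1) -[(a *: v + w).2]/(a *: v.2 + w.2).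
rewrite !gammaA_SE// !gammaAs_SE//.
rewrite (opAT_lin Omfin TOm disjT nullT a (HtA_HAT v1) (HtA_HAT w1)).
rewrite (opAsT_lin Omfin TOm disjT nullT a (HtAs_HAsT v2) (HtAs_HAsT w2)).
have lE y (p q : E) : BE y (a *: p + q) = a * BE y p + BE y q.
  by rewrite (ipDr hE)// (ipZr hE).
have lG y (p q : G) : BG y (a *: p + q) = a * BG y p + BG y q.
  by rewrite (ipDr hG)// (ipZr hG).
rewrite !lE !lG.
move: (BG (K _) v.2) (BG (K _) w.2) (BE _ (AsT v.2)) (BE _ (AsT w.2)) (BE _ (AsT v.2)) (BE _ (AsT w.2)).
move: (BG (A0 z) v.2) (BG (A0 z) w.2) (BG x.1.1.2 (AT v.1)) (BG x.1.1.2 (AT w.1)).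
move: (BE (As0 z') v.1) (BE (As0 z') w.1) (BG z' (AT v.1)) (BG z' (AT w.1)) => *; ring.
Qed.

Lemma ipVT_VS x y : VS x -> VS y ->
  ipVT A T x y = gipA A T x.1 y.1 + gipAs A T x.2 y.2.
Proof.
move=> [x1 x2] [y1 y2].
by apply: (ipVT_gip Omfin TOm disjT nullT); [exact: HtA_HAT|exact: HtA_HAT|exact: HtAs_HAsT|exact: HtAs_HAsT].
Qed.

Lemma ipVT_semi_ip : semi_ip VS (ipVT A T).
Proof.
have h1 := gipA_semi_ip Omfin TOm disjT nullT clA.
have h2 := gipAs_semi_ip Omfin TOm disjT nullT clAs.
have sV : is_subspace VS.
  split; first by split; [exact: sub0 (ip_sub h1)|exact: sub0 (ip_sub h2)].
  move=> a x y [x1 x2] [y1 y2].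
  by split; [exact: ((ip_sub h1).2 a _ _ x1 y1)|exact: ((ip_sub h2).2 a _ _ x2 y2)].
apply: SemiIp; first exact: sV.
- move=> a x y z Vx Vy Vz; have Vxy := sV.2 a _ _ Vx Vy.
  rewrite (ipVT_VS Vxy Vz) (ipVT_VS Vx Vz) (ipVT_VS Vy Vz); case: Vx Vy Vz => [x1 x2] [y1 y2] [z1 z2].
  rewrite -[(a *: x + y).1]/(a *: x.1 + y.1) -[(a *: x + y).2]/(a *: x.2 + y.2).
  by rewrite (ip_lin h1 a x1 y1 z1) (ip_lin h2 a x2 y2 z2) addrACA -mulrDr.
- move=> x y Vx Vy; rewrite (ipVT_VS Vx Vy) (ipVT_VS Vy Vx); case: Vx Vy => [x1 x2] [y1 y2].
  by rewrite (ip_sym h1 x1 y1) (ip_sym h2 x2 y2).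
- move=> x Vx; rewrite (ipVT_VS Vx Vx); case: Vx => [x1 x2].
  by rewrite addr_ge0 ?(ip_ge0 h1)// (ip_ge0 h2).
Qed.

Lemma ipVT_eq0 v : VS v -> ipVT A T v v = 0 -> v = 0.
Proof.
move=> Vv; rewrite ipVT_VS// /gipA /gipAs /graph_ip => h.
have e1 := ip_ge0 hE (x := v.1) I; have e2 := ip_ge0 hG (x := v.2) I.
have e3 := ip_ge0 hG (x := op (relA A T) v.1) I; have e4 := ip_ge0 hE (x := op (relAsU A T) v.2) I.
have v1 : v.1 = 0.
  by apply: ipL2_eq0; move: h e1 e2 e3 e4; move: (BE _ _) (BG _ _) (BG _ _) (BE _ _) => *; lra.
have v2 : v.2 = 0.
  by apply: ipL2mx_eq0; move: h e1 e2 e3 e4; move: (BE _ _) (BG _ _) (BG v.2 _) (BE _ _) => *; lra.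
by rewrite [v]surjective_pairing v1 v2.
Qed.

Lemma nrm_ipVT v : VS v -> nrm (ipVT A T) v = normVT A T v.
Proof.
move=> Vv; rewrite /nrm ipVT_VS// /normVT; case: Vv => [v1 v2].
rewrite (normAT_gip Omfin TOm disjT nullT (HtA_HAT v1)).
rewrite (normAsT_gip Omfin TOm disjT nullT (HtAs_HAsT v2)).
rewrite (nrm_sqr (gipA_semi_ip Omfin TOm disjT nullT clA) v1).
by rewrite (nrm_sqr (gipAs_semi_ip Omfin TOm disjT nullT clAs) v2).
Qed.

Lemma normUT_sqr x : nU x ^+ 2 = norm2 x.1.1.1 ^+ 2 + norm2U x.1.1.2 ^+ 2 +
  normA_S A T HtAs x.1.2 ^+ 2 + normAs_S A T HtA x.2 ^+ 2.
Proof. by case: x => [[[u w] phi] psi] /=; rewrite sqr_sqrtr// !addr_ge0 ?sqr_ge0. Qed.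

Lemma normUT_ge0 x : 0 <= nU x.
Proof. by case: x => [[[u w] phi] psi]; exact: sqrtr_ge0. Qed.

Lemma normUTN x : US x -> nU (- x) = nU x.
Proof.
move=> /UTP[x1 [v v0 vx] [w hw wx]]; apply/eqP.
rewrite -(eqrXn2 (n := 2))// ?normUT_ge0// !normUT_sqr; apply/eqP.
rewrite -[(- x).1.1.1]/(- x.1.1.1) -[(- x).1.1.2]/(- x.1.1.2) -[(- x).1.2]/(- x.1.2) -[(- x).2]/(- x.2).
rewrite !norm2E !norm2UE (nrmN hE)// (nrmN hG)// -vx -wx.
by rewrite normA_SN ?normAs_SN//; exact: H0A_HA.
Qed.

Lemma normUTD x y : US x -> US y -> nU (x + y) ^+ 2 <= 2 * nU x ^+ 2 + 2 * nU y ^+ 2.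
Proof.
move=> /UTP[x1 [v v0 vx] [w hw wx]] /UTP[y1 [v' v0' vy] [w' hw' wy]].
rewrite !normUT_sqr.
rewrite -[(x + y).1.1.1]/(x.1.1.1 + y.1.1.1) -[(x + y).1.1.2]/(x.1.1.2 + y.1.1.2).
rewrite -[(x + y).1.2]/(x.1.2 + y.1.2) -[(x + y).2]/(x.2 + y.2).
have sq (a p q : R) : 0 <= a -> a <= p + q -> a ^+ 2 <= 2 * p ^+ 2 + 2 * q ^+ 2.
  move=> a0 apq; apply: le_trans (sqrrD_le p q); rewrite ler_sqr ?nnegrE//.
  exact: le_trans a0 apq.
have h1 := sq _ _ _ (nrm_ge0 (B := BE) _) (nrmD hE (x := x.1.1.1) (y := y.1.1.1) I I).
have h2 := sq _ _ _ (nrm_ge0 (B := BG) _) (nrmD hG (x := x.1.1.2) (y := y.1.1.2) I I).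
have h3 := sq _ _ _ (normA_S_ge0 _) (normA_SD (H0A_HA v0) (H0A_HA v0')).
have h4 := sq _ _ _ (normAs_S_ge0 _) (normAs_SD hw hw').
rewrite vx vy in h3; rewrite wx wy in h4.
have h5 := lerD (lerD h1 h2) (lerD h3 h4); rewrite !norm2E !norm2UE addrA in h5 *.
apply: le_trans h5 _; rewrite le_eqVlt; apply/orP; left; apply/eqP.
move: (nrm BE x.1.1.1) (nrm BE y.1.1.1) (nrm BG x.1.1.2) (nrm BG y.1.1.2).
move: (normA_S A T HtAs x.1.2) (normA_S A T HtAs y.1.2) (normAs_S A T HtA x.2) (normAs_S A T HtA y.2) => *.
ring.
Qed.

(** For the trace components, a vanishing quotient norm forces every value of the functional to
    vanish by the trace bounds; outside the test space the value is 0 by the encoding. *)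
Lemma normUT_eq0 x : US x -> nU x = 0 -> x = 0.
Proof.
move=> /UTP[x1 [v v0 vx] [w hw wx]] x0.
have := normUT_sqr x; rewrite x0 expr0n /= norm2E norm2UE.
move: (sqr_ge0 (nrm BE x.1.1.1)) (sqr_ge0 (nrm BG x.1.1.2)) (sqr_ge0 (normA_S A T HtAs x.1.2))
  (sqr_ge0 (normAs_S A T HtA x.2)) => a1 a2 a3 a4 s0.
have [e1 e2 e3' e4'] := sum4_eq0 a1 a2 a3 a4 s0.
have e3 : normA_S A T HtAs x.1.2 = 0 by apply/eqP; rewrite -sqrf_eq0 e3'.
have e4 : normAs_S A T HtA x.2 = 0 by apply/eqP; rewrite -sqrf_eq0 e4'.
have u0 : x.1.1.1 = 0 by apply: ipL2_eq0; rewrite -(nrm_sqr hE).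
have w0 : x.1.1.2 = 0 by apply: ipL2mx_eq0; rewrite -(nrm_sqr hG).
have p0 : x.1.2 = 0.
  rewrite -vx; apply/funext => d; have [hd|hd] := pselect (HtAs d); last exact: gammaA_S_out.
  have := gammaA_S_bound (H0A_HA v0) hd; rewrite vx e3 mul0r normr_le0 => /eqP.
  by move=> ->.
have q0 : x.2 = 0.
  rewrite -wx; apply/funext => d; have [hd|hd] := pselect (HtA d); last exact: gammaAs_S_out.
  have := gammaAs_S_bound hw hd; rewrite wx e4 mul0r normr_le0 => /eqP.
  by move=> ->.
by case: x u0 w0 p0 q0 {x0 vx wx a1 a2 a3 a4 s0 e1 e2 e3 e4 e3' e4' x1} => [[[u z] phi] psi] /= -> -> -> ->.
Qed.

(** The term with the inverse tensor contributes [c0^-1], and each of the other four terms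
    contributes 1, every component norm being at most the whole norm. *)
Lemma bform_bound x v : US x -> VS v ->
  `|b x v| <= (c0^-1 + 4) * nU x * nrm (ipVT A T) v.
Proof.
move=> Ux Vv; have [x1 [z z0 zx] [z' hz' zx']] := (UTP x).1 Ux.
have hV := ipVT_semi_ip; have [V1 V2] := Vv.
have h1 := gipA_semi_ip Omfin TOm disjT nullT clA.
have h2 := gipAs_semi_ip Omfin TOm disjT nullT clAs.
have le_sq (p q : R) : 0 <= q -> p ^+ 2 <= q ^+ 2 -> p <= q.
  move=> q0; have [p0|p0] := leP 0 p; first by rewrite ler_sqr ?nnegrE.
  by move=> _; exact: le_trans (ltW p0) q0.
have X0 := normUT_ge0 x; have Y0 := nrm_ge0 (B := ipVT A T) v.
have Xsq := normUT_sqr x; rewrite norm2E norm2UE in Xsq.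
have [s1 s2 s3 s4] := And4 (sqr_ge0 (nrm BE x.1.1.1)) (sqr_ge0 (nrm BG x.1.1.2))
  (sqr_ge0 (normA_S A T HtAs x.1.2)) (sqr_ge0 (normAs_S A T HtA x.2)).
have [u1 u2 u3 u4] : [/\ nrm BE x.1.1.1 <= nU x, nrm BG x.1.1.2 <= nU x,
    normA_S A T HtAs x.1.2 <= nU x & normAs_S A T HtA x.2 <= nU x].
  move: Xsq s1 s2 s3 s4 X0.
  move: (nU x) (nrm BE _) (nrm BG _) (normA_S _ _ _ _) (normAs_S _ _ _ _) => X a1 a2 a3 a4 Xsq *.
  by split; apply: le_sq => //; rewrite Xsq; lra.
have Ysq := nrm_sqr hV Vv; rewrite (ipVT_VS Vv Vv) in Ysq.
have g1 := ip_ge0 h1 V1; have g2 := ip_ge0 h2 V2.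
have [y1 y2] : nrm (gipA A T) v.1 <= nrm (ipVT A T) v /\ nrm (gipAs A T) v.2 <= nrm (ipVT A T) v.
  by split; apply: le_sq => //; rewrite Ysq ?(nrm_sqr h1 V1) ?(nrm_sqr h2 V2) ?lerDl ?lerDr.
have n1 : nrm BG (AT v.1) <= nrm (ipVT A T) v := le_trans (graph_nrm_ge_op _ hE _ _) y1.
have n2 : nrm BE (AsT v.2) <= nrm (ipVT A T) v := le_trans (graph_nrm_ge_op _ hG _ _) y2.
have n3 : nrm BG v.2 <= nrm (ipVT A T) v := le_trans (graph_nrm_ge _ hE _ _) y2.
have xw : `|(x.1.2 v.2 : R)| <= nU x * nrm (ipVT A T) v.
  rewrite -zx; apply: le_trans (gammaA_S_bound (H0A_HA z0) V2) _.
  by rewrite zx ler_pM ?normA_S_ge0 ?nrm_ge0.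
have xv : `|(x.2 v.1 : R)| <= nU x * nrm (ipVT A T) v.
  rewrite -zx'; apply: le_trans (gammaAs_S_bound hz' V1) _.
  by rewrite zx' ler_pM ?normAs_S_ge0 ?nrm_ge0.
have b1 : `|BG (K x.1.1.2) v.2| <= c0^-1 * nU x * nrm (ipVT A T) v.
  apply: le_trans (cauchy_schwarz hG I I) _; rewrite ler_pM ?nrm_ge0//.
  by apply: le_trans (K_bound x1) _; rewrite ler_wpM2l// invr_ge0 ltW.
have b2 : `|BE x.1.1.1 (AsT v.2)| <= nU x * nrm (ipVT A T) v.
  by apply: le_trans (cauchy_schwarz hE I I) _; rewrite ler_pM ?nrm_ge0.
have b3 : `|BG x.1.1.2 (AT v.1)| <= nU x * nrm (ipVT A T) v.
  by apply: le_trans (cauchy_schwarz hG I I) _; rewrite ler_pM ?nrm_ge0.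
rewrite (bformE Ux Vv).
have -> : (c0^-1 + 4) * nU x * nrm (ipVT A T) v = c0^-1 * nU x * nrm (ipVT A T) v +
    nU x * nrm (ipVT A T) v + nU x * nrm (ipVT A T) v + nU x * nrm (ipVT A T) v +
    nU x * nrm (ipVT A T) v by ring.
do 4! (apply: le_trans (ler_normB _ _) _; apply: lerD => //).
Qed.

Variables (CPF c1 : R).
Hypotheses (CPF_gt0 : 0 < CPF) (c1_gt0 : 0 < c1)
  (poincare : forall v, H0A A Om v -> nrm BE v <= CPF * nrm BG (A0 v))
  (Cbound : forall w : G, L2U w -> nrm BG (tensor_op C w) <= c1 * nrm BG w).

(** [infsup_abstract] for the concrete operators. The extensions [v1] and [w1] have the traces of
    the trial function, so their graph norms dominate the quotient norms and [s] dominates the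
    squared trial norm. *)
Lemma bform_infsup x : US x -> exists v s, [/\ VS v, nU x ^+ 2 <= s, s <= b x v &
  ipVT A T v v <= infsup_const CPF c0 c1 * s].
Proof.
move=> Ux; have [x1 [z z0 zx] [z' hz' zx']] := (UTP x).1 Ux.
have [sA _ _] := clA; have [sAs _ _] := clAs.
have K1 w : L2U w -> L2U (K w) by move=> /KP[].
have K2 w : L2U w -> tensor_op C (K w) = w by move=> /KP[].
have AT1 v : H0A A Om v -> AT v = A0 v.
  by move=> /H0A_HA hv; exact: (opAT_HA Omfin TOm disjT nullT hv).
have AsT1 w : HAs A Om w -> AsT w = As0 w by exact: (opAsT_HAs Omfin TOm disjT nullT).
have ATU v : HtA v -> L2U (AT v) by move=> /HtA_HAT; exact: (opAT_U Omfin TOm disjT).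
have Alin a p q : H0A A Om p -> H0A A Om q -> A0 (a *: p + q) = a *: A0 p + A0 q.
  by move=> /H0A_HA hp /H0A_HA hq; have [] := HA_lin Omfin a hp hq.
have ATlin a p q : HtA p -> HtA q -> AT (a *: p + q) = a *: AT p + AT q.
  by move=> /HtA_HAT hp /HtA_HAT hq; exact: opAT_lin.
have AsTlin a p q : HtAs p -> HtAs q -> AsT (a *: p + q) = a *: AsT p + AsT q.
  by move=> /HtAs_HAsT hp /HtAs_HAsT hq; exact: opAsT_lin.
have A0U v : H0A A Om v -> L2U (A0 v) by move=> /H0A_HA; exact: opA0_U.
have adj v w : H0A A Om v -> HAs A Om w -> BG (A0 v) w = BE v (As0 w).
  by move=> /H0AP[_]; exact.
have [du [dw [v1 [w1 [[hdu hdw hv1 hw1] e1 e2]]]]] := infsup_abstract hE hG (L2U_subspace k Om)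
  (H0A_subspace A Omfin) sA sAs HtAs_U HAsHtAs H0HtA Alin A0U ATU ATlin AsTlin AT1 AsT1
  (gipA_semi_ip Omfin TOm disjT nullT clA) (gipAs_semi_ip Omfin TOm disjT nullT clAs)
  (gA0_semi_ip0 A Omfin) (@gA0_complete _ _ _ A _ Omfin)
  (gipA_complete Omfin TOm disjT nullT clA) (gipAs_complete Omfin TOm disjT nullT clAs)
  adj (maximal_A Omfin) (maximal_As Omfin) CPF_gt0 c0_gt0 c1_gt0 poincare
  (tensor_opU hC) (tensor_op_lin hC) (tensor_op_sym hC) Cbound Ccoer K1 K2 z0 hz' x.1.1.1 x1.
set s := (X in let s := X in _); move=> [sb sn].
have Vd : VS (du, dw) by split.
exists (du, dw), s; split; first exact: Vd.
- have g1 : gam v1 = x.1.2.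
    rewrite -zx; apply/funext => d; have [hd|hd] := pselect (HtAs d).
      by rewrite (gammaA_SE v1 hd) (gammaA_SE z hd); exact: e1.
    by rewrite (gammaA_S_out v1 hd) (gammaA_S_out z hd).
  have g2 : gams w1 = x.2.
    rewrite -zx'; apply/funext => d; have [hd|hd] := pselect (HtA d).
      by rewrite (gammaAs_SE w1 hd) (gammaAs_SE z' hd); exact: e2.
    by rewrite (gammaAs_S_out w1 hd) (gammaAs_S_out z' hd).
  have l1 := normA_S_le hv1; have l2 := normAs_S_le hw1; rewrite g1 in l1; rewrite g2 in l2.
  rewrite normUT_sqr /s norm2E norm2UE (nrm_sqr hE (x := x.1.1.1) I) (nrm_sqr hG (x := x.1.1.2) I).
  have n1 : BE v1 v1 + BG (A0 v1) (A0 v1) = normA A v1 ^+ 2.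
    by rewrite normA_gA0 (nrm_sqr (gA0_semi_ip A Omfin) hv1).
  have n2 : BG w1 w1 + BE (As0 w1) (As0 w1) = normAs A w1 ^+ 2.
    by rewrite normAs_gAs0 (nrm_sqr (gAs0_semi_ip A Omfin) hw1).
  rewrite n1 n2; apply: lerD; first apply: lerD => //.
    by rewrite ler_sqr ?nnegrE ?normA_S_ge0.
  by rewrite ler_sqr ?nnegrE ?normAs_S_ge0.
- rewrite (bformE Ux Vd) -zx -zx' (gammaA_SE z hdw) (gammaAs_SE z' hdu); exact: sb.
- rewrite (ipVT_VS Vd Vd); exact: sn.
Qed.

End Form.
End TraceSpaces.

Lemma Lf_lin (R : realType) (n : nat) (k : Ukind) (Om : opens R n) (f : L2 Om) a
    (v w : test k Om) : Lf f (a *: v + w) = a * Lf f v + Lf f w.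
Proof.
have LE (x : test k Om) : Lf f x = - ipL2 f x.1 by [].
have hE := L2_semi_ip Om.
rewrite !LE -[(a *: v + w).1]/(a *: v.1 + w.1) (ipDr hE)// (ipZr hE)//.
by rewrite opprD mulrN.
Qed.

Theorem theorem7 (R : realType) (n : nat) (k : Ukind)
  (Om : opens R n) (hOm : bounded_lipschitz_domain Om)
  (A : diffop R n k)
  (C : 'rV[R]_n.+1 -> Umat R n k -> Umat R n k) (hC : spd_tensor_field Om C)
  (CPF cis CF : R) (hCPF : 0 < CPF) (hcis : 0 < cis) (hCF : 0 < CF)
  (poincare : forall v : L2 Om, H0A A Om v ->
     norm2 v <= CPF * norm2U (weakA A Om v))
  (infsup : forall v : L2 Om,
     cis * norm2 v <=
     sup [set ip Om (weakAs A Om (L2mxrep w)) v |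
            w in [set w : L2mx k Om | HAs A Om w /\ normAs A w = 1]]) :
  exists2 Cst : R, 0 < Cst &
  forall (N : nat) (T : 'I_N -> opens R n) (hT : regular_mesh Om T)
    (HtA : set (L2 Om)) (HtAs : set (L2mx k Om))
    (hHtA : closed_subspace (normAT A T) (HAT A Om T) HtA)
    (hHtAs : closed_subspace (normAsT A T) (HAsT A Om T) HtAs)
    (hH0A : H0A A Om `<=` HtA) (hHAs : HAs A Om `<=` HtAs)
    (f : L2 Om) (Vh : set (test k Om)) (Uh : set (trial k Om))
    (hVh : finite_dim_subspace (VT HtA HtAs) Vh)
    (hUh : finite_dim_subspace (UT A Om T HtA HtAs) Uh)
    (F : test k Om -> test k Om)
    (hFVh : forall v, VT HtA HtAs v -> Vh (F v))
    (hFb : forall du v, Uh du -> VT HtA HtAs v -> bform A T C du (v - F v) = 0)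
    (hFn : forall v, VT HtA HtAs v -> normVT A T (F v) <= CF * normVT A T v),
  (exists! p : test k Om * trial k Om,
     mixed_scheme A T C f Vh Uh p.1 p.2) /\
  (forall (u : L2 Om) (w : L2mx k Om) (phi : L2mx k Om -> R^o)
      (psi : L2 Om -> R^o),
    UT A Om T HtA HtAs (u, w, phi, psi) ->
    (forall dv, VT HtA HtAs dv ->
       bform A T C ((u, w, phi, psi) : trial k Om) dv = Lf f dv) ->
    forall (vh : test k Om) (uh : L2 Om) (wh : L2mx k Om)
      (phih : L2mx k Om -> R^o) (psih : L2 Om -> R^o),
    mixed_scheme A T C f Vh Uh vh (uh, wh, phih, psih) ->
    normUT A T HtA HtAs
      (((u, w, phi, psi) : trial k Om) - (uh, wh, phih, psih)) ^+ 2 =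
      norm2 (u - uh) ^+ 2 + norm2U (w - wh) ^+ 2 +
      normA_S A T HtAs (phi - phih) ^+ 2 +
      normAs_S A T HtA (psi - psih) ^+ 2 /\
    forall ww : trial k Om, Uh ww ->
      normUT A T HtA HtAs
        (((u, w, phi, psi) : trial k Om) - (uh, wh, phih, psih)) ^+ 2 <=
      Cst * normUT A T HtA HtAs (((u, w, phi, psi) : trial k Om) - ww) ^+ 2).
Proof.
have Omfin : (leb Om < +oo)%E by apply: leb_bounded; case: hOm.
have [c0 c00 c0P] := tensor_op_coercive hC.
have [c1 c10 c1P] := tensor_op_bounded hC.
have [K KP] := tensor_inv_op Omfin hC.
pose M := c0^-1 + 4; pose K2 := infsup_const CPF c0 c1.
have M0 : 0 <= M by rewrite addr_ge0// invr_ge0 ltW.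
have K0 : 0 <= K2 by exact: infsup_const_ge0.
(* Fixed before the mesh, the load and the discrete spaces are introduced: it is built from [CPF],
   [CF] and the bounds [c0], [c1] of the tensor. *)
exists (quasi_const M K2 CF).
  rewrite /quasi_const; have h : 0 <= M ^+ 2 * CF ^+ 2 * K2.
    by rewrite mulr_ge0// mulr_ge0// sqr_ge0.
  by move: h; move: (M ^+ 2 * _ * _) => Z h; lra.
move=> N T hT HtA HtAs clA clAs hH0 hHs f Vh Uh [VhV [p [e Ve]]] [UhU [q [g Ug]]] F FVh Fb Fn.
(* The mesh enters the estimates through disjoint elements inside the domain and a null skeleton. *)
have [polyT disjT _ _] := hT; have nullT := leb_skeleton hT.
have TOm i : T i `<=` Om by case: (polyT i).
have hV := ipVT_semi_ip Omfin TOm disjT nullT clA clAs.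
have sU := UT_subspace Omfin TOm disjT nullT clA clAs.
have V0 := ipVT_eq0 Omfin TOm disjT nullT clA clAs.
have U0 := normUT_eq0 Omfin TOm disjT nullT clA clAs.
have UD := normUTD Omfin TOm disjT nullT clA clAs.
have UN := normUTN Omfin TOm disjT nullT clA clAs.
have bl := bform_linl Omfin TOm disjT nullT clA clAs hC KP.
have br := bform_linr Omfin TOm disjT nullT clA clAs KP.
have bM := bform_bound Omfin TOm disjT nullT clA clAs KP c00 c0P.
have bI := bform_infsup Omfin TOm disjT nullT clA clAs hH0 hHs hC KP c00 c0P hCPF c10 poincare c1P.
have nV := nrm_ipVT Omfin TOm disjT nullT clA clAs.
have Fn' v : VT HtA HtAs v -> nrm (ipVT A T) (F v) <= CF * nrm (ipVT A T) v.
  by move=> Vv; rewrite (nV _ Vv) (nV _ (VhV _ (FVh _ Vv))); exact: Fn.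
subst Vh Uh.
split; first exact: (scheme_unique_exists sU hV V0 U0 bl br bI VhV UhU FVh Fb (fun a v w _ _ => Lf_lin f a v w)).
move=> u w phi psi Uu bu vh uh wh phih psih sh; split; first exact: normUT_sqr.
move=> ww Uww.
exact: (quasi_optimal sU hV (@normUT_ge0 _ _ _ A Om N T HtA HtAs) UN UD M0 K0 (ltW hCF) bl br bM bI
  VhV UhU FVh Fb Fn' Uu bu sh Uww).
Qed.
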